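(* Consider the planar piecewise linear system with real parameters $(\gamma_L,\gamma_R,b,x_L,x_R)$ $$\begin{cases}\dot x=2\gamma_L x-y-b,\\ \dot y=(1+\gamma_L^2)(x-x_L),\end{cases}\ \text{if } x\le 0,\qquad \begin{cases}\dot x=2\gamma_R x-y+b,\\ \dot y=(1+\gamma_R^2)(x-x_R),\end{cases}\ \text{if } x>0,$$ and put $y_L=2\gamma_Lx_L-b$, $y_R=2\gamma_Rx_R+b$. The system undergoes a degenerate Hopf bifurcation at infinity for $\gamma_L+\gamma_R=0$, and the following statements hold. (a) If we take $\gamma_R$ as the only bifurcation parameter, assuming fixed values for the remaining parameters, and the condition $y_L-y_R\ne0$ (equivalently, $b-\gamma_L(x_L+x_R)\neq0$) holds, then one hyperbolic stable (unstable) limit cycle bifurcates from infinity for $\gamma_L<-\gamma_R$ ($\gamma_L>-\gamma_R$) provided that $y_L-y_R<0$ ($y_L-y_R>0$). (b) If we take $(\gamma_R,b)$ as bifurcation parameters, assuming fixed values for the remaining parameters, and the condition $x_L^2-x_R^2\ne0$ holds, then the critical point $(\gamma_R,b)=(-\gamma_L,\gamma_L(x_L+x_R))$ is a bifurcation point of co-dimension two. Consequently, up to $2$ limit cycles can bifurcate from infinity. (c) If we assume fixed values for $\gamma_L\neq0$ and $x_L\ne0$, then within the three-parameter space $(\gamma_R,b,x_R)$ the critical point $(\gamma_R,b,x_R)=(-\gamma_L,2\gamma_Lx_L,x_L)$ is a bifurcation point of co-dimension three. In particular, up to three limit cycles can bifurcate from infinity, so that in a neighborhood of such a critical point there are parameter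 values for which the system exhibits $3$ limit cycles of big amplitude.
   Context: On $\Sigma=\{x=0\}$ the system is understood with the Filippov convention; orbits far from the origin cross $\Sigma$. The linear parts have eigenvalues $\gamma_L\pm i$, $\gamma_R\pm i$, and $(x_L,y_L)$, $(x_R,y_R)$ are the equilibria of the left and right linear systems. In (a), the conditions on $y_L-y_R$ refer to the critical value $\gamma_R=-\gamma_L$, where $y_R-y_L=2(b-\gamma_L(x_L+x_R))$. Half-return maps. For $y_0>0$ large, the orbit of the left system starting at $(0,y_0)$ reaches, forward in time through $x\le0$, a point $(0,y_1)$ with $y_1<0$; the orbit of the right system through $(0,y_0)$ reaches, backward in time through $x\ge0$, a point $(0,y_2)$ with $y_2<0$. For $u_0=1/y_0>0$ small put $L(u_0)=1/y_1$, $R(u_0)=1/y_2$ and define the displacement map $\Delta(u_0)=L(u_0)-R(u_0)$. These maps extend analytically to $u_0=0$ with value $0$ there, and $\Delta(u_0)=\Delta_1u_0+\Delta_2u_0^2+\Delta_3u_0^3+\cdots$, with coefficients depending on the parameters. The value $u_0=0$ represents the periodic orbit at infinity; positive zeros of $\Delta$ near $0$ correspond one-to-one to crossing periodic orbits near infinity. The periodic orbit at infinity is non-hyperbolic when $\Delta_1=0$. The degenerate Hopf bifurcation at infinity refers to this loss of hyperbolicity of the periodic orbit at infinity and the corresponding birth of limit cycles from it. Limit cycles bifurcating from infinity (of big amplitude) are isolated crossing periodic orbits corresponding to isolated positive zeros of $\Delta$ tending to $u_0=0$ as the parameters tend to the critical value; hyperbolic means the zero is simple.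
   Formalization: In (b) the hypothesis γ_L≠0 is added: if γ_L=0, the critical point is (γ_R,b)=(0,0), where all half-orbits are circular arcs centred on the x-axis, so Δ vanishes identically and the co-dimension is not two, whatever x_L, x_R. *)

(* Defs.v *)
From Stdlib Require Import Reals List ClassicalEpsilon.
From Coquelicot Require Import Coquelicot.
Open Scope R_scope.

Record params : Type := Params {
  gamma_L : R;
  gamma_R : R;
  offset : R; (* the parameter b *)
  x_L : R;
  x_R : R
}.

Definition y_L (p : params) : R := 2 * gamma_L p * x_L p - offset p.
Definition y_R (p : params) : R := 2 * gamma_R p * x_R p + offset p.

Definition left_field (p : params) (x y : R) : R * R :=
  (2 * gamma_L p * x - y - offset p, (1 + gamma_L p ^ 2) * (x - x_L p)).

Definition right_field (p : params) (x y : R) : R * R :=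
  (2 * gamma_R p * x - y + offset p, (1 + gamma_R p ^ 2) * (x - x_R p)).

(* Both fields are affine, so their maximal solutions are defined on all of R. *)
Definition is_orbit (f : R -> R -> R * R) (x y : R -> R) : Prop :=
  forall t, is_derive x t (fst (f (x t) (y t))) /\
            is_derive y t (snd (f (x t) (y t))).

Definition left_half_return (p : params) (y0 y1 : R) : Prop :=
  0 < y0 /\ y1 < 0 /\
  exists (x y : R -> R) (T : R),
    is_orbit (left_field p) x y /\ x 0 = 0 /\ y 0 = y0 /\
    0 < T /\ (forall t, 0 < t < T -> x t < 0) /\ x T = 0 /\ y T = y1.

(* The right orbit is followed backward in time. *)
Definition right_half_return (p : params) (y0 y2 : R) : Prop :=
  0 < y0 /\ y2 < 0 /\
  exists (x y : R -> R) (T : R),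
    is_orbit (right_field p) x y /\ x 0 = 0 /\ y 0 = y0 /\
    0 < T /\ (forall t, - T < t < 0 -> 0 < x t) /\ x (- T) = 0 /\ y (- T) = y2.

(* The half-return relations are functional: an orbit has at most one first
   return.  [epsilon] selects the return point when it exists; the values of
   [Lmap], [Rmap] and [Delta] are meaningful only then. *)
Definition Lmap (p : params) (u0 : R) : R :=
  / epsilon (inhabits 0) (left_half_return p (/ u0)).

Definition Rmap (p : params) (u0 : R) : R :=
  / epsilon (inhabits 0) (right_half_return p (/ u0)).

Definition Delta (p : params) (u0 : R) : R := Lmap p u0 - Rmap p u0.

(* [a] is the sequence of Taylor coefficients at 0 of the analytic extension
   of [Delta p], so that [a k] is Delta_k; it is unique when it exists. *)
Definition displacement_series (p : params) (a : nat -> R) : Prop :=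
  a 0%nat = 0 /\
  exists r, 0 < r /\
    forall u, 0 < u < r ->
      (exists y1, left_half_return p (/ u) y1) /\
      (exists y2, right_half_return p (/ u) y2) /\
      is_pseries a u (Delta p u).

Definition infinity_hyperbolic (p : params) : Prop :=
  exists a, displacement_series p a /\ a 1%nat <> 0.

Definition infinity_nonhyperbolic (p : params) : Prop :=
  exists a, displacement_series p a /\ a 1%nat = 0.

(* Filippov convention: (0, y) is a crossing point when the horizontal
   components of both fields have the same strict sign there. *)
Definition crossing_point (p : params) (y : R) : Prop :=
  0 < fst (left_field p 0 y) * fst (right_field p 0 y).

(* The closed orbit through (0, 1/u) made of a left arc and a right arc. *)
Definition crossing_periodic_orbit (p : params) (u : R) : Prop :=
  0 < u /\
  exists y1, left_half_return p (/ u) y1 /\ right_half_return p (/ u) y1 /\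
             crossing_point p (/ u) /\ crossing_point p y1.

Definition limit_cycle (p : params) (u : R) : Prop :=
  crossing_periodic_orbit p u /\
  exists eps, 0 < eps /\
    forall v, Rabs (v - u) < eps -> crossing_periodic_orbit p v -> v = u.

Definition hyperbolic_cycle (p : params) (u : R) : Prop :=
  exists d, is_derive (Delta p) u d /\ d <> 0.

(* Graph of the Poincare map of the half-line {x = 0, y > 0}, in the
   coordinate u = 1/y: a forward left arc followed by a forward right arc. *)
Definition return_map (p : params) (u u' : R) : Prop :=
  0 < u /\ 0 < u' /\
  exists y1, left_half_return p (/ u) y1 /\ right_half_return p (/ u') y1.

(* Asymptotic stability of [u0] under iteration of the map with graph [F]. *)
Definition asymptotically_stable (F : R -> R -> Prop) (u0 : R) : Prop :=
  forall eps, 0 < eps -> exists delta, 0 < delta /\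
    forall u, Rabs (u - u0) < delta ->
      exists s : nat -> R, s 0%nat = u /\
        (forall n, F (s n) (s (S n)) /\ Rabs (s n - u0) < eps) /\
        is_lim_seq s u0.

Definition stable_cycle (p : params) (u : R) : Prop :=
  asymptotically_stable (return_map p) u.

(* Unstable is taken in the sense of repelling: asymptotically stable for the
   reversed time. *)
Definition unstable_cycle (p : params) (u : R) : Prop :=
  asymptotically_stable (fun v v' => return_map p v' v) u.

(* In the one-parameter family [fam], a single limit cycle, hyperbolic and of
   stability type [st], emerges from infinity on the side [side] of [m0], and
   none exists near infinity at [m0] or on the other side. *)
Definition one_cycle_bifurcates_from_infinity
    (fam : R -> params) (m0 : R) (side : R -> Prop)
    (st : params -> R -> Prop) : Prop :=
  exists (eps r : R) (u : R -> R),
    0 < eps /\ 0 < r /\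
    (forall m, Rabs (m - m0) < eps -> side m ->
       0 < u m < r /\ limit_cycle (fam m) (u m) /\
       hyperbolic_cycle (fam m) (u m) /\ st (fam m) (u m) /\
       forall v, 0 < v < r -> limit_cycle (fam m) v -> v = u m) /\
    filterlim u (within side (locally m0)) (locally 0) /\
    (forall m, Rabs (m - m0) < eps -> ~ side m ->
       forall v, 0 < v < r -> ~ limit_cycle (fam m) v).

Definition params_close (eta : R) (p q : params) : Prop :=
  Rabs (gamma_L q - gamma_L p) < eta /\ Rabs (gamma_R q - gamma_R p) < eta /\
  Rabs (offset q - offset p) < eta /\
  Rabs (x_L q - x_L p) < eta /\ Rabs (x_R q - x_R p) < eta.

(* Loss of hyperbolicity of the periodic orbit at infinity, and birth of limit
   cycles from it under arbitrarily small changes of the parameters. *)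
Definition degenerate_hopf_at_infinity (p : params) : Prop :=
  infinity_nonhyperbolic p /\
  forall eta r, 0 < eta -> 0 < r ->
    exists q u, params_close eta p q /\ 0 < u < r /\ limit_cycle q u.

(* Degeneracy of order exactly k: Delta_1 = ... = Delta_k = 0 <> Delta_{k+1} at
   [mu0], unfolded transversally by the parameters: the differential of
   mu |-> (Delta_1, ..., Delta_k) at [mu0] is onto R^k (equivalently, for a
   k-dimensional [U], its Jacobian matrix is nonsingular). *)
Definition codimension_bifurcation_point {U : NormedModule R_AbsRing}
    (k : nat) (fam : U -> params) (mu0 : U) : Prop :=
  exists D : U -> nat -> R,
    (forall mu, displacement_series (fam mu) (D mu)) /\
    (forall i, (1 <= i <= k)%nat -> D mu0 i = 0) /\
    D mu0 (S k) <> 0 /\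
    exists l : nat -> U -> R,
      (forall i, (1 <= i <= k)%nat ->
         filterdiff (fun mu => D mu i) (locally mu0) (l i)) /\
      (forall c : nat -> R, exists v : U,
         forall i, (1 <= i <= k)%nat -> l i v = c i).

Definition big_limit_cycles (p : params) (r : R) (us : list R) : Prop :=
  NoDup us /\ forall u, In u us -> 0 < u < r /\ limit_cycle p u.

(* The maximal number of limit cycles bifurcating from infinity is k. *)
Definition up_to_cycles_bifurcate {U : UniformSpace}
    (k : nat) (fam : U -> params) (mu0 : U) : Prop :=
  (exists r, 0 < r /\
     locally mu0 (fun mu =>
       forall us, big_limit_cycles (fam mu) r us -> (length us <= k)%nat)) /\
  (forall (r : R) (N : U -> Prop), 0 < r -> locally mu0 N ->
     exists mu us, N mu /\ big_limit_cycles (fam mu) r us /\ length us = k).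

(* Main.v *)
Require Import Defs.
From Stdlib Require Import Reals Ranalysis5 List Permutation Lra Lia ClassicalEpsilon.
From Coquelicot Require Import Coquelicot.
Open Scope R_scope.

(* In u = 1/y both half-return maps have the form u w(u), where w solves a regular
   polynomial differential equation with w(0) = - exp(-pi gamma); the right map is
   the left one for the mirrored parameters (-gamma_R, -b, -x_R).  The formal power
   series solution converges with bounds uniform for bounded parameters, and the
   first integral of the focus identifies its sum with the half-return map.  Hence
   Delta(u) = u * gap(u), where gap = w_L - w_R is a power series with uniformly
   bounded, continuous coefficients and explicit first four coefficients.  Rolle's
   theorem bounds the number of zeros of gap by the order of its first nonzero
   coefficient at the critical point; perturbing the lower coefficients one after
   another, with alternating signs, produces that many zeros. *)

(** * Power series *)

(** All claims concern a full neighbourhood of a parameter value, so radii and bounds have to be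
    common to all parameters of absolute value at most some K; hence convergence is proved by a norm
    estimate with explicit constants ([half_radius], [half_domain]). The differential equation alone
    does not determine the half-return map: w(0) is free in it, and it is the half turn by the angle
    pi in the first integral that selects - exp (- pi gamma). Since Delta = u gap, the coefficient
    Delta_(k+1) of the statement is coefficient k of [gap_series]. When gamma_R = - gamma_L the
    right data are (gamma_L, - b, - x_R), and changing the signs of b and x amounts to u -> - u in
    the half series; so for x_R = x_L the gap is twice the odd part of the left series, which
    explains the third degeneracy. Cycles are produced from strict signs at finitely many points
    rather than from simple zeros: such signs survive perturbation at once. *)

Definition causal (Phi : (nat -> R) -> nat -> R) : Prop :=
  forall a b n, (forall k, (k < n)%nat -> a k = b k) -> Phi a n = Phi b n.

Fixpoint causal_iter (Phi : (nat -> R) -> nat -> R) (k : nat) : nat -> R :=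
  match k with O => fun _ => 0 | S k => Phi (causal_iter Phi k) end.

(** The diagonal of the iterates: coefficient n is final after n + 1 iterations, so no limit is
    taken. *)
Definition causal_fixpoint (Phi : (nat -> R) -> nat -> R) (n : nat) : R :=
  causal_iter Phi (S n) n.

Lemma causal_iter_stable (Phi : (nat -> R) -> nat -> R) (k : nat) :
  causal Phi -> forall n, (n < k)%nat -> causal_iter Phi k n = causal_fixpoint Phi n.
Proof.
intros HP.
assert (Hs : forall k n, (n < k)%nat -> causal_iter Phi (S k) n = causal_iter Phi k n).
{ induction k0 as [|k0 IH]; intros n Hn; [lia|].
  simpl. apply HP. intros j Hj. apply IH. lia. }
induction k as [|k IH]; intros n Hn; [lia|].
destruct (Nat.eq_dec n k) as [->|Hne]; [reflexivity|].
rewrite Hs by lia. apply IH. lia.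
Qed.

Lemma causal_fixpoint_eq (Phi : (nat -> R) -> nat -> R) (n : nat) :
  causal Phi -> causal_fixpoint Phi n = Phi (causal_fixpoint Phi) n.
Proof.
intros HP. unfold causal_fixpoint at 1. simpl. apply HP.
intros k Hk. now apply causal_iter_stable.
Qed.

(** * Truncated weighted norms of coefficient sequences *)

Definition shift (a : nat -> R) (n : nat) : R :=
  match n with O => 0 | S n => a n end.

Definition unit_series (n : nat) : R := match n with O => 1 | S _ => 0 end.

(** Partial sum of a weighted l1 norm. Truncation keeps everything finite, so estimates can run by
    induction on N before convergence is known. *)
Definition trunc_norm (r : R) (a : nat -> R) (N : nat) : R :=
  sum_f_R0 (fun n => Rabs (a n) * r ^ n) N.

Lemma trunc_norm_nonneg (r : R) (a : nat -> R) (N : nat) :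
  0 <= r -> 0 <= trunc_norm r a N.
Proof.
intros Hr. apply cond_pos_sum. intros n.
apply Rmult_le_pos; [apply Rabs_pos | now apply pow_le].
Qed.

Lemma trunc_norm_le_S (r : R) (a : nat -> R) (N : nat) :
  0 <= r -> trunc_norm r a N <= trunc_norm r a (S N).
Proof.
intros Hr. unfold trunc_norm; simpl.
assert (0 <= Rabs (a (S N)) * (r * r ^ N)); [|lra].
apply Rmult_le_pos; [apply Rabs_pos | now apply (pow_le r (S N))].
Qed.

Lemma trunc_norm_term (r : R) (a : nat -> R) (n : nat) :
  0 <= r -> Rabs (a n) * r ^ n <= trunc_norm r a n.
Proof.
intros Hr. unfold trunc_norm. destruct n as [|n]; [simpl; lra|].
rewrite tech5. generalize (trunc_norm_nonneg r a n Hr). unfold trunc_norm. lra.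
Qed.

Lemma trunc_norm_plus (r : R) (a b : nat -> R) (N : nat) :
  0 <= r -> trunc_norm r (fun n => a n + b n) N <= trunc_norm r a N + trunc_norm r b N.
Proof.
intros Hr. unfold trunc_norm. rewrite <- plus_sum. apply sum_Rle. intros n _.
rewrite <- Rmult_plus_distr_r. apply Rmult_le_compat_r; [now apply pow_le|].
apply Rabs_triang.
Qed.

Lemma trunc_norm_minus (r : R) (a b : nat -> R) (N : nat) :
  0 <= r -> trunc_norm r (fun n => a n - b n) N <= trunc_norm r a N + trunc_norm r b N.
Proof.
intros Hr. unfold trunc_norm. rewrite <- plus_sum. apply sum_Rle. intros n _.
rewrite <- Rmult_plus_distr_r. apply Rmult_le_compat_r; [now apply pow_le|].
rewrite <- (Rabs_Ropp (b n)). apply Rabs_triang.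
Qed.

Lemma trunc_norm_scal (r c : R) (a : nat -> R) (N : nat) :
  trunc_norm r (fun n => c * a n) N = Rabs c * trunc_norm r a N.
Proof.
unfold trunc_norm. rewrite scal_sum. apply sum_eq. intros n _.
rewrite Rabs_mult. ring.
Qed.

Lemma trunc_norm_shift_S (r : R) (a : nat -> R) (N : nat) :
  trunc_norm r (shift a) (S N) = r * trunc_norm r a N.
Proof.
unfold trunc_norm. rewrite decomp_sum by lia. simpl.
rewrite Rabs_R0, scal_sum. rewrite Rmult_0_l, Rplus_0_l.
apply sum_eq. intros n _. ring.
Qed.

Lemma trunc_norm_shift (r : R) (a : nat -> R) (N : nat) :
  0 <= r -> trunc_norm r (shift a) N <= r * trunc_norm r a N.
Proof.
intros Hr. destruct N as [|N].
- unfold trunc_norm; simpl. rewrite Rabs_R0.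
  generalize (Rabs_pos (a 0%nat)); intros. nra.
- rewrite trunc_norm_shift_S. apply Rmult_le_compat_l; [easy|].
  now apply trunc_norm_le_S.
Qed.

Lemma trunc_norm_unit (r : R) (N : nat) : trunc_norm r unit_series N = 1.
Proof.
unfold trunc_norm. induction N as [|N IH]; simpl.
- rewrite Rabs_R1. ring.
- rewrite IH, Rabs_R0. ring.
Qed.

Lemma PS_mult_S (a b : nat -> R) (n : nat) :
  PS_mult a b (S n) = a 0%nat * b (S n) + PS_mult (fun k => a (S k)) b n.
Proof.
unfold PS_mult. rewrite decomp_sum by lia. reflexivity.
Qed.

(** Submultiplicativity survives truncation because a product term of total degree at most N only
    uses factors of degree at most N. The induction peels off [a 0] and treats the rest as a shifted
    series. *)
Lemma trunc_norm_mult (r : R) (a b : nat -> R) (N : nat) :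
  0 <= r -> trunc_norm r (PS_mult a b) N <= trunc_norm r a N * trunc_norm r b N.
Proof.
intros Hr. revert a. induction N as [|N IH]; intros a.
- unfold trunc_norm, PS_mult; simpl. rewrite Rabs_mult. lra.
- unfold trunc_norm. rewrite (decomp_sum (fun n => Rabs (PS_mult a b n) * r ^ n)) by lia.
  rewrite (decomp_sum (fun n => Rabs (a n) * r ^ n)) by lia. simpl pred.
  set (a' := fun k => a (S k)).
  assert (H1 : sum_f_R0 (fun i => Rabs (PS_mult a b (S i)) * r ^ S i) N <=
     Rabs (a 0%nat) * sum_f_R0 (fun i => Rabs (b (S i)) * r ^ S i) N +
     r * trunc_norm r (PS_mult a' b) N).
  { unfold trunc_norm. rewrite !scal_sum, <- plus_sum. apply sum_Rle. intros n _.
    rewrite PS_mult_S. fold a'.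
    apply Rle_trans with ((Rabs (a 0%nat) * Rabs (b (S n)) + Rabs (PS_mult a' b n)) * r ^ S n).
    - apply Rmult_le_compat_r; [now apply pow_le|].
      rewrite <- Rabs_mult. apply Rabs_triang.
    - simpl. right. ring. }
  specialize (IH a').
  assert (H2 : r * trunc_norm r (PS_mult a' b) N <=
     sum_f_R0 (fun i => Rabs (a (S i)) * r ^ S i) N * trunc_norm r b (S N)).
  { replace (sum_f_R0 (fun i => Rabs (a (S i)) * r ^ S i) N) with (r * trunc_norm r a' N).
    - rewrite Rmult_assoc. apply Rmult_le_compat_l; [easy|].
      eapply Rle_trans; [exact IH|].
      apply Rmult_le_compat_l; [now apply trunc_norm_nonneg | now apply trunc_norm_le_S].
    - unfold trunc_norm, a'. rewrite scal_sum. apply sum_eq. intros n _. simpl. ring. }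
  assert (H3 : trunc_norm r b (S N) =
     Rabs (b 0%nat) + sum_f_R0 (fun i => Rabs (b (S i)) * r ^ S i) N).
  { unfold trunc_norm. rewrite decomp_sum by lia. simpl. ring. }
  fold (trunc_norm r b (S N)).
  rewrite Rmult_plus_distr_r.
  replace (PS_mult a b 0) with (a 0%nat * b 0%nat) by reflexivity.
  rewrite Rabs_mult, H3 at 1. rewrite pow_O, Rmult_1_r, Rmult_1_r.
  lra.
Qed.

Definition geometric_bound (C rho : R) (a : nat -> R) : Prop :=
  forall n, Rabs (a n) * rho ^ n <= C.

Definition abs_summable (r : R) (a : nat -> R) : Prop :=
  exists M, forall N, trunc_norm r a N <= M.

Lemma abs_summable_mult (r : R) (a b : nat -> R) :
  0 <= r -> abs_summable r a -> abs_summable r b -> abs_summable r (PS_mult a b).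
Proof.
intros Hr [Ma Ha] [Mb Hb]. exists (Ma * Mb). intros N.
eapply Rle_trans; [now apply trunc_norm_mult|].
apply Rmult_le_compat; auto using trunc_norm_nonneg.
Qed.

Lemma abs_summable_plus (r : R) (a b : nat -> R) :
  0 <= r -> abs_summable r a -> abs_summable r b -> abs_summable r (fun n => a n + b n).
Proof.
intros Hr [Ma Ha] [Mb Hb]. exists (Ma + Mb). intros N.
eapply Rle_trans; [now apply trunc_norm_plus|]. apply Rplus_le_compat; auto.
Qed.

Lemma abs_summable_minus (r : R) (a b : nat -> R) :
  0 <= r -> abs_summable r a -> abs_summable r b -> abs_summable r (fun n => a n - b n).
Proof.
intros Hr [Ma Ha] [Mb Hb]. exists (Ma + Mb). intros N.
eapply Rle_trans; [now apply trunc_norm_minus|]. apply Rplus_le_compat; auto.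
Qed.

Lemma abs_summable_scal (r c : R) (a : nat -> R) :
  abs_summable r a -> abs_summable r (fun n => c * a n).
Proof.
intros [Ma Ha]. exists (Rabs c * Ma). intros N.
rewrite trunc_norm_scal. apply Rmult_le_compat_l; auto using Rabs_pos.
Qed.

Lemma abs_summable_shift (r : R) (a : nat -> R) :
  0 <= r -> abs_summable r a -> abs_summable r (shift a).
Proof.
intros Hr [Ma Ha]. exists (r * Ma). intros N.
eapply Rle_trans; [now apply trunc_norm_shift|]. apply Rmult_le_compat_l; auto.
Qed.

Lemma abs_summable_unit (r : R) : abs_summable r unit_series.
Proof. exists 1. intros N. rewrite trunc_norm_unit. lra. Qed.

Lemma CV_radius_geometric (C rho u : R) (a : nat -> R) :
  0 <= rho -> geometric_bound C rho a -> Rabs u < rho -> Rbar_lt (Rabs u) (CV_radius a).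
Proof.
intros Hr Hg Hu.
apply Rbar_lt_le_trans with (Finite rho); [exact Hu|].
apply (proj1 (CV_radius_bounded a)). exists C. intros n.
rewrite Rabs_mult, (Rabs_pos_eq (rho ^ n)) by now apply pow_le. apply Hg.
Qed.

Lemma abs_summable_geometric (r : R) (a : nat -> R) :
  0 <= r -> abs_summable r a -> exists C, geometric_bound C r a.
Proof.
intros Hr [M HM]. exists M. intros n.
eapply Rle_trans; [now apply trunc_norm_term | apply HM].
Qed.

Lemma CV_radius_summable (r u : R) (a : nat -> R) :
  abs_summable r a -> Rabs u < r -> Rbar_lt (Rabs u) (CV_radius a).
Proof.
intros Ha Hu.
assert (Hr : 0 <= r) by (generalize (Rabs_pos u); lra).
destruct (abs_summable_geometric r a Hr Ha) as [C HC].
now apply (CV_radius_geometric C r).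
Qed.

Lemma is_pseries_PSeries (a : nat -> R) (u : R) :
  Rbar_lt (Rabs u) (CV_radius a) -> is_pseries a u (PSeries a u).
Proof. intros H. apply PSeries_correct. now apply CV_radius_inside. Qed.

Lemma PSeries_shift (a : nat -> R) (u : R) : PSeries (shift a) u = u * PSeries a u.
Proof. rewrite <- PSeries_incr_1. apply PSeries_ext. now intros [|n]. Qed.

Lemma PSeries_unit (u : R) : PSeries unit_series u = 1.
Proof.
apply is_pseries_unique. unfold is_pseries.
apply is_series_Reals.
intros eps He. exists 0%nat. intros n _.
replace (sum_f_R0 _ n) with 1; [now rewrite Rdist_eq|].
induction n as [|n IH].
- simpl. unfold scal; simpl; unfold mult; simpl. unfold one; simpl. ring.
- rewrite tech5, <- IH. unfold scal; simpl; unfold mult; simpl. ring.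
Qed.

Lemma abs_summable_le (r r' : R) (a : nat -> R) :
  0 <= r' <= r -> abs_summable r a -> abs_summable r' a.
Proof.
intros Hr [M HM]. exists M. intros N. eapply Rle_trans; [|apply (HM N)].
apply sum_Rle. intros n _. apply Rmult_le_compat_l; [apply Rabs_pos|].
now apply pow_incr.
Qed.

(** Absolute summability at some radius beyond |u| travels with the value: unlike plain convergence
    at u it is stable under Cauchy products, so a differential equation can be summed term by
    term. *)
Definition has_sum (u : R) (a : nat -> R) (s : R) : Prop :=
  (exists r, Rabs u < r /\ abs_summable r a) /\ PSeries a u = s.

Lemma has_sum_radius (u s : R) (a : nat -> R) :
  has_sum u a s -> Rbar_lt (Rabs u) (CV_radius a).
Proof. intros [[r [Hu Ha]] _]. now apply (CV_radius_summable r). Qed.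

Lemma has_sum_intro (u : R) (a : nat -> R) :
  Rbar_lt (Rabs u) (CV_radius a) -> has_sum u a (PSeries a u).
Proof.
intros Hu. split; [|reflexivity].
assert (Hr : exists r, Rabs u < r /\ Rbar_lt r (CV_radius a)).
{ destruct (CV_radius a) as [c| |]; simpl in Hu.
  - exists ((Rabs u + c) / 2). simpl. lra.
  - exists (Rabs u + 1). simpl. split; [lra|easy].
  - easy. }
destruct Hr as [r [Hr1 Hr2]]. exists r. split; [easy|].
assert (Hr0 : 0 <= r) by (generalize (Rabs_pos u); lra).
assert (Hs : ex_series (fun n => Rabs (a n * r ^ n))).
{ apply CV_disk_inside. now rewrite Rabs_pos_eq. }
exists (Series (fun n => Rabs (a n * r ^ n))). intros N.
apply Series_correct in Hs.
eapply Rle_trans; [|apply (is_lim_seq_incr_compare _ _ Hs) with (n := N)].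
- rewrite sum_n_Reals. right. apply sum_eq. intros n _.
  now rewrite Rabs_mult, (Rabs_pos_eq (r ^ n)) by now apply pow_le.
- intros n. rewrite sum_Sn. unfold plus; simpl.
  generalize (Rabs_pos (a (S n) * (r * r ^ n))). lra.
Qed.

Lemma has_sum_minus (u s t : R) (a b : nat -> R) :
  has_sum u a s -> has_sum u b t -> has_sum u (fun n => a n - b n) (s - t).
Proof.
intros Ha Hb.
pose proof (has_sum_radius _ _ _ Ha) as Ra. pose proof (has_sum_radius _ _ _ Hb) as Rb.
destruct Ha as [[r [Hr Ha]] <-]. destruct Hb as [[r' [Hr' Hb]] <-].
generalize (Rabs_pos u); intros Hu. split.
- exists (Rmin r r'). split; [now apply Rmin_glb_lt|].
  assert (0 <= Rmin r r') by (apply Rmin_glb; lra).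
  apply abs_summable_minus; [easy| |].
  + apply abs_summable_le with r; [|easy]. split; [easy|apply Rmin_l].
  + apply abs_summable_le with r'; [|easy]. split; [easy|apply Rmin_r].
- apply is_pseries_unique.
  apply (is_pseries_minus a b u); now apply is_pseries_PSeries.
Qed.

Lemma has_sum_plus (u s t : R) (a b : nat -> R) :
  has_sum u a s -> has_sum u b t -> has_sum u (fun n => a n + b n) (s + t).
Proof.
intros Ha Hb.
pose proof (has_sum_radius _ _ _ Ha) as Ra. pose proof (has_sum_radius _ _ _ Hb) as Rb.
destruct Ha as [[r [Hr Ha]] <-]. destruct Hb as [[r' [Hr' Hb]] <-].
generalize (Rabs_pos u); intros Hu. split.
- exists (Rmin r r'). split; [now apply Rmin_glb_lt|].
  assert (0 <= Rmin r r') by (apply Rmin_glb; lra).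
  apply abs_summable_plus; [easy| |].
  + apply abs_summable_le with r; [|easy]. split; [easy|apply Rmin_l].
  + apply abs_summable_le with r'; [|easy]. split; [easy|apply Rmin_r].
- apply is_pseries_unique.
  apply (is_pseries_plus a b u); now apply is_pseries_PSeries.
Qed.

Lemma has_sum_mult (u s t : R) (a b : nat -> R) :
  has_sum u a s -> has_sum u b t -> has_sum u (PS_mult a b) (s * t).
Proof.
intros Ha Hb.
pose proof (has_sum_radius _ _ _ Ha) as Ra. pose proof (has_sum_radius _ _ _ Hb) as Rb.
destruct Ha as [[r [Hr Ha]] <-]. destruct Hb as [[r' [Hr' Hb]] <-].
generalize (Rabs_pos u); intros Hu. split; [|now apply PSeries_mult].
exists (Rmin r r'). split; [now apply Rmin_glb_lt|].
assert (0 <= Rmin r r') by (apply Rmin_glb; lra).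
apply abs_summable_mult; [easy| |].
+ apply abs_summable_le with r; [|easy]. split; [easy|apply Rmin_l].
+ apply abs_summable_le with r'; [|easy]. split; [easy|apply Rmin_r].
Qed.

Lemma has_sum_scal (u c s : R) (a : nat -> R) :
  has_sum u a s -> has_sum u (fun n => c * a n) (c * s).
Proof.
intros Ha. pose proof (has_sum_radius _ _ _ Ha) as Ra.
destruct Ha as [[r [Hr Ha]] <-]. split.
- exists r. split; [easy|]. now apply abs_summable_scal.
- apply (PSeries_scal c a u).
Qed.

Lemma has_sum_shift (u s : R) (a : nat -> R) :
  has_sum u a s -> has_sum u (shift a) (u * s).
Proof.
intros [[r [Hr Ha]] <-]. split; [|apply PSeries_shift].
exists r. split; [easy|]. apply abs_summable_shift; [|easy].
generalize (Rabs_pos u); lra.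
Qed.

Lemma has_sum_unit (u : R) : has_sum u unit_series 1.
Proof.
split; [|apply PSeries_unit].
exists (Rabs u + 1). split; [lra|apply abs_summable_unit].
Qed.

Lemma has_sum_unique (u s t : R) (a : nat -> R) :
  has_sum u a s -> has_sum u a t -> s = t.
Proof. now intros [_ <-] [_ <-]. Qed.

Lemma has_sum_ext (u s : R) (a b : nat -> R) :
  (forall n, a n = b n) -> has_sum u a s -> has_sum u b s.
Proof.
intros E [[r [Hr [M HM]]] <-]. split.
- exists r. split; [easy|]. exists M. intros N. rewrite <- (HM N).
  right. apply sum_eq. intros n _. now rewrite E.
- symmetry. now apply PSeries_ext.
Qed.

Lemma geometric_bound_decr (C rho : R) (a : nat -> R) :
  0 < rho -> geometric_bound C rho a -> geometric_bound (C / rho) rho (PS_decr_1 a).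
Proof.
intros Hr Ha n. unfold PS_decr_1. specialize (Ha (S n)).
apply Rmult_le_reg_r with rho; [easy|].
unfold Rdiv. rewrite (Rmult_assoc C), Rinv_l, Rmult_1_r by lra.
simpl in Ha. lra.
Qed.

(** At half the radius the terms are dominated by C / 2^n. *)
Lemma PSeries_bound (C rho u : R) (a : nat -> R) :
  0 < rho -> geometric_bound C rho a -> Rabs u <= rho / 2 -> Rabs (PSeries a u) <= 2 * C.
Proof.
intros Hr Ha Hu.
assert (Hq : 0 <= Rabs u / rho <= / 2).
{ split.
  - apply Rmult_le_pos; [apply Rabs_pos | left; now apply Rinv_0_lt_compat].
  - apply Rmult_le_reg_r with rho; [easy|]. unfold Rdiv.
    rewrite Rmult_assoc, Rinv_l; lra. }
assert (HC : 0 <= C) by (specialize (Ha 0%nat); generalize (Rabs_pos (a 0%nat)); simpl in Ha; lra).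
assert (Ht : forall n, 0 <= Rabs (a n * u ^ n) <= C * (/ 2) ^ n).
{ intros n. split; [apply Rabs_pos|].
  rewrite Rabs_mult, <- RPow_abs.
  replace (Rabs u ^ n) with (rho ^ n * (Rabs u / rho) ^ n).
  - rewrite <- Rmult_assoc. apply Rmult_le_compat.
    + apply Rmult_le_pos; [apply Rabs_pos | apply pow_le; lra].
    + apply pow_le. lra.
    + apply Ha.
    + apply pow_incr. easy.
  - rewrite <- Rpow_mult_distr. f_equal. field. lra. }
assert (Hg : ex_series (fun n => C * (/ 2) ^ n)).
{ apply (ex_series_scal (V := R_NormedModule) C (fun n => (/ 2) ^ n)). apply ex_series_geom. rewrite Rabs_pos_eq; lra. }
assert (Hs : ex_series (fun n => Rabs (a n * u ^ n))).
{ apply (ex_series_le (K := R_AbsRing) (V := R_CompleteNormedModule) _ (fun n => C * (/ 2) ^ n)); [|easy].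
  intros n. unfold norm; simpl. unfold abs; simpl. rewrite Rabs_Rabsolu. apply Ht. }
unfold PSeries. eapply Rle_trans; [now apply Series_Rabs|].
eapply Rle_trans; [apply Series_le; [apply Ht|apply Hg]|].
rewrite Series_scal_l, Series_geom by (rewrite Rabs_pos_eq; lra). lra.
Qed.

Lemma PSeries_near_0 (C rho u : R) (a : nat -> R) :
  0 < rho -> geometric_bound C rho a -> Rabs u <= rho / 2 ->
  Rabs (PSeries a u - a 0%nat) <= 2 * C / rho * Rabs u.
Proof.
intros Hr Ha Hu.
rewrite PSeries_decr_1.
2:{ apply CV_radius_inside, (CV_radius_geometric C rho); try easy; try lra. }
replace (a 0%nat + u * PSeries (PS_decr_1 a) u - a 0%nat) with (u * PSeries (PS_decr_1 a) u) by ring.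
rewrite Rabs_mult, Rmult_comm. apply Rmult_le_compat_r; [apply Rabs_pos|].
unfold Rdiv. rewrite Rmult_assoc. apply (PSeries_bound (C / rho) rho); auto.
now apply geometric_bound_decr.
Qed.

(** Halving the radius pays for the factor n + 1 <= 2^n. *)
Lemma geometric_bound_derive (C rho : R) (a : nat -> R) :
  0 < rho -> geometric_bound C rho a -> geometric_bound (C / rho) (rho / 2) (PS_derive a).
Proof.
intros Hr Ha n. unfold PS_derive. specialize (Ha (S n)).
assert (Hn : INR (S n) <= 2 ^ n).
{ clear. induction n as [|n IH]; [simpl; lra|].
  rewrite S_INR. assert (1 <= 2 ^ n) by (apply pow_R1_Rle; lra). simpl pow. lra. }
rewrite Rabs_mult, (Rabs_pos_eq (INR (S n))) by apply pos_INR.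
unfold Rdiv. rewrite Rpow_mult_distr, pow_inv.
apply Rmult_le_reg_r with rho; [easy|].
rewrite (Rmult_assoc C), Rinv_l, Rmult_1_r by lra.
assert (H2 : 0 < 2 ^ n) by (apply pow_lt; lra).
apply Rle_trans with (Rabs (a (S n)) * rho ^ S n * (INR (S n) * / 2 ^ n)).
- right. simpl pow. field. lra.
- rewrite <- (Rmult_1_r C). apply Rmult_le_compat; auto.
  + apply Rmult_le_pos; [apply Rabs_pos | apply pow_le; lra].
  + apply Rmult_le_pos; [apply pos_INR | left; now apply Rinv_0_lt_compat].
  + apply Rmult_le_reg_r with (2 ^ n); [easy|].
    rewrite Rmult_assoc, Rinv_l; lra.
Qed.

(** * The power series of the half-return map *)

(** In the coordinates centred at the focus where the linear part is a rotation times a dilation,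
    the point (0, y) of the section has components x and y - [center_y]; [modulus2] is the squared
    radius of (0, 0). *)
Definition center_y (g b x : R) : R := g * x - b.
Definition modulus2 (g b x : R) : R := x ^ 2 + (g * x - b) ^ 2.

(* With v = u w, the differential form u (1 + b v) Q(u) v' = v (1 + b u) Q(v) of the
   first integral, Q u = 1 - 2 bt u + d u^2, becomes, for e = b + 2 bt,
   w' (1 + b u w) Q(u) = w (w - 1) (- e + d u (1 + w) + b d u^2 w);
   [ode_low] is the series of ((1 + b u w) Q(u) - 1) / u. *)
Definition ode_rhs (e d b : R) (w : nat -> R) (n : nat) : R :=
  let w2 := PS_mult w w in
  let w3 := PS_mult w w2 in
  - e * (w2 n - w n) + shift (fun k => d * (w3 k - w k)) n
  + shift (shift (fun k => b * d * (w3 k - w2 k))) n.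

Definition ode_low (bt d b : R) (w : nat -> R) (n : nat) : R :=
  -2 * bt * unit_series n + shift (fun k => d * unit_series k) n
  + b * w n + shift (fun k => -2 * b * bt * w k) n
  + shift (shift (fun k => b * d * w k)) n.

(** Order m of the equation w' (1 + u low) = rhs, solved for coefficient m + 1; the factor u in
    front of low makes the recursion causal. *)
Definition ode_step (w0 e bt d b : R) (w : nat -> R) (n : nat) : R :=
  match n with
  | O => w0
  | S m => (ode_rhs e d b w m
            - shift (PS_mult (PS_derive w) (ode_low bt d b w)) m) / INR (S m)
  end.

Definition ode_series (w0 e bt d b : R) : nat -> R :=
  causal_fixpoint (ode_step w0 e bt d b).

Lemma PS_mult_ext_le (a a' b b' : nat -> R) (n : nat) :
  (forall k, (k <= n)%nat -> a k = a' k) -> (forall k, (k <= n)%nat -> b k = b' k) ->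
  PS_mult a b n = PS_mult a' b' n.
Proof.
intros Ha Hb. unfold PS_mult. apply sum_eq. intros k Hk.
rewrite Ha, Hb by lia. reflexivity.
Qed.

Lemma shift_ext_lt (a a' : nat -> R) (n : nat) :
  (forall k, (k < n)%nat -> a k = a' k) -> shift a n = shift a' n.
Proof. intros H. destruct n; simpl; [reflexivity|]. apply H. lia. Qed.

Lemma ode_step_causal (w0 e bt d b : R) : causal (ode_step w0 e bt d b).
Proof.
intros u v [|n] H; [reflexivity|]. unfold ode_step.
assert (H' : forall k, (k <= n)%nat -> u k = v k) by (intros; apply H; lia).
assert (H2 : forall k, (k <= n)%nat -> PS_mult u u k = PS_mult v v k).
{ intros k Hk. apply PS_mult_ext_le; intros; apply H'; lia. }
assert (H3 : forall k, (k <= n)%nat ->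
  PS_mult u (PS_mult u u) k = PS_mult v (PS_mult v v) k).
{ intros k Hk. apply PS_mult_ext_le; intros; [apply H'|apply H2]; lia. }
assert (HL : forall k, (k <= n)%nat -> ode_low bt d b u k = ode_low bt d b v k).
{ intros k Hk. unfold ode_low. rewrite H' by lia.
  f_equal; [f_equal|].
  - apply shift_ext_lt. intros. rewrite H' by lia. reflexivity.
  - apply shift_ext_lt. intros. apply shift_ext_lt. intros.
    rewrite H' by lia. reflexivity. }
f_equal. f_equal.
- unfold ode_rhs. rewrite H' by lia. rewrite H2 by lia. f_equal; [f_equal|].
  + apply shift_ext_lt. intros. rewrite H3, H' by lia. reflexivity.
  + apply shift_ext_lt. intros. apply shift_ext_lt. intros.
    rewrite H3, H2 by lia. reflexivity.
- apply shift_ext_lt. intros. apply PS_mult_ext_le; intros.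
  + unfold PS_derive. rewrite H by lia. reflexivity.
  + apply HL. lia.
Qed.

Lemma ode_series_0 (w0 e bt d b : R) : ode_series w0 e bt d b 0%nat = w0.
Proof. reflexivity. Qed.

Lemma ode_series_eq (w0 e bt d b : R) (n : nat) :
  let w := ode_series w0 e bt d b in
  PS_derive w n + shift (PS_mult (PS_derive w) (ode_low bt d b w)) n = ode_rhs e d b w n.
Proof.
intros w. unfold PS_derive at 1. unfold w at 1, ode_series at 1.
rewrite causal_fixpoint_eq by apply ode_step_causal.
fold (ode_series w0 e bt d b). fold w. unfold ode_step.
field. apply not_0_INR. lia.
Qed.

(* [j / (n + 1) <= 1] for [j <= n], so the term containing the derivative is
   dominated by a plain Cauchy product. *)
Lemma derive_mult_bound (r : R) (a f : nat -> R) (n : nat) :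
  0 <= r ->
  Rabs (PS_mult (PS_derive a) f n / INR (S (S n))) * r ^ S (S n) <=
  r * (PS_mult (fun k => Rabs (a (S k)) * r ^ S k) (fun k => Rabs (f k) * r ^ k) n).
Proof.
intros Hr.
assert (HI : 0 < INR (S (S n))) by (apply lt_0_INR; lia).
unfold Rdiv. rewrite Rabs_mult, (Rabs_pos_eq (/ INR (S (S n)))) by
  (left; now apply Rinv_0_lt_compat).
unfold PS_mult. rewrite scal_sum.
apply Rle_trans with (sum_f_R0 (fun k => Rabs (PS_derive a k * f (n - k)%nat)) n
   * (/ INR (S (S n)) * r ^ S (S n))).
- rewrite Rmult_assoc. apply Rmult_le_compat_r.
  + apply Rmult_le_pos; [left; now apply Rinv_0_lt_compat | now apply pow_le].
  + apply Rsum_abs.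
- rewrite Rmult_comm, scal_sum. apply sum_Rle. intros k Hk.
  unfold PS_derive. rewrite !Rabs_mult, (Rabs_pos_eq (INR (S k))) by apply pos_INR.
  replace (r ^ S (S n)) with (r * (r ^ S k * r ^ (n - k))).
  2:{ rewrite <- pow_add. replace (S k + (n - k))%nat with (S n) by lia. reflexivity. }
  replace (INR (S k) * Rabs (a (S k)) * Rabs (f (n - k)%nat) *
     (/ INR (S (S n)) * (r * (r ^ S k * r ^ (n - k)))))
   with ((INR (S k) * / INR (S (S n))) *
     (Rabs (a (S k)) * r ^ S k * (Rabs (f (n - k)%nat) * r ^ (n - k)) * r)) by ring.
  rewrite <- (Rmult_1_l (Rabs (a (S k)) * r ^ S k * _ * r)) at 2.
  apply Rmult_le_compat_r.
  + repeat apply Rmult_le_pos; auto using Rabs_pos, pow_le.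
  + apply Rmult_le_reg_r with (INR (S (S n))); [easy|].
    rewrite Rmult_assoc, Rinv_l, Rmult_1_r, Rmult_1_l by lra.
    apply le_INR. lia.
Qed.

(** The recursion in norm form. The factor r comes from passing from coefficient m to m + 1, and the
    derivative inside the product costs nothing thanks to the division by [INR (S m)]. *)
Lemma ode_series_norm_step (w0 e bt d b r : R) (N : nat) :
  0 <= r ->
  let w := ode_series w0 e bt d b in
  trunc_norm r w (S N) <=
  Rabs w0 + r * trunc_norm r (ode_rhs e d b w) N
  + r * (trunc_norm r w N * trunc_norm r (ode_low bt d b w) N).
Proof.
intros Hr w.
set (A := fun k => Rabs (w (S k)) * r ^ S k).
set (F := fun k => Rabs (ode_low bt d b w k) * r ^ k).
assert (HA : forall k, 0 <= A k) by
  (intros; apply Rmult_le_pos; [apply Rabs_pos | now apply pow_le]).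
assert (HF : forall k, 0 <= F k) by
  (intros; apply Rmult_le_pos; [apply Rabs_pos | now apply pow_le]).
assert (HAF : forall k, 0 <= PS_mult A F k).
{ intros k. unfold PS_mult. apply cond_pos_sum. intros j. now apply Rmult_le_pos. }
assert (Hterm : forall m, Rabs (w (S m)) * r ^ S m <=
  r * (Rabs (ode_rhs e d b w m) * r ^ m) + r * shift (PS_mult A F) m).
{ intros m.
  assert (Hw : w (S m) = ode_step w0 e bt d b w (S m)) by
    apply causal_fixpoint_eq, ode_step_causal.
  rewrite Hw. unfold ode_step.
  assert (HI : 1 <= INR (S m)).
  { rewrite S_INR. generalize (pos_INR m). lra. }
  assert (Hr' : Rabs (ode_rhs e d b w m / INR (S m)) * r ^ S m <=
     r * (Rabs (ode_rhs e d b w m) * r ^ m)).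
  { simpl pow. rewrite <- Rmult_assoc, (Rmult_comm _ r), Rmult_assoc.
    apply Rmult_le_compat_l; [easy|]. apply Rmult_le_compat_r; [now apply pow_le|].
    unfold Rdiv. rewrite Rabs_mult, (Rabs_pos_eq (/ INR (S m))) by
      (left; apply Rinv_0_lt_compat; lra).
    rewrite <- (Rmult_1_r (Rabs (ode_rhs e d b w m))) at 2.
    apply Rmult_le_compat_l; [apply Rabs_pos|].
    rewrite <- Rinv_1. apply Rinv_le_contravar; lra. }
  unfold Rdiv at 1. rewrite Rmult_minus_distr_r.
  eapply Rle_trans.
  { apply Rmult_le_compat_r; [now apply (pow_le r (S m))|].
    unfold Rminus. apply Rabs_triang. }
  rewrite Rmult_plus_distr_r. apply Rplus_le_compat; [exact Hr'|].
  rewrite Rabs_Ropp. destruct m as [|k].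
  - simpl shift. rewrite Rmult_0_l, Rabs_R0, Rmult_0_l, Rmult_0_r. lra.
  - now apply derive_mult_bound. }
assert (Hlow : trunc_norm r (ode_low bt d b w) N = sum_f_R0 F N) by reflexivity.
assert (Hsum : sum_f_R0 (shift (PS_mult A F)) N <=
  trunc_norm r w N * trunc_norm r (ode_low bt d b w) N).
{ rewrite Hlow. destruct N as [|N].
  - simpl. apply Rmult_le_pos; [now apply trunc_norm_nonneg|]. apply HF.
  - rewrite decomp_sum by lia. simpl pred. simpl shift.
    (* With weight 1 the norm of a nonnegative sequence is its plain sum, so [trunc_norm_mult]
       applies to [A] and [F] themselves. *)
    assert (E1 : forall (a : nat -> R) n, (forall k, 0 <= a k) ->
        trunc_norm 1 a n = sum_f_R0 a n).
    { intros a n Ha. apply sum_eq. intros k _.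
      rewrite Rabs_pos_eq by apply Ha. rewrite pow1. ring. }
    rewrite Rplus_0_l. rewrite <- E1 by apply HAF.
    eapply Rle_trans; [apply trunc_norm_mult; lra|].
    rewrite !E1 by easy.
    apply Rmult_le_compat; try (now apply cond_pos_sum).
    + unfold trunc_norm. rewrite (decomp_sum _ (S N)) by lia. simpl pred.
      fold A. assert (0 <= Rabs (w 0%nat) * r ^ 0); [|unfold A; lra].
      simpl. generalize (Rabs_pos (w 0%nat)). lra.
    + rewrite tech5. generalize (HF (S N)). lra. }
unfold trunc_norm at 1. rewrite decomp_sum by lia. simpl pred.
change (w 0%nat) with w0. rewrite pow_O, Rmult_1_r, Rplus_assoc.
apply Rplus_le_compat_l.
eapply Rle_trans; [apply sum_Rle; intros m _; apply Hterm|].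
rewrite plus_sum. apply Rplus_le_compat.
- unfold trunc_norm. rewrite scal_sum. right. apply sum_eq. intros; ring.
- rewrite <- (Rmult_comm _ r).
  replace (sum_f_R0 (fun l => r * shift (PS_mult A F) l) N) with
    (sum_f_R0 (shift (PS_mult A F)) N * r).
  + now apply Rmult_le_compat_r.
  + rewrite Rmult_comm, scal_sum. apply sum_eq. intros; ring.
Qed.

(** Each of the three groups is at most 2 H^2 X^3, since H and X are at least 1. *)
Lemma ode_rhs_norm (e d b r H X : R) (w : nat -> R) (N : nat) :
  0 <= r <= 1 -> 1 <= H -> Rabs e <= H -> Rabs d <= H -> Rabs b <= H ->
  trunc_norm r w N <= X -> 1 <= X ->
  trunc_norm r (ode_rhs e d b w) N <= 6 * H ^ 2 * X ^ 3.
Proof.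
intros Hr HH He Hd Hb HX HX1.
set (T := trunc_norm r w N) in *.
assert (HT : 0 <= T) by now apply trunc_norm_nonneg.
assert (H2 : trunc_norm r (PS_mult w w) N <= X * X).
{ eapply Rle_trans; [now apply trunc_norm_mult|]. now apply Rmult_le_compat. }
assert (H3 : trunc_norm r (PS_mult w (PS_mult w w)) N <= X * (X * X)).
{ eapply Rle_trans; [now apply trunc_norm_mult|].
  apply Rmult_le_compat; auto. now apply trunc_norm_nonneg. }
assert (P2 : 0 <= trunc_norm r (PS_mult w w) N) by now apply trunc_norm_nonneg.
assert (P3 : 0 <= trunc_norm r (PS_mult w (PS_mult w w)) N) by now apply trunc_norm_nonneg.
assert (Hsh : forall a n, trunc_norm r (shift a) n <= trunc_norm r a n).
{ intros a n. eapply Rle_trans; [now apply trunc_norm_shift|].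
  generalize (trunc_norm_nonneg r a n (proj1 Hr)). nra. }
unfold ode_rhs.
assert (T1 : trunc_norm r (fun n => - e * (PS_mult w w n - w n)) N <= H * (X * X + X)).
{ rewrite trunc_norm_scal, Rabs_Ropp. apply Rmult_le_compat; auto using Rabs_pos.
  - now apply trunc_norm_nonneg.
  - eapply Rle_trans; [now apply trunc_norm_minus|]. fold T. lra. }
assert (T2 : trunc_norm r (shift (fun k => d * (PS_mult w (PS_mult w w) k - w k))) N
   <= H * (X * (X * X) + X)).
{ eapply Rle_trans; [apply Hsh|].
  rewrite trunc_norm_scal. apply Rmult_le_compat; auto using Rabs_pos.
  - now apply trunc_norm_nonneg.
  - eapply Rle_trans; [now apply trunc_norm_minus|]. fold T. lra. }
assert (T3 : trunc_norm r (shift (shift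
    (fun k => b * d * (PS_mult w (PS_mult w w) k - PS_mult w w k)))) N
   <= H * H * (X * (X * X) + X * X)).
{ eapply Rle_trans; [apply Hsh|]. eapply Rle_trans; [apply Hsh|].
  rewrite trunc_norm_scal, Rabs_mult.
  apply Rmult_le_compat; auto using Rabs_pos, Rmult_le_pos.
  - now apply trunc_norm_nonneg.
  - apply Rmult_le_compat; auto using Rabs_pos.
  - eapply Rle_trans; [now apply trunc_norm_minus|]. lra. }
eapply Rle_trans; [now apply trunc_norm_plus|].
eapply Rle_trans.
{ apply Rplus_le_compat; [now apply trunc_norm_plus|apply T3]. }
assert (X <= X * X) by nra. assert (X * X <= X * (X * X)) by nra.
assert (H <= H * H) by nra.
apply Rle_trans with (H * (X * X + X) + H * (X * (X * X) + X) +
  H * H * (X * (X * X) + X * X)); [lra|].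
assert (K1 : H * (X * X + X) <= (H * H) * (2 * (X * (X * X)))) by
  (apply Rmult_le_compat; nra).
assert (K2 : H * (X * (X * X) + X) <= (H * H) * (2 * (X * (X * X)))) by
  (apply Rmult_le_compat; nra).
assert (K3 : H * H * (X * (X * X) + X * X) <= (H * H) * (2 * (X * (X * X)))) by
  (apply Rmult_le_compat; nra).
simpl pow. lra.
Qed.

(** The five terms contribute 2 + 1 + 1 + 2 + 1 multiples of H^2 X. *)
Lemma ode_low_norm (bt d b r H X : R) (w : nat -> R) (N : nat) :
  0 <= r <= 1 -> 1 <= H -> Rabs bt <= H -> Rabs d <= H -> Rabs b <= H ->
  trunc_norm r w N <= X -> 1 <= X ->
  trunc_norm r (ode_low bt d b w) N <= 7 * H ^ 2 * X.
Proof.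
intros Hr HH Ht Hd Hb HX HX1.
set (T := trunc_norm r w N) in *.
assert (HT : 0 <= T) by now apply trunc_norm_nonneg.
assert (Hsh : forall a n, trunc_norm r (shift a) n <= trunc_norm r a n).
{ intros a n. eapply Rle_trans; [now apply trunc_norm_shift|].
  generalize (trunc_norm_nonneg r a n (proj1 Hr)). nra. }
assert (R2 : Rabs (-2) = 2) by (rewrite Rabs_left; lra).
assert (HHH : H <= H * H) by nra.
assert (Hbt : Rabs b * Rabs bt <= H * H) by (apply Rmult_le_compat; auto using Rabs_pos).
assert (Hbd : Rabs b * Rabs d <= H * H) by (apply Rmult_le_compat; auto using Rabs_pos).
assert (T1 : trunc_norm r (fun n => -2 * bt * unit_series n) N <= 2 * H * H).
{ rewrite trunc_norm_scal, trunc_norm_unit, Rabs_mult, R2. nra. }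
assert (T2 : trunc_norm r (shift (fun k => d * unit_series k)) N <= H * H).
{ eapply Rle_trans; [apply Hsh|]. rewrite trunc_norm_scal, trunc_norm_unit. lra. }
assert (T3 : trunc_norm r (fun n => b * w n) N <= H * H * X).
{ rewrite trunc_norm_scal. fold T. apply Rmult_le_compat; auto using Rabs_pos. lra. }
assert (T4 : trunc_norm r (shift (fun k => -2 * b * bt * w k)) N <= 2 * (H * H) * X).
{ eapply Rle_trans; [apply Hsh|]. rewrite trunc_norm_scal. fold T.
  apply Rmult_le_compat; auto using Rabs_pos.
  rewrite !Rabs_mult, R2. lra. }
assert (T5 : trunc_norm r (shift (shift (fun k => b * d * w k))) N <= H * H * X).
{ eapply Rle_trans; [apply Hsh|]. eapply Rle_trans; [apply Hsh|].
  rewrite trunc_norm_scal. fold T. apply Rmult_le_compat; auto using Rabs_pos.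
  rewrite !Rabs_mult. lra. }
unfold ode_low.
eapply Rle_trans; [now apply trunc_norm_plus|].
eapply Rle_trans; [apply Rplus_le_compat; [now apply trunc_norm_plus|apply T5]|].
eapply Rle_trans; [apply Rplus_le_compat_r, Rplus_le_compat;
  [now apply trunc_norm_plus|apply T4]|].
eapply Rle_trans; [apply Rplus_le_compat_r, Rplus_le_compat_r, Rplus_le_compat;
  [now apply trunc_norm_plus|apply T3]|].
assert (H * H <= H * H * X) by (assert (0 <= H * H) by nra; nra).
simpl pow. nra.
Qed.

(** 13 = 6 + 7, the constants of [ode_rhs_norm] and [ode_low_norm]: with X = H + 1, one step of the
    recursion at this radius adds at most 1 to |w0|, so the bound H + 1 reproduces itself. *)
Definition ode_radius (H : R) : R := / (13 * H ^ 2 * (H + 1) ^ 3).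

Lemma ode_radius_pos (H : R) : 1 <= H -> 0 < ode_radius H <= 1.
Proof.
intros HH. unfold ode_radius.
assert (1 <= H ^ 2) by (simpl; nra). assert (1 <= (H + 1) ^ 3) by (apply pow_R1_Rle; lra).
assert (1 <= 13 * H ^ 2 * (H + 1) ^ 3) by nra.
split; [apply Rinv_0_lt_compat; lra|].
rewrite <- Rinv_1. apply Rinv_le_contravar; lra.
Qed.

Lemma ode_series_bound (w0 e bt d b H : R) :
  1 <= H -> Rabs w0 <= H -> Rabs e <= H -> Rabs bt <= H -> Rabs d <= H -> Rabs b <= H ->
  forall N, trunc_norm (ode_radius H) (ode_series w0 e bt d b) N <= H + 1.
Proof.
intros HH Hw He Ht Hd Hb.
destruct (ode_radius_pos H HH) as [Hr Hr1].
assert (Hr' : 0 <= ode_radius H <= 1) by lra.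
induction N as [|N IH].
- unfold trunc_norm; simpl. change (ode_series w0 e bt d b 0%nat) with w0. lra.
- eapply Rle_trans; [apply ode_series_norm_step; lra|].
  set (w := ode_series w0 e bt d b) in *.
  assert (A1 := ode_rhs_norm e d b _ H (H + 1) w N Hr' HH He Hd Hb IH ltac:(lra)).
  assert (A2 := ode_low_norm bt d b _ H (H + 1) w N Hr' HH Ht Hd Hb IH ltac:(lra)).
  assert (A3 : trunc_norm (ode_radius H) w N * trunc_norm (ode_radius H) (ode_low bt d b w) N
    <= (H + 1) * (7 * H ^ 2 * (H + 1))).
  { apply Rmult_le_compat; auto; apply trunc_norm_nonneg; lra. }
  assert (A4 : (H + 1) * (7 * H ^ 2 * (H + 1)) <= 7 * H ^ 2 * (H + 1) ^ 3).
  { assert (0 <= 7 * H ^ 2 * (H + 1) ^ 2).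
    { apply Rmult_le_pos; [|apply pow2_ge_0]. generalize (pow2_ge_0 H). lra. }
    simpl pow in *. nra. }
  assert (A5 : ode_radius H * (13 * H ^ 2 * (H + 1) ^ 3) = 1).
  { unfold ode_radius. apply Rinv_l.
    assert (0 < H ^ 2) by (apply pow_lt; lra). assert (0 < (H + 1) ^ 3) by (apply pow_lt; lra).
    apply Rgt_not_eq. repeat apply Rmult_lt_0_compat; lra. }
  rewrite Rplus_assoc, <- Rmult_plus_distr_l.
  assert (ode_radius H * (trunc_norm (ode_radius H) (ode_rhs e d b w) N +
     trunc_norm (ode_radius H) w N * trunc_norm (ode_radius H) (ode_low bt d b w) N) <= 1).
  { rewrite <- A5. apply Rmult_le_compat_l; lra. }
  lra.
Qed.

Lemma exp_mono (x y : R) : x <= y -> exp x <= exp y.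
Proof.
intros [H | ->]; [left; now apply exp_increasing | apply Rle_refl].
Qed.

(** [ode_rhs] and [ode_low] are built from the operations that [has_sum] respects, so summing the
    coefficient identities restores the differential equation for the function. *)
Lemma ode_series_sum (w0 e bt d b u : R) :
  let w := ode_series w0 e bt d b in
  let s := PSeries w u in
  Rbar_lt (Rabs u) (CV_radius w) ->
  PSeries (PS_derive w) u * ((1 + b * u * s) * (1 - 2 * bt * u + d * u ^ 2)) =
  s * (s - 1) * (- e + d * u * (1 + s) + b * d * u ^ 2 * s).
Proof.
intros w s Hu.
assert (Hw : has_sum u w s) by now apply has_sum_intro.
assert (Hd : has_sum u (PS_derive w) (PSeries (PS_derive w) u)).
{ apply has_sum_intro. now rewrite CV_radius_derive. }
set (s' := PSeries (PS_derive w) u) in *.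
assert (Hw2 := has_sum_mult _ _ _ _ _ Hw Hw).
assert (Hw3 := has_sum_mult _ _ _ _ _ Hw Hw2).
assert (Hlow : has_sum u (ode_low bt d b w)
  (-2 * bt * 1 + u * (d * 1) + b * s + u * (-2 * b * bt * s) + u * (u * (b * d * s)))).
{ unfold ode_low.
  repeat apply has_sum_plus; repeat apply has_sum_shift; apply has_sum_scal; auto using has_sum_unit. }
assert (Hrhs : has_sum u (ode_rhs e d b w)
  (- e * (s * s - s) + u * (d * (s * (s * s) - s)) + u * (u * (b * d * (s * (s * s) - s * s))))).
{ unfold ode_rhs.
  repeat apply has_sum_plus; repeat apply has_sum_shift; apply has_sum_scal;
  apply has_sum_minus; auto. }
assert (Hl := has_sum_plus _ _ _ _ _ Hd (has_sum_shift _ _ _ (has_sum_mult _ _ _ _ _ Hd Hlow))).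
assert (E := has_sum_unique _ _ _ _ (has_sum_ext _ _ _ _ (ode_series_eq w0 e bt d b) Hl) Hrhs).
apply Rminus_diag_uniq. apply Rminus_diag_eq in E. rewrite <- E. ring.
Qed.

(** * Constants uniform over a box of parameters *)

Definition half_series (g b x : R) : nat -> R :=
  ode_series (- exp (- (PI * g))) (2 * g * x - b) (center_y g b x) (modulus2 g b x) b.

Definition in_box (K g b x : R) : Prop := Rabs g <= K /\ Rabs b <= K /\ Rabs x <= K.

(** K^2 + (2 K^2)^2 <= 5 K^4 bounds [modulus2], the largest polynomial entry; the exponential bounds
    exp (- pi g) and its inverse. *)
Definition box_bound (K : R) : R := 5 * K ^ 4 + exp (PI * K).

Lemma box_bounds (K g b x : R) :
  1 <= K -> in_box K g b x ->
  let H := box_bound K in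
  1 <= H /\ K <= H /\
  / H <= exp (- (PI * g)) <= H /\ Rabs (2 * g * x - b) <= H /\ Rabs (center_y g b x) <= H /\
  Rabs (modulus2 g b x) <= H /\ Rabs b <= H.
Proof.
intros HK (Hg & Hb & Hx) H.
assert (Hpi := PI_RGT_0).
assert (HE : 0 < exp (PI * K)) by apply exp_pos.
assert (H2 : 1 <= K ^ 2) by (simpl; nra).
assert (HK2 : K <= K ^ 2) by (simpl; nra).
assert (H4 : K ^ 2 <= K ^ 4) by (replace (K ^ 4) with (K ^ 2 * K ^ 2) by ring; nra).
assert (Hgx : Rabs (g * x) <= K ^ 2).
{ rewrite Rabs_mult. simpl. rewrite Rmult_1_r. apply Rmult_le_compat; auto using Rabs_pos. }
assert (Hc : Rabs (g * x - b) <= 2 * K ^ 2).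
{ unfold Rminus. eapply Rle_trans; [apply Rabs_triang|]. rewrite Rabs_Ropp. lra. }
assert (HH : 5 * K ^ 4 <= H) by (unfold H, box_bound; lra).
repeat split.
- lra.
- lra.
- unfold H, box_bound. rewrite <- (Rinv_inv (exp (- (PI * g)))).
  rewrite <- exp_Ropp, Ropp_involutive.
  apply Rinv_le_contravar; [apply exp_pos|].
  assert (exp (PI * g) <= exp (PI * K)); [|lra].
  apply exp_mono. apply Rmult_le_compat_l; [lra|].
  eapply Rle_trans; [apply Rle_abs|easy].
- assert (exp (- (PI * g)) <= exp (PI * K)); [|unfold H, box_bound; lra].
  apply exp_mono. rewrite Ropp_mult_distr_r. apply Rmult_le_compat_l; [lra|].
  eapply Rle_trans; [apply Rle_abs|]. now rewrite Rabs_Ropp.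
- unfold Rminus. eapply Rle_trans; [apply Rabs_triang|].
  rewrite Rabs_Ropp, Rmult_assoc, Rabs_mult, (Rabs_pos_eq 2) by lra. lra.
- unfold center_y. lra.
- unfold modulus2. eapply Rle_trans; [apply Rabs_triang|].
  rewrite <- !RPow_abs.
  assert (Rabs x ^ 2 <= K ^ 2) by (apply pow_incr; split; auto using Rabs_pos).
  assert (Rabs (g * x - b) ^ 2 <= (2 * K ^ 2) ^ 2) by (apply pow_incr; split; auto using Rabs_pos).
  replace ((2 * K ^ 2) ^ 2) with (4 * K ^ 4) in * by ring. lra.
- lra.
Qed.

Definition half_radius (K : R) : R := ode_radius (box_bound K).

Lemma half_radius_pos (K : R) : 1 <= K -> 0 < half_radius K <= 1.
Proof.
intros HK. apply ode_radius_pos.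
apply (box_bounds K 0 0 0 HK). unfold in_box. rewrite Rabs_R0. lra.
Qed.

Lemma half_series_bound (K g b x : R) :
  1 <= K -> in_box K g b x ->
  geometric_bound (box_bound K + 1) (half_radius K) (half_series g b x).
Proof.
intros HK Hbox.
destruct (box_bounds K g b x HK Hbox) as (H1 & H2 & [H3 H3'] & H4 & H5 & H6 & H7).
intros n. eapply Rle_trans; [apply trunc_norm_term; left; now apply half_radius_pos|].
apply ode_series_bound; auto.
rewrite Rabs_Ropp, Rabs_pos_eq; [easy|]. left. apply exp_pos.
Qed.

(* For [|u| < half_domain K] and parameters in the box, the denominators below
   stay away from 0. *)
Definition half_domain (K : R) : R := half_radius K / (32 * (box_bound K + 1) ^ 2).

Lemma half_domain_facts (K g b x u : R) :
  1 <= K -> in_box K g b x -> Rabs u < half_domain K ->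
  let c := exp (- (PI * g)) in
  let s := PSeries (half_series g b x) u in
  0 < half_domain K <= 1 /\
  Rbar_lt (Rabs u) (CV_radius (half_series g b x)) /\
  Rabs (s + c) <= c / 2 /\
  Rabs (center_y g b x * u) <= / 16 /\ Rabs (center_y g b x * (u * s)) <= / 16 /\
  Rabs (b * u) <= / 16 /\ Rabs (b * (u * s)) <= / 16.
Proof.
intros HK Hbox Hu c s.
destruct (box_bounds K g b x HK Hbox) as (H1 & H2 & [H3 H3'] & H4 & H5 & H6 & H7).
fold c in H3, H3'.
assert (Hr := half_radius_pos K HK).
set (H := box_bound K) in *. set (rho := half_radius K) in *.
assert (HB := half_series_bound K g b x HK Hbox). fold H rho in HB.
assert (Hq : 0 < / (32 * (H + 1) ^ 2)) by (apply Rinv_0_lt_compat; simpl; nra).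
assert (HD : half_domain K * (32 * (H + 1) ^ 2) = rho).
{ unfold half_domain. fold H rho. field. simpl; nra. }
assert (HD0 : 0 < half_domain K) by (unfold half_domain; fold H rho; apply Rmult_lt_0_compat; lra).
assert (Hu' : Rabs u * (32 * (H + 1) ^ 2) < rho).
{ rewrite <- HD. apply Rmult_lt_compat_r; [simpl; nra|easy]. }
assert (HH2 : 4 <= (H + 1) ^ 2) by (simpl; nra).
assert (Hu0 := Rabs_pos u).
assert (Hur : Rabs u <= rho / 2) by nra.
assert (Hc : 0 < c) by apply exp_pos.
(* The distance from w(u) to w(0) = - c is at most 2 (H + 1) |u| / rho, and 1 / H <= c turns this
   into a fraction of c; thus w stays negative. *)
assert (Hs : Rabs (s + c) <= c / 2).
{ assert (Hn := PSeries_near_0 _ _ u _ (proj1 Hr) HB Hur).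
  change (half_series g b x 0%nat) with (- c) in Hn. fold s in Hn.
  replace (s - - c) with (s + c) in Hn by ring.
  eapply Rle_trans; [exact Hn|].
  apply Rle_trans with (/ H / 2); [|lra].
  apply Rmult_le_reg_r with (rho * (16 * H)); [nra|].
  replace (2 * (H + 1) / rho * Rabs u * (rho * (16 * H))) with
    (Rabs u * (32 * ((H + 1) * H))) by (field; lra).
  replace (/ H / 2 * (rho * (16 * H))) with (8 * rho) by (field; lra).
  assert (Rabs u * (32 * ((H + 1) * H)) <= Rabs u * (32 * (H + 1) ^ 2)).
  { apply Rmult_le_compat_l; [easy|]. simpl. nra. }
  lra. }
assert (Hsa : Rabs s <= 2 * H).
{ replace s with ((s + c) - c) by ring. unfold Rminus.
  eapply Rle_trans; [apply Rabs_triang|]. rewrite Rabs_Ropp, (Rabs_pos_eq c); lra. }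
assert (Hsmall : forall m, Rabs m <= H -> Rabs (m * u) <= / 16 /\ Rabs (m * (u * s)) <= / 16).
{ intros m Hm. rewrite !Rabs_mult.
  assert (Hm0 := Rabs_pos m). assert (Hs0 := Rabs_pos s).
  assert (HuH : Rabs u * (32 * (H + 1) ^ 2) <= 1) by lra.
  assert (G1 : Rabs m * Rabs u <= H * Rabs u) by (apply Rmult_le_compat_r; easy).
  assert (G2 : Rabs m * (Rabs u * Rabs s) <= H * (Rabs u * (2 * H))).
  { apply Rmult_le_compat; auto using Rmult_le_pos. apply Rmult_le_compat_l; easy. }
  assert (G3 : H * H <= (H + 1) ^ 2) by (simpl; nra).
  assert (G4 : Rabs u * (H * H) <= Rabs u * (H + 1) ^ 2) by (apply Rmult_le_compat_l; easy).
  assert (G5 : Rabs u * H <= Rabs u * (H * H)) by (apply Rmult_le_compat_l; nra).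
  split; nra. }
split; [split; [easy|nra]|].
split.
{ apply (CV_radius_geometric (H + 1) rho); try easy; try lra. }
split; [easy|].
destruct (Hsmall _ H5) as [G1 G2]. destruct (Hsmall _ H7) as [G3 G4].
repeat split; assumption.
Qed.

(** * Half-return orbits *)

Lemma is_derive_eq (f : R -> R) (x l l' : R) : is_derive f x l -> l = l' -> is_derive f x l'.
Proof. now intros H <-. Qed.

Definition quad (g b x u : R) : R := 1 - 2 * center_y g b x * u + modulus2 g b x * u ^ 2.

Lemma quad_eq (g b x u : R) : quad g b x u = (1 - center_y g b x * u) ^ 2 + (x * u) ^ 2.
Proof. unfold quad, modulus2, center_y. ring. Qed.

Lemma quad_pos (g b x u : R) : 0 < 1 - center_y g b x * u -> 0 < quad g b x u.
Proof.
intros H. rewrite quad_eq. generalize (pow2_ge_0 (x * u)).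
assert (0 < (1 - center_y g b x * u) ^ 2) by now apply pow_lt. lra.
Qed.

(** As long as [center_y] u < 1, this is the angle of the point (0, 1/u) around the focus for u > 0,
    and that angle minus pi for u < 0. *)
Definition phase (g b x u : R) : R := atan (x * u / (1 - center_y g b x * u)).

(* [ln |u| + spiral_log g b x u] is the value at the point (0, 1/u) of the
   multivalued first integral (polar angle) * g - log (radius) of the focus. *)
Definition spiral_log (g b x u : R) : R := g * phase g b x u - ln (quad g b x u) / 2.

Lemma is_derive_spiral_log (g b x u : R) :
  0 < 1 - center_y g b x * u ->
  is_derive (spiral_log g b x) u
    ((g * x + center_y g b x - modulus2 g b x * u) / quad g b x u).
Proof.
intros H. assert (HQ := quad_pos g b x u H).
unfold spiral_log, phase. unfold quad at 1.
auto_derive.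
- unfold quad in HQ. repeat split; try lra.
- fold (quad g b x u). rewrite quad_eq in HQ |- *.
  assert (1 + (x * u / (1 + - (center_y g b x * u))) ^ 2 <> 0).
  { generalize (pow2_ge_0 (x * u / (1 + - (center_y g b x * u)))). lra. }
  unfold modulus2. fold (center_y g b x). set (t := center_y g b x) in *.
  field. repeat split; nra.
Qed.

Lemma sqrt_quad_phase (g b x u : R) :
  0 < 1 - center_y g b x * u ->
  sqrt (quad g b x u) * sin (phase g b x u) = x * u /\
  sqrt (quad g b x u) * cos (phase g b x u) = 1 - center_y g b x * u.
Proof.
intros H. assert (HQ := quad_pos g b x u H).
unfold phase. rewrite sin_atan, cos_atan.
set (A := 1 - center_y g b x * u) in *.
assert (E : sqrt (1 + (x * u / A)²) = sqrt (quad g b x u) / A).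
{ rewrite <- (sqrt_Rsqr A) at 2 by lra.
  rewrite <- sqrt_div_alt by (apply Rlt_0_sqr; lra).
  f_equal. rewrite quad_eq. fold A. unfold Rsqr. field. lra. }
rewrite E. assert (0 < sqrt (quad g b x u)) by now apply sqrt_lt_R0.
split; field; split; lra.
Qed.

(** A half-return for [left_params] is, by conversion, a left half-return of every system with the
    same left data. *)
Definition left_params (g b x : R) : params := Params g 0 b x 0.

Lemma cos_pos_inv (a : R) : - PI < a < PI -> 0 < cos a -> - (PI / 2) < a < PI / 2.
Proof.
intros Ha Hc. assert (Hpi := PI_RGT_0).
split; apply Rnot_le_lt; intros H.
- assert (cos (- a) <= 0) by (apply cos_le_0; lra). rewrite cos_neg in *. lra.
- assert (cos a <= 0) by (apply cos_le_0; lra). lra.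
Qed.

(* At (0, 1/u) the left field has x' = - (1 + b u) / u. *)
Lemma phase_direction (g b x u : R) :
  0 < 1 - center_y g b x * u -> 0 < 1 + b * u ->
  - (PI / 2) < phase g b x u - atan g < PI / 2.
Proof.
intros H1 H2.
assert (Ht := atan_bound g). assert (Hp := atan_bound (x * u / (1 - center_y g b x * u))).
fold (phase g b x u) in Hp.
apply cos_pos_inv; [lra|].
rewrite cos_minus.
assert (Hg : 0 < cos (atan g)) by (apply cos_gt_0; lra).
assert (Hs : sin (atan g) = g * cos (atan g)).
{ rewrite sin_atan, cos_atan. field. apply Rgt_not_eq, sqrt_lt_R0.
  generalize (Rle_0_sqr g). lra. }
rewrite Hs.
destruct (sqrt_quad_phase g b x u H1) as [S1 S2].
assert (HQ : 0 < sqrt (quad g b x u)) by now apply sqrt_lt_R0, quad_pos.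
apply Rmult_lt_reg_l with (sqrt (quad g b x u)); [easy|].
rewrite Rmult_0_r.
replace (sqrt (quad g b x u) * (cos (phase g b x u) * cos (atan g) +
  sin (phase g b x u) * (g * cos (atan g)))) with
  (cos (atan g) * (sqrt (quad g b x u) * cos (phase g b x u) +
   g * (sqrt (quad g b x u) * sin (phase g b x u)))) by ring.
rewrite S1, S2. apply Rmult_lt_0_compat; [easy|].
unfold center_y. replace (1 - (g * x - b) * u + g * (x * u)) with (1 + b * u) by ring. easy.
Qed.

(** The orbit is explicit, with radius r0 exp (g t) and angle th0 + t. The hypothesis on the first
    integral says that it meets the section at 1/v after turning by pi - th0 + th1. *)
Lemma spiral_arc (g b x u v : R) :
  0 < u -> v < 0 ->
  0 < 1 - center_y g b x * u -> 0 < 1 - center_y g b x * v ->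
  0 < 1 + b * u -> 0 < 1 + b * v ->
  ln (- v) + spiral_log g b x v = ln u + spiral_log g b x u - PI * g ->
  left_half_return (left_params g b x) (/ u) (/ v).
Proof.
intros Hu Hv Au Av Bu Bv E.
split; [now apply Rinv_0_lt_compat|]. split; [now apply Rinv_lt_0_compat|].
assert (Hpi := PI_RGT_0).
set (th0 := phase g b x u). set (th1 := phase g b x v).
set (T := PI - th0 + th1).
set (r0 := sqrt (quad g b x u) / u).
set (r1 := sqrt (quad g b x v) / (- v)).
assert (Q0 := quad_pos _ _ _ _ Au). assert (Q1 := quad_pos _ _ _ _ Av).
assert (Hr0 : 0 < r0) by (apply Rdiv_lt_0_compat; [now apply sqrt_lt_R0 | easy]).
assert (Hr1 : 0 < r1) by (apply Rdiv_lt_0_compat; [now apply sqrt_lt_R0 | lra]).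
assert (Hr : r0 * exp (g * T) = r1).
{ assert (L0 : ln r0 = ln (quad g b x u) / 2 - ln u).
  { unfold r0. rewrite ln_div by (try easy; now apply sqrt_lt_R0).
    rewrite <- (sqrt_sqrt (quad g b x u)) at 2 by lra.
    rewrite ln_mult by now apply sqrt_lt_R0. lra. }
  assert (L1 : ln r1 = ln (quad g b x v) / 2 - ln (- v)).
  { unfold r1. rewrite ln_div by (try lra; now apply sqrt_lt_R0).
    rewrite <- (sqrt_sqrt (quad g b x v)) at 2 by lra.
    rewrite ln_mult by now apply sqrt_lt_R0. lra. }
  rewrite <- (exp_ln r0) by easy. rewrite <- exp_plus.
  rewrite <- (exp_ln r1) by easy. f_equal. rewrite L0, L1.
  unfold spiral_log in E. fold th0 th1 in E. unfold T. lra. }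
destruct (sqrt_quad_phase g b x u Au) as [S0 C0]. fold th0 in S0, C0.
destruct (sqrt_quad_phase g b x v Av) as [S1 C1]. fold th1 in S1, C1.
assert (S0' : r0 * sin th0 = x).
{ unfold r0. transitivity ((sqrt (quad g b x u) * sin th0) / u); [field; lra|].
  rewrite S0. field. lra. }
assert (C0' : r0 * cos th0 = / u - center_y g b x).
{ unfold r0. transitivity ((sqrt (quad g b x u) * cos th0) / u); [field; lra|].
  rewrite C0. field. lra. }
assert (S1' : r1 * sin th1 = - x).
{ unfold r1. transitivity ((sqrt (quad g b x v) * sin th1) / (- v)); [field; lra|].
  rewrite S1. field. lra. }
assert (C1' : r1 * cos th1 = center_y g b x - / v).
{ unfold r1. transitivity ((sqrt (quad g b x v) * cos th1) / (- v)); [field; lra|].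
  rewrite C1. field. lra. }
assert (D0 := phase_direction g b x u Au Bu). fold th0 in D0.
assert (D1 := phase_direction g b x v Av Bv). fold th1 in D1.
assert (B0 := atan_bound (x * u / (1 - center_y g b x * u))).
change (- PI / 2 < th0 < PI / 2) in B0.
assert (B1 := atan_bound (x * v / (1 - center_y g b x * v))).
change (- PI / 2 < th1 < PI / 2) in B1.
assert (Ba := atan_bound g).
assert (HT : 0 < T) by (unfold T; lra).
set (X := fun t => x - r0 * exp (g * t) * sin (t + th0)).
set (Y := fun t => 2 * g * x - b + r0 * exp (g * t) * (cos (t + th0) - g * sin (t + th0))).
assert (DX : forall t, is_derive X t (- (r0 * exp (g * t)) * (cos (t + th0) + g * sin (t + th0)))).
{ intros t. unfold X. auto_derive; [easy|]. ring. }
assert (DY : forall t, is_derive Y t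
   (- (1 + g ^ 2) * (r0 * exp (g * t)) * sin (t + th0))).
{ intros t. unfold Y. auto_derive; [easy|]. ring. }
assert (X0 : X 0 = 0).
{ unfold X. rewrite Rmult_0_r, exp_0, Rplus_0_l, Rmult_1_r, S0'. ring. }
assert (XT : X T = 0).
{ unfold X. rewrite Hr. replace (T + th0) with (th1 + PI) by (unfold T; ring).
  rewrite neg_sin. lra. }
exists X, Y, T. split; [|split; [easy|split; [|split; [easy|split; [|split; [easy|]]]]]].
- intros t. split; simpl.
  + eapply is_derive_eq; [apply DX|]. unfold X, Y. ring.
  + eapply is_derive_eq; [apply DY|]. unfold X. ring.
- unfold Y. rewrite Rmult_0_r, exp_0, Rplus_0_l, Rmult_1_r.
  transitivity (2 * g * x - b + r0 * cos th0 - g * (r0 * sin th0)); [ring|].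
  rewrite S0', C0'. unfold center_y. ring.
- assert (Ca : 0 < cos (atan g)) by (apply cos_gt_0; lra).
  assert (Sa : sin (atan g) = g * cos (atan g)).
  { rewrite sin_atan, cos_atan. field. apply Rgt_not_eq, sqrt_lt_R0.
    generalize (Rle_0_sqr g). lra. }
  assert (Hsgn : forall t, cos (t + th0) + g * sin (t + th0) =
     cos (t + th0 - atan g) / cos (atan g)).
  { intros t. rewrite cos_minus, Sa. field. lra. }
  intros t [Ht0 HtT].
  (* The only critical time of [X] in (0, T): before it [X] decreases from [X 0] = 0, after it [X]
     increases to [X T] = 0, so [X] is negative in between. *)
  destruct (Rle_lt_dec t (PI / 2 + atan g - th0)) as [Hle|Hlt].
  + destruct (MVT_cor2 X (fun t => - (r0 * exp (g * t)) * (cos (t + th0) + g * sin (t + th0)))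
      0 t Ht0) as [c [Ec Hc]].
    { intros s _. apply is_derive_Reals, DX. }
    assert (0 < cos (c + th0 - atan g)) by (apply cos_gt_0; lra).
    assert (0 < cos (c + th0) + g * sin (c + th0)) by
      (rewrite Hsgn; apply Rdiv_lt_0_compat; assumption).
    assert (0 < r0 * exp (g * c)) by (apply Rmult_lt_0_compat; [assumption|apply exp_pos]).
    rewrite X0 in Ec.
    assert (0 < (r0 * exp (g * c)) * (cos (c + th0) + g * sin (c + th0)) * t) by
      (apply Rmult_lt_0_compat; [apply Rmult_lt_0_compat; assumption|assumption]).
    lra.
  + destruct (MVT_cor2 X (fun t => - (r0 * exp (g * t)) * (cos (t + th0) + g * sin (t + th0)))
      t T HtT) as [c [Ec Hc]].
    { intros s _. apply is_derive_Reals, DX. }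
    assert (cos (c + th0 - atan g) < 0).
    { apply cos_lt_0; [lra|]. unfold T in Hc. lra. }
    assert (0 < - (cos (c + th0) + g * sin (c + th0))).
    { rewrite Hsgn. replace (- (cos (c + th0 - atan g) / cos (atan g))) with
        ((- cos (c + th0 - atan g)) / cos (atan g)) by (field; lra).
      apply Rdiv_lt_0_compat; lra. }
    assert (0 < r0 * exp (g * c)) by (apply Rmult_lt_0_compat; [assumption|apply exp_pos]).
    rewrite XT in Ec.
    assert (0 < (r0 * exp (g * c)) * (- (cos (c + th0) + g * sin (c + th0))) * (T - t)) by
      (apply Rmult_lt_0_compat; [apply Rmult_lt_0_compat; assumption|lra]).
    lra.
- unfold Y. rewrite Hr. replace (T + th0) with (th1 + PI) by (unfold T; ring).
  rewrite neg_sin, neg_cos.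
  transitivity (2 * g * x - b - r1 * cos th1 + g * (r1 * sin th1)); [ring|].
  rewrite S1', C1'. unfold center_y. ring.
Qed.

Definition half_map (g b x u : R) : R := u * PSeries (half_series g b x) u.

Lemma half_map_first_integral (K g b x u : R) :
  1 <= K -> in_box K g b x -> 0 < u < half_domain K ->
  ln (- half_map g b x u) + spiral_log g b x (half_map g b x u) =
  ln u + spiral_log g b x u - PI * g.
Proof.
intros HK Hbox Hu.
set (w := half_series g b x).
(* Dividing v by u removes the logarithmic singularity: [F] is differentiable up to t = 0, where its
   value is - pi g. *)
set (F := fun t => ln (- PSeries w t) + spiral_log g b x (t * PSeries w t) - spiral_log g b x t).
assert (Hc : 0 < exp (- (PI * g))) by apply exp_pos.
assert (Hfacts : forall t, 0 <= t <= u ->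
  Rbar_lt (Rabs t) (CV_radius w) /\ PSeries w t < 0 /\
  0 < 1 - center_y g b x * t /\ 0 < 1 - center_y g b x * (t * PSeries w t) /\
  0 < 1 + b * t /\ 0 < 1 + b * (t * PSeries w t)).
{ intros t Ht.
  assert (Ht' : Rabs t < half_domain K) by (rewrite Rabs_pos_eq; lra).
  destruct (half_domain_facts K g b x t HK Hbox Ht') as (_ & A1 & A2 & A3 & A4 & A5 & A6).
  fold w in A1, A2, A4, A6.
  apply Rabs_le_between in A2, A3, A4, A5, A6.
  repeat split; try easy; lra. }
assert (EF : F u = F 0).
{ symmetry. apply (eq_is_derive F 0 u); [|lra].
  intros t Ht.
  destruct (Hfacts t Ht) as (A1 & A2 & A3 & A4 & A5 & A6).
  assert (D := ode_series_sum (- exp (- (PI * g))) (2 * g * x - b) (center_y g b x)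
     (modulus2 g b x) b t A1). cbv zeta in D.
  fold (half_series g b x) in D. fold w in D.
  assert (Dw := is_derive_PSeries w t A1).
  set (s := PSeries w t) in *. set (s' := PSeries (PS_derive w) t) in *.
  assert (Q0 := quad_pos _ _ _ _ A3). assert (Q1 := quad_pos _ _ _ _ A4).
  assert (D1 : is_derive (fun t => ln (- PSeries w t)) t (s' / s)).
  { eapply is_derive_eq.
    - apply (is_derive_comp ln (fun t => - PSeries w t)).
      + apply is_derive_ln. fold s. lra.
      + apply (is_derive_opp (PSeries w)). exact Dw.
    - fold s. unfold scal, opp; simpl. unfold mult; simpl. field. lra. }
  assert (D2 : is_derive (fun t => t * PSeries w t) t (s + t * s')).
  { eapply is_derive_eq.
    - apply (is_derive_mult (fun t => t) (PSeries w)).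
      + apply (is_derive_id (K := R_AbsRing)).
      + exact Dw.
      + apply Rmult_comm.
    - fold s. unfold plus, mult, one; simpl. ring. }
  assert (D3 := is_derive_comp (spiral_log g b x) (fun t => t * PSeries w t) t _ _
    (is_derive_spiral_log g b x (t * s) A4) D2).
  assert (D4 := is_derive_spiral_log g b x t A3).
  assert (D5 := is_derive_minus _ _ _ _ _ (is_derive_plus _ _ _ _ _ D1 D3) D4).
  eapply is_derive_eq; [exact D5|].
  unfold minus, plus, opp, scal, zero; simpl. unfold mult; simpl.
  fold (quad g b x t) in D.
  set (v := t * s) in *.
  (* The differential equation divided by s Q(t), in terms of v = t s. *)
  assert (E1 : s' / s * (1 + b * v) = (s - 1) *
    (- (2 * g * x - b) + modulus2 g b x * t * (1 + s) + b * modulus2 g b x * t ^ 2 * s)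
    / quad g b x t).
  { apply Rmult_eq_reg_r with (s * quad g b x t); [|nra].
    transitivity (s' * ((1 + b * t * s) * quad g b x t)); [unfold v; field; lra|].
    rewrite D. field. lra. }
  apply Rmult_eq_reg_r with (quad g b x v * quad g b x t); [|nra].
  rewrite Rmult_0_l.
  transitivity (quad g b x t * (s' / s * (1 + b * v)) +
    s * (g * x + center_y g b x - modulus2 g b x * v) * quad g b x t -
    (g * x + center_y g b x - modulus2 g b x * t) * quad g b x v).
  (* This identity lets the terms in s' from ln (- w) and from [spiral_log] at v combine into s'/s
     (1 + b v). *)
  - replace (1 + b * v) with ((quad g b x v + v * (g * x + center_y g b x - modulus2 g b x * v)))
      by (unfold quad, center_y; ring).
    clear - Q0 Q1 A2. generalize dependent (quad g b x v). intros q1 Q1.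
    generalize dependent (quad g b x t). intros q0 Q0.
    unfold v. field. lra.
  - rewrite E1.
    transitivity ((s - 1) * (- (2 * g * x - b) + modulus2 g b x * t * (1 + s) +
       b * modulus2 g b x * t ^ 2 * s) +
       s * (g * x + center_y g b x - modulus2 g b x * v) * quad g b x t -
      (g * x + center_y g b x - modulus2 g b x * t) * quad g b x v); [field; lra|].
    unfold quad, v, center_y. ring. }
destruct (Hfacts u ltac:(lra)) as (_ & A2 & _).
unfold F in EF. rewrite Rmult_0_l, PSeries_0 in EF.
change (w 0%nat) with (- exp (- (PI * g))) in EF.
rewrite Ropp_involutive, ln_exp in EF.
unfold half_map. fold w.
replace (- (u * PSeries w u)) with (u * - PSeries w u) by ring.
rewrite ln_mult by lra. lra.
Qed.

Lemma half_return_exists (K g b x u : R) :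
  1 <= K -> in_box K g b x -> 0 < u < half_domain K ->
  half_map g b x u < 0 /\
  left_half_return (left_params g b x) (/ u) (/ half_map g b x u).
Proof.
intros HK Hbox Hu.
assert (E := half_map_first_integral K g b x u HK Hbox Hu).
assert (Hu' : Rabs u < half_domain K) by (rewrite Rabs_pos_eq; lra).
destruct (half_domain_facts K g b x u HK Hbox Hu') as (_ & _ & A2 & A3 & A4 & A5 & A6).
apply Rabs_le_between in A2, A3, A4, A5, A6.
assert (Hc : 0 < exp (- (PI * g))) by apply exp_pos.
assert (Hv : half_map g b x u < 0) by (unfold half_map; nra).
split; [easy|].
apply spiral_arc; try lra; try easy; unfold half_map; lra.
Qed.

(** * Uniqueness of half-returns and the mirror symmetry *)

Lemma left_orbit_unique (p : params) (x1 y1 x2 y2 : R -> R) (t : R) :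
  is_orbit (left_field p) x1 y1 -> is_orbit (left_field p) x2 y2 ->
  x1 0 = x2 0 -> y1 0 = y2 0 -> 0 <= t -> x1 t = x2 t /\ y1 t = y2 t.
Proof.
intros O1 O2 Hx Hy Ht.
destruct Ht as [Ht | <-]; [|easy].
set (g := gamma_L p).
(* the squared distance in the coordinates where the linear part is a rotation
   times a dilation *)
set (F := fun s => exp (- (2 * g * s)) *
   ((x1 s - x2 s) ^ 2 + (g * (x1 s - x2 s) - (y1 s - y2 s)) ^ 2)).
assert (EF : F 0 = F t).
{ apply (eq_is_derive F 0 t); [|easy]. intros s _.
  destruct (O1 s) as [A1 A2]. destruct (O2 s) as [B1 B2]. simpl in A1, A2, B1, B2.
  unfold F. auto_derive.
  - repeat split; try (eexists; eassumption).
  - rewrite (is_derive_unique (fun z : R => x1 z) _ _ A1), (is_derive_unique (fun z : R => y1 z) _ _ A2),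
      (is_derive_unique (fun z : R => x2 z) _ _ B1), (is_derive_unique (fun z : R => y2 z) _ _ B2).
    fold g. unfold zero; simpl. ring. }
unfold F in EF at 1. rewrite Hx, Hy, !Rminus_diag, Rmult_0_r, Rminus_0_r in EF.
unfold F in EF.
assert (He : 0 < exp (- (2 * g * t))) by apply exp_pos.
assert (H0 : (x1 t - x2 t) ^ 2 + (g * (x1 t - x2 t) - (y1 t - y2 t)) ^ 2 = 0).
{ apply Rmult_eq_reg_l with (exp (- (2 * g * t))); [|lra]. rewrite <- EF. ring. }
assert (P1 := pow2_ge_0 (x1 t - x2 t)).
assert (P2 := pow2_ge_0 (g * (x1 t - x2 t) - (y1 t - y2 t))).
assert (Z1 : x1 t - x2 t = 0).
{ apply Rsqr_0_uniq. rewrite Rsqr_pow2. lra. }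
assert (Z2 : g * (x1 t - x2 t) - (y1 t - y2 t) = 0).
{ apply Rsqr_0_uniq. rewrite Rsqr_pow2. lra. }
rewrite Z1 in Z2. lra.
Qed.

(** The orbits coincide for t >= 0; if one returned earlier, the other would have x = 0 at a time
    when it must still have x < 0. *)
Lemma left_half_return_unique (p : params) (y0 y1 y1' : R) :
  left_half_return p y0 y1 -> left_half_return p y0 y1' -> y1 = y1'.
Proof.
intros (_ & _ & x & y & T & O & X0 & Y0 & HT & Hneg & XT & YT).
intros (_ & _ & x' & y' & T' & O' & X0' & Y0' & HT' & Hneg' & XT' & YT').
assert (U : forall t, 0 <= t -> x t = x' t /\ y t = y' t).
{ intros t Ht. apply (left_orbit_unique p); auto; congruence. }
assert (E : T = T').
{ destruct (Rtotal_order T T') as [H|[H|H]]; [|easy|].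
  - specialize (Hneg' T ltac:(lra)). destruct (U T ltac:(lra)) as [E _]. lra.
  - specialize (Hneg T' ltac:(lra)). destruct (U T' ltac:(lra)) as [E _]. lra. }
rewrite <- YT, <- YT', <- E. apply U. lra.
Qed.

Lemma is_derive_reflect (f : R -> R) (t l : R) :
  is_derive f (- t) l -> is_derive (fun s => f (- s)) t (- l).
Proof.
intros H. eapply is_derive_eq.
- apply (is_derive_comp f (fun s => - s)); [exact H|].
  apply (is_derive_opp (fun s : R => s) t 1), (is_derive_id (K := R_AbsRing)).
- unfold scal, opp, one; simpl. unfold mult; simpl. ring.
Qed.

(* (x, y, t) -> (-x, y, -t) turns the right system into a left one. *)
Definition right_of (p : params) : params :=
  left_params (- gamma_R p) (- offset p) (- x_R p).

Lemma right_half_return_mirror (p : params) (y0 y2 : R) :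
  right_half_return p y0 y2 <-> left_half_return (right_of p) y0 y2.
Proof.
split; intros (H0 & H1 & x & y & T & O & X0 & Y0 & HT & Hs & XT & YT);
  split; try easy; split; try easy;
  exists (fun s => - x (- s)), (fun s => y (- s)), T; rewrite ?Ropp_0, ?Ropp_involutive;
  split; [|split; [lra|split; [easy|split; [easy|split; [|split; [lra|easy]]]]]
        | |split; [lra|split; [easy|split; [easy|split; [|split; [lra|easy]]]]]].
- intros t. destruct (O (- t)) as [D1 D2]. simpl in D1, D2. split; simpl.
  + eapply is_derive_eq.
    * apply (is_derive_opp (fun s => x (- s))). apply is_derive_reflect, D1.
    * unfold opp; simpl. ring.
  + eapply is_derive_eq; [apply is_derive_reflect, D2|]. ring.
- intros t Ht. specialize (Hs (- t) ltac:(lra)). lra.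
- intros t. destruct (O (- t)) as [D1 D2]. simpl in D1, D2. split; simpl.
  + eapply is_derive_eq.
    * apply (is_derive_opp (fun s => x (- s))). apply is_derive_reflect, D1.
    * unfold opp; simpl. ring.
  + eapply is_derive_eq; [apply is_derive_reflect, D2|]. ring.
- intros t Ht. specialize (Hs (- t) ltac:(lra)). lra.
Qed.

(** * The displacement map *)

Definition params_in_box (K : R) (p : params) : Prop :=
  Rabs (gamma_L p) <= K /\ Rabs (gamma_R p) <= K /\ Rabs (offset p) <= K /\
  Rabs (x_L p) <= K /\ Rabs (x_R p) <= K.

Definition left_series (p : params) : nat -> R :=
  half_series (gamma_L p) (offset p) (x_L p).
Definition right_series (p : params) : nat -> R :=
  half_series (- gamma_R p) (- offset p) (- x_R p).
Definition left_map (p : params) : R -> R := half_map (gamma_L p) (offset p) (x_L p).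
Definition right_map (p : params) : R -> R :=
  half_map (- gamma_R p) (- offset p) (- x_R p).

(* Coefficients and sum of Delta(u)/u. *)
Definition gap_series (p : params) (n : nat) : R := left_series p n - right_series p n.
Definition gap_sum (p : params) (u : R) : R := PSeries (gap_series p) u.

Lemma params_in_box_halves (K : R) (p : params) :
  params_in_box K p ->
  in_box K (gamma_L p) (offset p) (x_L p) /\
  in_box K (- gamma_R p) (- offset p) (- x_R p).
Proof.
intros (H1 & H2 & H3 & H4 & H5). unfold in_box. rewrite !Rabs_Ropp. tauto.
Qed.

Lemma half_domain_pos (K : R) : 1 <= K -> 0 < half_domain K.
Proof.
intros HK. unfold half_domain.
assert (H := half_radius_pos K HK).
assert (1 <= box_bound K).
{ apply (box_bounds K 0 0 0 HK). unfold in_box. rewrite Rabs_R0. lra. }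
apply Rdiv_lt_0_compat; [lra|]. simpl. nra.
Qed.

Lemma gap_series_bound (K : R) (p : params) :
  1 <= K -> params_in_box K p ->
  geometric_bound (2 * (box_bound K + 1)) (half_radius K) (gap_series p).
Proof.
intros HK Hp n. destruct (params_in_box_halves K p Hp) as [HL HR].
assert (BL := half_series_bound K _ _ _ HK HL n).
assert (BR := half_series_bound K _ _ _ HK HR n).
unfold gap_series, Rminus.
eapply Rle_trans; [apply Rmult_le_compat_r; [|apply Rabs_triang]|].
- apply pow_le. generalize (half_radius_pos K HK). lra.
- rewrite Rabs_Ropp. unfold left_series, right_series. lra.
Qed.

Lemma left_half_return_iff (K : R) (p : params) (u y : R) :
  1 <= K -> params_in_box K p -> 0 < u < half_domain K ->
  (left_half_return p (/ u) y <-> y = / left_map p u).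
Proof.
intros HK Hp Hu. destruct (params_in_box_halves K p Hp) as [HL _].
destruct (half_return_exists K _ _ _ u HK HL Hu) as [_ H]. split.
- intros H'. exact (left_half_return_unique p _ _ _ H' H).
- intros ->. exact H.
Qed.

Lemma right_half_return_iff (K : R) (p : params) (u y : R) :
  1 <= K -> params_in_box K p -> 0 < u < half_domain K ->
  (right_half_return p (/ u) y <-> y = / right_map p u).
Proof.
intros HK Hp Hu. destruct (params_in_box_halves K p Hp) as [_ HR].
destruct (half_return_exists K _ _ _ u HK HR Hu) as [_ H].
rewrite right_half_return_mirror. split.
- intros H'. exact (left_half_return_unique _ _ _ _ H' H).
- intros ->. exact H.
Qed.

Lemma left_map_neg (K : R) (p : params) (u : R) :
  1 <= K -> params_in_box K p -> 0 < u < half_domain K -> left_map p u < 0.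
Proof.
intros HK Hp Hu. destruct (params_in_box_halves K p Hp) as [HL _].
exact (proj1 (half_return_exists K _ _ _ u HK HL Hu)).
Qed.

Lemma right_map_neg (K : R) (p : params) (u : R) :
  1 <= K -> params_in_box K p -> 0 < u < half_domain K -> right_map p u < 0.
Proof.
intros HK Hp Hu. destruct (params_in_box_halves K p Hp) as [_ HR].
exact (proj1 (half_return_exists K _ _ _ u HK HR Hu)).
Qed.

(** Existence and uniqueness of the half-returns pin down the values chosen by [epsilon]. *)
Lemma Delta_maps (K : R) (p : params) (u : R) :
  1 <= K -> params_in_box K p -> 0 < u < half_domain K ->
  Defs.Delta p u = left_map p u - right_map p u.
Proof.
intros HK Hp Hu.
assert (NL := left_map_neg K p u HK Hp Hu). assert (NR := right_map_neg K p u HK Hp Hu).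
unfold Defs.Delta, Lmap, Rmap.
assert (EL : epsilon (inhabits 0) (left_half_return p (/ u)) = / left_map p u).
{ apply (left_half_return_iff K p u _ HK Hp Hu). apply epsilon_spec.
  exists (/ left_map p u). now apply (left_half_return_iff K). }
assert (ER : epsilon (inhabits 0) (right_half_return p (/ u)) = / right_map p u).
{ apply (right_half_return_iff K p u _ HK Hp Hu). apply epsilon_spec.
  exists (/ right_map p u). now apply (right_half_return_iff K). }
rewrite EL, ER, !Rinv_inv. reflexivity.
Qed.

Lemma gap_maps (K : R) (p : params) (u : R) :
  1 <= K -> params_in_box K p -> 0 <= u < half_domain K ->
  u * gap_sum p u = left_map p u - right_map p u.
Proof.
intros HK Hp Hu. destruct (params_in_box_halves K p Hp) as [HL HR].
assert (Hu' : Rabs u < half_domain K) by (rewrite Rabs_pos_eq; lra).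
destruct (half_domain_facts K _ _ _ u HK HL Hu') as (_ & CL & _).
destruct (half_domain_facts K _ _ _ u HK HR Hu') as (_ & CR & _).
apply has_sum_intro in CL, CR.
assert (E := proj2 (has_sum_minus _ _ _ _ _ CL CR)).
change (gap_sum p u = PSeries (left_series p) u - PSeries (right_series p) u) in E.
rewrite E. unfold left_map, right_map, half_map, left_series, right_series. ring.
Qed.

Lemma Delta_gap (K : R) (p : params) (u : R) :
  1 <= K -> params_in_box K p -> 0 < u < half_domain K ->
  Defs.Delta p u = u * gap_sum p u.
Proof.
intros HK Hp Hu. rewrite (gap_maps K) by (try easy; lra). now apply (Delta_maps K).
Qed.

Lemma crossing_iff (K : R) (p : params) (u : R) :
  1 <= K -> params_in_box K p -> 0 < u < half_domain K ->
  (crossing_periodic_orbit p u <-> gap_sum p u = 0).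
Proof.
intros HK Hp Hu.
assert (NL := left_map_neg K p u HK Hp Hu). assert (NR := right_map_neg K p u HK Hp Hu).
assert (EG := gap_maps K p u HK Hp ltac:(lra)).
split.
- intros [_ [y1 (H1 & H2 & _)]].
  apply (left_half_return_iff K p u y1 HK Hp Hu) in H1.
  apply (right_half_return_iff K p u y1 HK Hp Hu) in H2.
  assert (E : left_map p u = right_map p u).
  { rewrite <- (Rinv_inv (left_map p u)), <- H1, H2. apply Rinv_inv. }
  rewrite E, Rminus_diag in EG. destruct (Rmult_integral _ _ EG); lra.
- intros H0. rewrite H0, Rmult_0_r in EG.
  assert (E : left_map p u = right_map p u) by lra.
  split; [easy|]. exists (/ left_map p u).
  split; [now apply (left_half_return_iff K)|].
  split; [rewrite E; now apply (right_half_return_iff K)|].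
  (* At (0, 1/z) the horizontal components are - (1 + b z) / z and - (1 - b z) / z, so a small |b z|
     gives them the same sign. *)
  assert (Hcr : forall z, z <> 0 -> Rabs (offset p * z) <= / 16 -> crossing_point p (/ z)).
  { intros z Hz Hb. unfold crossing_point; simpl.
    set (o := offset p) in *.
    replace ((2 * gamma_L p * 0 - / z - o) * (2 * gamma_R p * 0 - / z + o))
      with ((/ z) ^ 2 * ((1 - o * z) * (1 + o * z))) by (field; easy).
    apply Rabs_le_between in Hb.
    apply Rmult_lt_0_compat; [|nra].
    assert (/ z <> 0) by now apply Rinv_neq_0_compat.
    destruct (Rtotal_order (/ z) 0) as [?|[?|?]]; [|easy|]; simpl; nra. }
  destruct (params_in_box_halves K p Hp) as [HL _].
  assert (Hu' : Rabs u < half_domain K) by (rewrite Rabs_pos_eq; lra).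
  destruct (half_domain_facts K _ _ _ u HK HL Hu') as (_ & _ & _ & _ & _ & B1 & B2).
  split; apply Hcr; auto; lra.
Qed.

Lemma params_box_exists (p : params) : exists K, 1 <= K /\ params_in_box K p.
Proof.
exists (1 + Rabs (gamma_L p) + Rabs (gamma_R p) + Rabs (offset p) + Rabs (x_L p) + Rabs (x_R p)).
generalize (Rabs_pos (gamma_L p)), (Rabs_pos (gamma_R p)), (Rabs_pos (offset p)),
  (Rabs_pos (x_L p)), (Rabs_pos (x_R p)). intros.
unfold params_in_box. repeat split; lra.
Qed.

Lemma gap_has_sum (K : R) (p : params) (u : R) :
  1 <= K -> params_in_box K p -> Rabs u < half_domain K ->
  Rbar_lt (Rabs u) (CV_radius (gap_series p)).
Proof.
intros HK Hp Hu. destruct (params_in_box_halves K p Hp) as [HL HR].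
destruct (half_domain_facts K _ _ _ u HK HL Hu) as (_ & CL & _).
destruct (half_domain_facts K _ _ _ u HK HR Hu) as (_ & CR & _).
apply has_sum_intro in CL, CR.
exact (has_sum_radius _ _ _ (has_sum_minus _ _ _ _ _ CL CR)).
Qed.

Lemma displacement_series_gap (p : params) : displacement_series p (shift (gap_series p)).
Proof.
destruct (params_box_exists p) as [K [HK Hp]].
split; [reflexivity|]. exists (half_domain K). split; [now apply half_domain_pos|].
intros u Hu. split; [|split].
- exists (/ left_map p u). now apply (left_half_return_iff K).
- exists (/ right_map p u). now apply (right_half_return_iff K).
- rewrite (Delta_gap K) by easy. unfold gap_sum. rewrite <- PSeries_shift.
  apply is_pseries_PSeries. apply has_sum_radius with (u * gap_sum p u).
  apply has_sum_shift, has_sum_intro, (gap_has_sum K); try easy.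
  rewrite Rabs_pos_eq; lra.
Qed.

(** * Coefficients of the displacement map *)

Lemma ode_series_1 (w0 e bt d b : R) :
  ode_series w0 e bt d b 1%nat = - e * (w0 ^ 2 - w0).
Proof.
assert (H := ode_series_eq w0 e bt d b 0). cbv zeta in H.
unfold PS_derive, ode_rhs, PS_mult in H. simpl in H.
change (ode_series w0 e bt d b 0%nat) with w0 in H. lra.
Qed.

Lemma ode_series_2 (w0 e bt d b : R) :
  let w1 := ode_series w0 e bt d b 1%nat in
  ode_series w0 e bt d b 2%nat =
  (- e * (2 * w0 - 1) * w1 + d * (w0 ^ 3 - w0) - w1 * (b * w0 - 2 * bt)) / 2.
Proof.
intros w1.
assert (H := ode_series_eq w0 e bt d b 1). cbv zeta in H.
unfold PS_derive, ode_rhs, ode_low, PS_mult in H. simpl in H. fold w1 in H.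
change (ode_series w0 e bt d b 0%nat) with w0 in H. lra.
Qed.

Lemma ode_series_3 (w0 e bt d b : R) :
  let w1 := ode_series w0 e bt d b 1%nat in
  let w2 := ode_series w0 e bt d b 2%nat in
  ode_series w0 e bt d b 3%nat =
  (- e * (2 * w0 * w2 + w1 ^ 2 - w2) + d * (3 * w0 ^ 2 * w1 - w1)
   + b * d * (w0 ^ 3 - w0 ^ 2)
   - w1 * (d + b * w1 - 2 * b * bt * w0) - 2 * w2 * (b * w0 - 2 * bt)) / 3.
Proof.
intros w1 w2.
assert (H := ode_series_eq w0 e bt d b 2). cbv zeta in H.
unfold PS_derive, ode_rhs, ode_low, PS_mult in H. simpl in H. fold w1 w2 in H.
change (ode_series w0 e bt d b 0%nat) with w0 in H. lra.
Qed.

(** Closed forms of the first coefficients, written with products and the constant factor / 2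
    instead of powers and quotients, so that [solve_filterdiff] can split them. *)
Definition half_coeff_0 (g : R) : R := - exp (- (PI * g)).
Definition half_coeff_1 (g b x : R) : R := - (2 * g * x - b) * (half_coeff_0 g * half_coeff_0 g - half_coeff_0 g).
Definition half_coeff_2 (g b x : R) : R :=
  (- (2 * g * x - b) * (2 * half_coeff_0 g - 1) * half_coeff_1 g b x
   + (x * x + (g * x - b) * (g * x - b)) * (half_coeff_0 g * half_coeff_0 g * half_coeff_0 g - half_coeff_0 g)
   - half_coeff_1 g b x * (b * half_coeff_0 g - 2 * (g * x - b))) * / 2.

Lemma half_series_1 (g b x : R) : half_series g b x 1%nat = half_coeff_1 g b x.
Proof. unfold half_series. rewrite ode_series_1. unfold half_coeff_1, half_coeff_0. ring. Qed.

Lemma half_series_2 (g b x : R) : half_series g b x 2%nat = half_coeff_2 g b x.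
Proof.
unfold half_series. rewrite ode_series_2. fold (half_series g b x). rewrite half_series_1.
unfold half_coeff_2, half_coeff_0, modulus2, center_y. field.
Qed.

Lemma gap_series_0 (p : params) :
  gap_series p 0%nat = exp (PI * gamma_R p) - exp (- (PI * gamma_L p)).
Proof.
unfold gap_series, left_series, right_series, half_series. rewrite !ode_series_0.
replace (- (PI * - gamma_R p)) with (PI * gamma_R p) by ring. ring.
Qed.

(** With gamma_R = - gamma_L both series start at - c, and the coefficients e of the two equations
    are [y_L] and [y_R]. *)
Lemma gap_series_1 (p : params) :
  gamma_R p = - gamma_L p ->
  let c := exp (- (PI * gamma_L p)) in
  gap_series p 1%nat = - (c * (1 + c) * (y_L p - y_R p)).
Proof.
intros E c. unfold gap_series, left_series, right_series. rewrite !half_series_1.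
unfold half_coeff_1, half_coeff_0, y_L, y_R. rewrite E, Ropp_involutive. fold c. ring.
Qed.

(** Here [y_L] = [y_R]. The factor 1 - c^2 vanishes exactly for gamma_L = 0, which is where gL <> 0
    enters (b). *)
Lemma gap_series_2 (p : params) :
  gamma_R p = - gamma_L p -> offset p = gamma_L p * (x_L p + x_R p) ->
  let c := exp (- (PI * gamma_L p)) in
  gap_series p 2%nat =
  c * (1 - c ^ 2) * (1 + gamma_L p ^ 2) * (x_L p ^ 2 - x_R p ^ 2) / 2.
Proof.
intros E E' c. unfold gap_series, left_series, right_series. rewrite !half_series_2.
unfold half_coeff_2, half_coeff_1, half_coeff_0. rewrite E, E', Ropp_involutive. fold c. field.
Qed.

(** Now [y_L] = [y_R] = 0, so e = 0 and both linear coefficients vanish. The right data are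
    (gamma_L, - b, - x_L), so this is twice the third left coefficient. *)
Lemma gap_series_3 (p : params) :
  gamma_R p = - gamma_L p -> offset p = 2 * gamma_L p * x_L p -> x_R p = x_L p ->
  let c := exp (- (PI * gamma_L p)) in
  gap_series p 3%nat =
  - (4 / 3 * c * (1 + c ^ 3) * gamma_L p * (1 + gamma_L p ^ 2) * x_L p ^ 3).
Proof.
intros E E' E'' c. unfold gap_series, left_series, right_series, half_series.
rewrite !ode_series_3.
fold (half_series (gamma_L p) (offset p) (x_L p)).
fold (half_series (- gamma_R p) (- offset p) (- x_R p)).
rewrite !half_series_1, !half_series_2.
unfold half_coeff_2, half_coeff_1, half_coeff_0, modulus2, center_y. rewrite E, E', E'', Ropp_involutive. fold c. field.
Qed.

(** * Dependence of the coefficients on the parameters *)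

Lemma continuous_Rplus {U : UniformSpace} (f g : U -> R) (t : U) :
  continuous f t -> continuous g t -> continuous (fun s => f s + g s) t.
Proof. apply (continuous_plus (V := R_NormedModule)). Qed.

Lemma continuous_Rminus {U : UniformSpace} (f g : U -> R) (t : U) :
  continuous f t -> continuous g t -> continuous (fun s => f s - g s) t.
Proof. apply (continuous_minus (V := R_NormedModule)). Qed.

Lemma continuous_Ropp {U : UniformSpace} (f : U -> R) (t : U) :
  continuous f t -> continuous (fun s => - f s) t.
Proof. apply (continuous_opp (V := R_NormedModule)). Qed.

Lemma continuous_Rmult {U : UniformSpace} (f g : U -> R) (t : U) :
  continuous f t -> continuous g t -> continuous (fun s => f s * g s) t.
Proof. apply (continuous_mult (K := R_AbsRing)). Qed.

Lemma continuous_exp_comp {U : UniformSpace} (f : U -> R) (t : U) :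
  continuous f t -> continuous (fun s => exp (f s)) t.
Proof.
intros Hf. apply (continuous_comp f exp); [easy|].
apply (ex_derive_continuous exp). exists (exp (f t)). apply is_derive_exp.
Qed.

Ltac split_continuous :=
  lazymatch goal with
  | |- continuous (fun s => @?f s + @?g s) ?t => apply (continuous_Rplus f g t)
  | |- continuous (fun s => @?f s - @?g s) ?t => apply (continuous_Rminus f g t)
  | |- continuous (fun s => @?f s * @?g s) ?t => apply (continuous_Rmult f g t)
  | |- continuous (fun s => - @?f s) ?t => apply (continuous_Ropp f t)
  | |- continuous (fun s => exp (@?f s)) ?t => apply (continuous_exp_comp f t)
  | |- continuous (fun _ => ?c) _ => apply continuous_const
  end.

Ltac solve_continuous := repeat first [ assumption | progress split_continuous ].

Lemma continuous_PS_mult {U : UniformSpace} (a c : U -> nat -> R) (t : U) (n : nat) :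
  (forall k, (k <= n)%nat -> continuous (fun s => a s k) t) ->
  (forall k, (k <= n)%nat -> continuous (fun s => c s k) t) ->
  continuous (fun s => PS_mult (a s) (c s) n) t.
Proof.
intros Ha Hc. unfold PS_mult.
assert (H : forall m, (m <= n)%nat ->
  continuous (fun s => sum_f_R0 (fun k => a s k * c s (n - k)%nat) m) t).
{ induction m as [|m IH]; intros Hm; simpl.
  - apply continuous_Rmult; [apply Ha|apply Hc]; lia.
  - apply continuous_Rplus; [apply IH; lia|].
    apply continuous_Rmult; [apply Ha|apply Hc]; lia. }
now apply H.
Qed.

Lemma continuous_shift {U : UniformSpace} (a : U -> nat -> R) (t : U) (n : nat) :
  (forall k, (k < n)%nat -> continuous (fun s => a s k) t) ->
  continuous (fun s => shift (a s) n) t.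
Proof.
intros Ha. destruct n as [|n]; simpl; [apply continuous_const|]. apply Ha. lia.
Qed.

Lemma continuous_ode_series {U : UniformSpace} (w0 e bt d b : U -> R) (t : U) (n : nat) :
  continuous w0 t -> continuous e t -> continuous bt t -> continuous d t -> continuous b t ->
  continuous (fun s => ode_series (w0 s) (e s) (bt s) (d s) (b s) n) t.
Proof.
intros Hw He Ht Hd Hb. induction n as [n IH] using (well_founded_induction Nat.lt_wf_0).
destruct n as [|n]; [exact Hw|].
set (w := fun s => ode_series (w0 s) (e s) (bt s) (d s) (b s)) in *.
assert (IH' : forall k, (k <= n)%nat -> continuous (fun s => w s k) t).
{ intros k Hk. apply IH. lia. }
assert (W2 : forall k, (k <= n)%nat -> continuous (fun s => PS_mult (w s) (w s) k) t).
{ intros k Hk. apply continuous_PS_mult; intros; apply IH'; lia. }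
assert (W3 : forall k, (k <= n)%nat ->
   continuous (fun s => PS_mult (w s) (PS_mult (w s) (w s)) k) t).
{ intros k Hk. apply continuous_PS_mult; intros; [apply IH'|apply W2]; lia. }
assert (HL : forall k, (k <= n)%nat ->
   continuous (fun s => ode_low (bt s) (d s) (b s) (w s) k) t).
{ intros k Hk. unfold ode_low. apply continuous_Rplus; [apply continuous_Rplus;
    [apply continuous_Rplus; [apply continuous_Rplus|]|]|].
  - solve_continuous.
  - apply continuous_shift. intros. solve_continuous.
  - apply continuous_Rmult; [easy|now apply IH'].
  - apply continuous_shift. intros. apply continuous_Rmult; [solve_continuous|apply IH'; lia].
  - apply continuous_shift. intros. apply continuous_shift. intros.
    apply continuous_Rmult; [solve_continuous|apply IH'; lia]. }
apply (continuous_ext (fun s => ode_step (w0 s) (e s) (bt s) (d s) (b s) (w s) (S n))).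
{ intros s. symmetry. apply causal_fixpoint_eq, ode_step_causal. }
unfold ode_step, Rdiv. apply continuous_Rmult; [|apply continuous_const].
apply continuous_Rminus.
- unfold ode_rhs. apply continuous_Rplus; [apply continuous_Rplus|].
  + apply continuous_Rmult; [solve_continuous|].
    apply continuous_Rminus; [now apply W2|now apply IH'].
  + apply continuous_shift. intros. apply continuous_Rmult; [easy|].
    apply continuous_Rminus; [apply W3|apply IH']; lia.
  + apply continuous_shift. intros. apply continuous_shift. intros.
    apply continuous_Rmult; [solve_continuous|].
    apply continuous_Rminus; [apply W3|apply W2]; lia.
- apply continuous_shift. intros k Hk. apply continuous_PS_mult.
  + intros j Hj. unfold PS_derive. apply continuous_Rmult; [apply continuous_const|].
    apply IH'. lia.
  + intros j Hj. apply HL. lia.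
Qed.

Definition continuous_params {U : UniformSpace} (P : U -> params) (t : U) : Prop :=
  continuous (fun s => gamma_L (P s)) t /\ continuous (fun s => gamma_R (P s)) t /\
  continuous (fun s => offset (P s)) t /\ continuous (fun s => x_L (P s)) t /\
  continuous (fun s => x_R (P s)) t.

Lemma continuous_half_series {U : UniformSpace} (g b x : U -> R) (t : U) (n : nat) :
  continuous g t -> continuous b t -> continuous x t ->
  continuous (fun s => half_series (g s) (b s) (x s) n) t.
Proof.
intros Hg Hb Hx. unfold half_series. apply continuous_ode_series; unfold center_y, modulus2, pow;
  solve_continuous.
Qed.

Lemma continuous_gap_series {U : UniformSpace} (P : U -> params) (t : U) (n : nat) :
  continuous_params P t -> continuous (fun s => gap_series (P s) n) t.
Proof.
intros (H1 & H2 & H3 & H4 & H5). unfold gap_series, left_series, right_series.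
apply continuous_Rminus; apply continuous_half_series; solve_continuous.
Qed.

Lemma ex_filterdiff_Rplus {U : NormedModule R_AbsRing} (f g : U -> R) (t : U) :
  ex_filterdiff f (locally t) -> ex_filterdiff g (locally t) ->
  ex_filterdiff (fun s => f s + g s) (locally t).
Proof. apply (ex_filterdiff_plus_fct (V := R_NormedModule)). Qed.

Lemma ex_filterdiff_Rminus {U : NormedModule R_AbsRing} (f g : U -> R) (t : U) :
  ex_filterdiff f (locally t) -> ex_filterdiff g (locally t) ->
  ex_filterdiff (fun s => f s - g s) (locally t).
Proof. apply (ex_filterdiff_minus_fct (V := R_NormedModule)). Qed.

Lemma ex_filterdiff_Ropp {U : NormedModule R_AbsRing} (f : U -> R) (t : U) :
  ex_filterdiff f (locally t) -> ex_filterdiff (fun s => - f s) (locally t).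
Proof. apply (ex_filterdiff_opp_fct (V := R_NormedModule)). Qed.

Lemma ex_filterdiff_Rmult {U : NormedModule R_AbsRing} (f g : U -> R) (t : U) :
  ex_filterdiff f (locally t) -> ex_filterdiff g (locally t) ->
  ex_filterdiff (fun s => f s * g s) (locally t).
Proof. apply (ex_filterdiff_mult_fct (K := R_AbsRing)). exact Rmult_comm. Qed.

Lemma ex_filterdiff_Rconst {U : NormedModule R_AbsRing} (c : R) (t : U) :
  ex_filterdiff (fun _ : U => c) (locally t).
Proof. apply (ex_filterdiff_const (V := R_NormedModule)). Qed.

Lemma ex_filterdiff_exp_comp {U : NormedModule R_AbsRing} (f : U -> R) (t : U) :
  ex_filterdiff f (locally t) -> ex_filterdiff (fun s => exp (f s)) (locally t).
Proof.
intros Hf. apply (ex_filterdiff_comp' (V := R_NormedModule) (W := R_NormedModule) f exp); [easy|].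
apply (ex_derive_filterdiff (V := R_NormedModule) exp). exists (exp (f t)). apply is_derive_exp.
Qed.

Ltac solve_filterdiff := repeat first
  [ assumption
  | lazymatch goal with
    | |- ex_filterdiff (fun s => @?f s + @?g s) (locally ?t) => apply (ex_filterdiff_Rplus f g t)
    | |- ex_filterdiff (fun s => @?f s - @?g s) (locally ?t) => apply (ex_filterdiff_Rminus f g t)
    | |- ex_filterdiff (fun s => @?f s * @?g s) (locally ?t) => apply (ex_filterdiff_Rmult f g t)
    | |- ex_filterdiff (fun s => - @?f s) (locally ?t) => apply (ex_filterdiff_Ropp f t)
    | |- ex_filterdiff (fun s => exp (@?f s)) (locally ?t) => apply (ex_filterdiff_exp_comp f t)
    | |- ex_filterdiff (fun _ => ?c) _ => apply ex_filterdiff_Rconst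
    end ].

(** Codimension k requires the differentials of coefficients 0 to k - 1, and k is at most 3. *)
Lemma ex_filterdiff_gap_series {U : NormedModule R_AbsRing} (gL gR b xL xR : U -> R) (t : U)
    (n : nat) :
  ex_filterdiff gL (locally t) -> ex_filterdiff gR (locally t) ->
  ex_filterdiff b (locally t) -> ex_filterdiff xL (locally t) ->
  ex_filterdiff xR (locally t) -> (n <= 2)%nat ->
  ex_filterdiff (fun s => gap_series (Params (gL s) (gR s) (b s) (xL s) (xR s)) n) (locally t).
Proof.
intros H1 H2 H3 H4 H5 Hn.
assert (G0 : forall g, ex_filterdiff g (locally t) ->
  ex_filterdiff (fun s => half_coeff_0 (g s)) (locally t)).
{ intros g Hg. unfold half_coeff_0. solve_filterdiff. }
assert (G1 : forall g b x, ex_filterdiff g (locally t) -> ex_filterdiff b (locally t) ->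
  ex_filterdiff x (locally t) -> ex_filterdiff (fun s => half_coeff_1 (g s) (b s) (x s)) (locally t)).
{ intros g c x Hg Hc Hx. assert (Hh := G0 g Hg). unfold half_coeff_1. solve_filterdiff. }
assert (G2 : forall g b x, ex_filterdiff g (locally t) -> ex_filterdiff b (locally t) ->
  ex_filterdiff x (locally t) -> ex_filterdiff (fun s => half_coeff_2 (g s) (b s) (x s)) (locally t)).
{ intros g c x Hg Hc Hx. assert (Hh := G0 g Hg). assert (Hh1 := G1 g c x Hg Hc Hx).
  unfold half_coeff_2. solve_filterdiff. }
unfold gap_series, left_series, right_series; simpl.
destruct n as [|[|[|n]]]; [| | |lia].
- apply ex_filterdiff_Rminus; apply G0; solve_filterdiff.
- apply ex_filterdiff_Rminus.
  + apply (ex_filterdiff_ext (fun s => half_coeff_1 (gL s) (b s) (xL s))).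
    * intros s. symmetry. apply half_series_1.
    * now apply G1.
  + apply (ex_filterdiff_ext (fun s => half_coeff_1 (- gR s) (- b s) (- xR s))).
    * intros s. symmetry. apply half_series_1.
    * apply G1; solve_filterdiff.
- apply ex_filterdiff_Rminus.
  + apply (ex_filterdiff_ext (fun s => half_coeff_2 (gL s) (b s) (xL s))).
    * intros s. symmetry. apply half_series_2.
    * now apply G2.
  + apply (ex_filterdiff_ext (fun s => half_coeff_2 (- gR s) (- b s) (- xR s))).
    * intros s. symmetry. apply half_series_2.
    * apply G2; solve_filterdiff.
Qed.

(** * Counting and creating zeros *)

Fixpoint increasing_from (a : R) (l : list R) : Prop :=
  match l with
  | nil => True
  | b :: l => a < b /\ increasing_from b l
  end.

Lemma increasing_from_le (a a' : R) (l : list R) :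
  a' <= a -> increasing_from a l -> increasing_from a' l.
Proof. destruct l as [|b l]; simpl; [easy|]. intros; split; [lra|tauto]. Qed.

Lemma insert_increasing (x a : R) (l : list R) :
  a < x -> ~ In x l -> increasing_from a l ->
  exists l', Permutation (x :: l) l' /\ increasing_from a l'.
Proof.
revert a. induction l as [|b l IH]; intros a Ha Hx Hl.
- exists (x :: nil). split; [apply Permutation_refl|]. simpl. tauto.
- destruct Hl as [Hab Hl].
  destruct (Rtotal_order x b) as [H|[H|H]].
  + exists (x :: b :: l). split; [apply Permutation_refl|]. simpl. tauto.
  + exfalso. apply Hx. now left.
  + destruct (IH b) as [l' [P I]]; [easy| |easy|].
    * intros Hi. apply Hx. now right.
    * exists (b :: l'). split; [|now split].
      apply perm_trans with (b :: x :: l); [apply perm_swap | now apply perm_skip].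
Qed.

Lemma sort_increasing (a : R) (l : list R) :
  NoDup l -> (forall u, In u l -> a < u) ->
  exists l', Permutation l l' /\ increasing_from a l'.
Proof.
induction 1 as [|x l Hx Hl IH]; intros H.
- exists nil. now split.
- destruct IH as [l1 [P1 I1]]; [intros; apply H; now right|].
  destruct (insert_increasing x a l1) as [l' [P' I']]; auto.
  + apply H. now left.
  + intros Hi. apply Hx. apply (Permutation_in x (Permutation_sym P1) Hi).
  + exists l'. split; [|easy]. apply perm_trans with (x :: l1); [now apply perm_skip|easy].
Qed.

Lemma increasing_from_In (a u : R) (l : list R) : increasing_from a l -> In u l -> a < u.
Proof.
revert a. induction l as [|b l IH]; simpl; [easy|].
intros a [H1 H2] [<-|H]; [easy|]. apply Rlt_trans with b; auto.
Qed.

Lemma increasing_from_NoDup (a : R) (l : list R) : increasing_from a l -> NoDup l.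
Proof.
revert a. induction l as [|b l IH]; simpl; constructor.
- intros Hi. generalize (increasing_from_In b b l (proj2 H) Hi). lra.
- apply (IH b). tauto.
Qed.

Definition at_most_zeros (k : nat) (f : R -> R) (r : R) : Prop :=
  forall l, NoDup l -> (forall u, In u l -> 0 < u < r /\ f u = 0) -> (length l <= k)%nat.

(** Rolle between consecutive zeros of the list headed by a: one zero is lost, so the new list has
    the length of the tail. *)
Lemma rolle_list (f f' : R -> R) (r a : R) (l : list R) :
  (forall u, 0 < u < r -> is_derive f u (f' u)) ->
  0 < a < r -> f a = 0 -> increasing_from a l -> (forall u, In u l -> u < r /\ f u = 0) ->
  exists l', length l' = length l /\ increasing_from a l' /\
    forall u, In u l' -> u < r /\ f' u = 0.
Proof.
intros Hd. revert a. induction l as [|b l IH]; intros a Ha Fa Hi Hl.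
- exists nil. now simpl.
- destruct Hi as [Hab Hi]. destruct (Hl b ltac:(now left)) as [Hb Fb].
  destruct (IH b) as [l' (L & I & Z)]; auto; [lra| |].
  + intros; apply Hl; now right.
  + destruct (MVT_cor2 f f' a b Hab) as [c [Ec Hc]].
    { intros c Hc. apply is_derive_Reals, Hd. lra. }
    exists (c :: l'). simpl. split; [now rewrite L|]. split.
    * split; [lra|]. apply increasing_from_le with b; [lra|easy].
    * intros u [<-|Hu]; [|now apply Z]. split; [lra|].
      rewrite Fa, Fb, Rminus_diag in Ec. symmetry in Ec.
      destruct (Rmult_integral _ _ Ec); lra.
Qed.

Lemma at_most_zeros_derive (k : nat) (f f' : R -> R) (r : R) :
  (forall u, 0 < u < r -> is_derive f u (f' u)) ->
  at_most_zeros k f' r -> at_most_zeros (S k) f r.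
Proof.
intros Hd Hk l Hl Hz.
destruct (sort_increasing 0 l Hl) as [l1 [P I]]; [intros; now apply Hz|].
rewrite (Permutation_length P).
assert (Hz1 : forall u, In u l1 -> 0 < u < r /\ f u = 0).
{ intros u Hu. apply Hz. apply (Permutation_in u (Permutation_sym P) Hu). }
destruct l1 as [|a l1]; [simpl; lia|]. destruct I as [Ia I].
destruct (Hz1 a ltac:(now left)) as [Ha Fa].
destruct (rolle_list f f' r a l1 Hd Ha Fa I) as [l' (L & I' & Z')].
{ intros u Hu. destruct (Hz1 u ltac:(now right)). split; [lra|easy]. }
simpl. rewrite <- L. apply le_n_S. apply Hk.
- now apply increasing_from_NoDup with a.
- intros u Hu. destruct (Z' u Hu). generalize (increasing_from_In a u l' I' Hu).
  intros. split; [lra|easy].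
Qed.

Lemma at_most_zeros_le (k : nat) (f : R -> R) (r r' : R) :
  r' <= r -> at_most_zeros k f r -> at_most_zeros k f r'.
Proof.
intros Hr H l Hl Hz. apply H; [easy|]. intros u Hu. destruct (Hz u Hu). split; [lra|easy].
Qed.

(** Differentiating k times leaves a series whose constant term is at least kappa in absolute value,
    hence without small positive zeros. The radius depends only on k, C, rho and kappa, so it serves
    all nearby parameters. *)
Lemma PSeries_at_most_zeros (k : nat) (C rho kappa : R) :
  0 < rho -> 0 < kappa ->
  exists r, 0 < r /\ forall a, geometric_bound C rho a -> kappa <= Rabs (a k) ->
    at_most_zeros k (PSeries a) r.
Proof.
revert C rho. induction k as [|k IH]; intros C rho Hr Hk.
- set (M := Rmax 1 (2 * C / rho)).
  assert (HM : 1 <= M) by apply Rmax_l. assert (HM' : 2 * C / rho <= M) by apply Rmax_r.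
  exists (Rmin (rho / 2) (kappa / M)). split.
  { apply Rmin_glb_lt; [lra|]. apply Rdiv_lt_0_compat; lra. }
  intros a Ha Hka l Hl Hz. destruct l as [|u l]; [simpl; lia|exfalso].
  destruct (Hz u ltac:(now left)) as [Hu Fu].
  assert (U1 : u < rho / 2) by (eapply Rlt_le_trans; [apply Hu|apply Rmin_l]).
  assert (U2 : u < kappa / M) by (eapply Rlt_le_trans; [apply Hu|apply Rmin_r]).
  assert (B := PSeries_near_0 C rho u a Hr Ha). rewrite (Rabs_pos_eq u) in B by lra.
  specialize (B ltac:(lra)). rewrite Fu, Rminus_0_l, Rabs_Ropp in B.
  assert (u * M < kappa).
  { apply Rmult_lt_reg_r with (/ M); [apply Rinv_0_lt_compat; lra|].
    rewrite Rmult_assoc, Rinv_r, Rmult_1_r by lra. exact U2. }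
  assert (2 * C / rho * u <= M * u) by (apply Rmult_le_compat_r; lra).
  lra.
- destruct (IH (C / rho) (rho / 2) ltac:(lra) Hk) as [r [Hr0 H]].
  exists (Rmin r rho). split; [apply Rmin_glb_lt; lra|].
  intros a Ha Hka.
  apply at_most_zeros_derive with (PSeries (PS_derive a)).
  + intros u Hu. apply is_derive_PSeries. apply (CV_radius_geometric C rho); [lra|easy|].
    rewrite Rabs_pos_eq by lra. eapply Rlt_le_trans; [apply Hu|apply Rmin_r].
  + apply at_most_zeros_le with r; [apply Rmin_l|]. apply H.
    * now apply geometric_bound_derive.
    * unfold PS_derive. rewrite Rabs_mult, (Rabs_pos_eq (INR (S k))) by apply pos_INR.
      rewrite S_INR. generalize (pos_INR k), (Rabs_pos (a (S k))). nra.
Qed.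

(** * Continuity in the parameter and alternating signs *)

Fixpoint partial_poly (a : nat -> R) (n : nat) (u : R) : R :=
  match n with O => 0 | S n => a 0%nat + u * partial_poly (PS_decr_1 a) n u end.

Lemma PSeries_decr (C rho u : R) (a : nat -> R) :
  0 < rho -> geometric_bound C rho a -> Rabs u <= rho / 2 ->
  PSeries a u = a 0%nat + u * PSeries (PS_decr_1 a) u.
Proof.
intros Hr Ha Hu. apply PSeries_decr_1, CV_radius_inside, (CV_radius_geometric C rho); lra || easy.
Qed.

Lemma partial_poly_bound (rho u : R) (n : nat) :
  0 < rho -> Rabs u <= rho / 2 -> forall C a, geometric_bound C rho a ->
  Rabs (PSeries a u - partial_poly a n u) <= 2 * C * (/ 2) ^ n.
Proof.
intros Hr Hu. induction n as [|n IH]; intros C a Ha; simpl.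
- rewrite Rminus_0_r, Rmult_1_r. now apply (PSeries_bound C rho).
- rewrite (PSeries_decr C rho) by easy.
  replace (a 0%nat + u * PSeries (PS_decr_1 a) u - (a 0%nat + u * partial_poly (PS_decr_1 a) n u))
    with (u * (PSeries (PS_decr_1 a) u - partial_poly (PS_decr_1 a) n u)) by ring.
  rewrite Rabs_mult.
  specialize (IH _ _ (geometric_bound_decr C rho a Hr Ha)).
  apply Rle_trans with (rho / 2 * (2 * (C / rho) * (/ 2) ^ n)).
  + apply Rmult_le_compat; auto using Rabs_pos.
  + right. field. lra.
Qed.

Lemma continuous_partial_poly {U : UniformSpace} (u : R) (t : U) (n : nat) :
  forall a : U -> nat -> R, (forall n, continuous (fun s => a s n) t) ->
  continuous (fun s => partial_poly (a s) n u) t.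
Proof.
induction n as [|n IH]; intros a Ha; simpl; [apply continuous_const|].
apply continuous_Rplus; [apply Ha|]. apply continuous_Rmult; [apply continuous_const|].
apply (IH (fun s => PS_decr_1 (a s))). intros m. apply (Ha (S m)).
Qed.

(** The common geometric bound makes the tails uniformly small, and each partial sum is continuous
    in the parameter. *)
Lemma continuous_PSeries_param {U : UniformSpace} (C rho u : R) (a : U -> nat -> R) (t : U) :
  0 < rho -> Rabs u <= rho / 2 ->
  locally t (fun s => geometric_bound C rho (a s)) ->
  (forall n, continuous (fun s => a s n) t) ->
  continuous (fun s => PSeries (a s) u) t.
Proof.
intros Hr Hu Hb Hc. apply filterlim_locally. intros eps.
assert (Ht : geometric_bound C rho (a t)) by exact (locally_singleton _ _ Hb).
assert (HC : 0 <= C).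
{ specialize (Ht 0%nat). generalize (Rabs_pos (a t 0%nat)). simpl in Ht. lra. }
(* This makes each of the two tails 2 C / 2^n smaller than eps / 3; C + 1 replaces C, which may be
   0. *)
destruct (pow_lt_1_zero (/ 2) ltac:(rewrite Rabs_pos_eq; lra) (eps / (6 * (C + 1))))
  as [n Hn].
{ apply Rdiv_lt_0_compat; [apply cond_pos|lra]. }
specialize (Hn n (Nat.le_refl n)). rewrite Rabs_pos_eq in Hn by (apply pow_le; lra).
assert (Hn' : 2 * C * (/ 2) ^ n < eps / 3).
{ assert (He := cond_pos eps).
  assert ((/ 2) ^ n * (6 * (C + 1)) < eps).
  { apply Rmult_lt_reg_r with (/ (6 * (C + 1))); [apply Rinv_0_lt_compat; lra|].
    rewrite Rmult_assoc, Rinv_r, Rmult_1_r by lra. exact Hn. }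
  assert (0 < (/ 2) ^ n) by (apply pow_lt; lra). nra. }
assert (Hp := continuous_partial_poly u t n a Hc).
assert (He3 : 0 < eps / 3) by (generalize (cond_pos eps); lra).
apply filterlim_locally with (eps := mkposreal _ He3) in Hp.
generalize (filter_and _ _ Hb Hp). apply filter_imp. intros s [Hs1 Hs2].
assert (B1 := partial_poly_bound rho u n Hr Hu C _ Hs1).
assert (B2 := partial_poly_bound rho u n Hr Hu C _ Ht).
unfold ball in *; simpl in *. unfold AbsRing_ball, abs, minus, plus, opp in *; simpl in *.
apply Rabs_le_between in B1, B2. apply Rabs_lt_between in Hs2. apply Rabs_lt_between. lra.
Qed.

Lemma PSeries_leading_sign (C rho s : R) (j : nat) (a : nat -> R) :
  0 < rho -> geometric_bound C rho a ->
  (forall i, (i < j)%nat -> a i = 0) -> 0 < s * a j ->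
  forall d, 0 < d -> exists u, 0 < u < d /\ 0 < s * PSeries a u.
Proof.
intros Hr. revert C a. induction j as [|j IH]; intros C a Ha Hz Hs d Hd.
- set (M := Rmax 1 (2 * C / rho)).
  assert (HM : 1 <= M) by apply Rmax_l. assert (HM' : 2 * C / rho <= M) by apply Rmax_r.
  assert (Hs0 : 0 < Rabs s) by (apply Rabs_pos_lt; intros ->; lra).
  (* Chosen so that |s| M q is half of s a_0: the remainder cannot cancel the leading term. *)
  set (q := s * a 0%nat / (2 * Rabs s * M)).
  assert (Hq : 0 < q) by (apply Rdiv_lt_0_compat; nra).
  set (u := Rmin (rho / 2) (Rmin (d / 2) q)).
  assert (U0 : 0 < u) by (repeat apply Rmin_glb_lt; lra).
  assert (U1 : u <= rho / 2) by apply Rmin_l.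
  assert (U2 : u <= d / 2) by (eapply Rle_trans; [apply Rmin_r|apply Rmin_l]).
  assert (U3 : u <= q) by (eapply Rle_trans; [apply Rmin_r|apply Rmin_r]).
  exists u. split; [lra|].
  assert (B := PSeries_near_0 C rho u a Hr Ha). rewrite (Rabs_pos_eq u) in B by lra.
  specialize (B U1).
  assert (B' : Rabs (s * (PSeries a u - a 0%nat)) <= s * a 0%nat / 2).
  { rewrite Rabs_mult. apply Rle_trans with (Rabs s * (M * q)).
    - apply Rmult_le_compat_l; [lra|]. eapply Rle_trans; [exact B|].
      apply Rle_trans with (M * u); [apply Rmult_le_compat_r; lra|].
      apply Rmult_le_compat_l; lra.
    - right. unfold q. field. lra. }
  apply Rabs_le_between in B'. lra.
- destruct (IH (C / rho) (PS_decr_1 a)) with (d := Rmin d (rho / 2)) as [u [Hu Hp]].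
  + now apply geometric_bound_decr.
  + intros i Hi. apply Hz. lia.
  + exact Hs.
  + apply Rmin_glb_lt; lra.
  + assert (U1 := Rmin_l d (rho / 2)). assert (U2 := Rmin_r d (rho / 2)).
    exists u. split; [lra|].
    rewrite (PSeries_decr C rho) by (try easy; rewrite Rabs_pos_eq; lra).
    rewrite Hz by lia. replace (s * (0 + u * PSeries (PS_decr_1 a) u)) with
      (u * (s * PSeries (PS_decr_1 a) u)) by ring.
    apply Rmult_lt_0_compat; lra.
Qed.

(** Strict signs at m + 1 increasing points, hence m sign changes. Finitely many strict inequalities
    are an open condition on f, so they persist under perturbation. *)
Fixpoint alternates (f : R -> R) (s lo hi : R) (m : nat) : Prop :=
  match m with
  | O => exists p, lo < p < hi /\ 0 < s * f p
  | S m => exists p, lo < p < hi /\ 0 < s * f p /\ alternates f (- s) p hi m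
  end.

(** The lower end constrains only the first point, so it may be moved anywhere below it; this makes
    room for prepending points. *)
Lemma alternates_first (f : R -> R) (s lo hi : R) (m : nat) :
  alternates f s lo hi m ->
  exists p, lo < p < hi /\ 0 < s * f p /\ forall lo', lo' < p -> alternates f s lo' hi m.
Proof.
destruct m as [|m].
- intros [p [H1 H2]]. exists p. split; [easy|split; [easy|]].
  intros lo' H. exists p. split; [lra|easy].
- intros [p (H1 & H2 & H3)]. exists p. split; [easy|split; [easy|]].
  intros lo' H. exists p. split; [lra|easy].
Qed.

Lemma alternates_zeros (f : R -> R) (lo hi : R) (m : nat) :
  (forall u, lo < u < hi -> continuity_pt f u) ->
  forall s, alternates f s lo hi m ->
  exists l, length l = m /\ increasing_from lo l /\ forall u, In u l -> u < hi /\ f u = 0.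
Proof.
revert lo. induction m as [|m IH]; intros lo Hc s Ha.
- exists nil. now simpl.
- destruct Ha as [p (Hp & Sp & Ha)].
  destruct (alternates_first _ _ _ _ _ Ha) as [q (Hq & Sq & Ha')].
  destruct (IVT_interv (fun u => - (s * f u)) p q) as [z [Hz Fz]].
  + intros a Ha0. apply continuity_pt_opp, continuity_pt_scal, Hc. lra.
  + lra.
  + lra.
  + lra.
  + assert (s <> 0) by (intros ->; lra).
    assert (Fz' : f z = 0).
    { destruct (Rmult_integral s (f z)); [lra|easy|easy]. }
    (* The zero lies strictly below q, so the remaining alternation can be restarted from it. *)
    assert (z < q).
    { destruct (Rle_lt_or_eq_dec z q); [lra|easy|]. subst z. rewrite Fz' in Sq. lra. }
    destruct (IH z) with (s := - s) as [l (L & I & Z)].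
    * intros u Hu. apply Hc. lra.
    * now apply Ha'.
    * exists (z :: l). simpl. rewrite L. split; [easy|]. split.
      -- split; [lra|easy].
      -- intros u [<-|Hu]; [|now apply Z]. split; [lra|easy].
Qed.

Lemma alternates_locally {U : UniformSpace} (f : U -> R -> R) (t : U) (hi : R) (m : nat) :
  forall lo s,
  (forall u, lo < u < hi -> continuous (fun s => f s u) t) ->
  alternates (f t) s lo hi m -> locally t (fun t' => alternates (f t') s lo hi m).
Proof.
induction m as [|m IH]; intros lo s Hc Ha.
- destruct Ha as [p [Hp Sp]].
  assert (H : locally t (fun t' => 0 < s * f t' p)).
  { assert (Hs : continuous (fun t' => s * f t' p) t) by
      (apply continuous_Rmult; [apply continuous_const|now apply Hc]).
    apply Hs. now apply (open_gt 0). }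
  revert H. apply filter_imp. intros t' Ht'. now exists p.
- destruct Ha as [p (Hp & Sp & Ha)].
  assert (H : locally t (fun t' => 0 < s * f t' p)).
  { assert (Hs : continuous (fun t' => s * f t' p) t) by
      (apply continuous_Rmult; [apply continuous_const|now apply Hc]).
    apply Hs. now apply (open_gt 0). }
  assert (H' := IH p (- s) ltac:(intros; apply Hc; lra) Ha).
  generalize (filter_and _ _ H H'). apply filter_imp. intros t' [H1 H2]. now exists p.
Qed.

(** * Limit cycles near infinity *)

Lemma list_separation (u : R) (l : list R) :
  exists d, 0 < d /\ forall v, In v l -> Rabs (v - u) < d -> v = u.
Proof.
induction l as [|a l [d [Hd H]]].
- exists 1. split; [lra|easy].
- destruct (Req_dec a u) as [->|Ha].
  + exists d. split; [easy|]. intros v [<-|Hv]; auto.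
  + exists (Rmin d (Rabs (a - u))). split.
    * apply Rmin_glb_lt; [easy|]. apply Rabs_pos_lt. lra.
    * intros v [<-|Hv] Hlt.
      -- generalize (Rmin_r d (Rabs (a - u))). lra.
      -- apply H; [easy|]. generalize (Rmin_l d (Rabs (a - u))). lra.
Qed.

(** Isolation by counting: the k listed zeros exhaust the bound k, so every crossing orbit in (0, r)
    belongs to a finite list. *)
Lemma limit_cycle_of_zeros (K r : R) (p : params) (k : nat) (l : list R) :
  1 <= K -> params_in_box K p -> r <= half_domain K ->
  at_most_zeros k (gap_sum p) r -> NoDup l -> length l = k ->
  (forall u, In u l -> 0 < u < r /\ gap_sum p u = 0) ->
  forall u, In u l -> limit_cycle p u.
Proof.
intros HK Hp Hr Hk Hl Hlen Hz u Hu.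
destruct (Hz u Hu) as [Hur Fu]. split.
- apply (crossing_iff K); try easy. lra.
- destruct (list_separation u l) as [d [Hd Hsep]].
  exists (Rmin d (Rmin u (r - u))). split; [repeat apply Rmin_glb_lt; lra|].
  intros v Hv Hc.
  assert (V1 := Rmin_l d (Rmin u (r - u))). assert (V2 := Rmin_r d (Rmin u (r - u))).
  assert (V3 := Rmin_l u (r - u)). assert (V4 := Rmin_r u (r - u)).
  assert (Hv0 : 0 < v < r).
  { assert (Hv' : Rabs (v - u) < Rmin u (r - u)) by lra. apply Rabs_lt_between in Hv'. lra. }
  apply (crossing_iff K p v HK Hp) in Hc; [|lra].
  destruct (in_dec Req_EM_T v l) as [Hi|Hi]; [apply Hsep; [easy|lra]|].
  exfalso. assert (H : (length (v :: l) <= k)%nat); [|simpl in H; lia].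
  apply Hk; [now constructor|]. intros z [<-|Hz']; [now split|now apply Hz].
Qed.

Lemma family_box {U : UniformSpace} (fam : U -> params) (t : U) :
  continuous_params fam t ->
  exists K, 1 <= K /\ locally t (fun s => params_in_box K (fam s)).
Proof.
intros (H1 & H2 & H3 & H4 & H5).
destruct (params_box_exists (fam t)) as [K [HK (B1 & B2 & B3 & B4 & B5)]].
exists (K + 1). split; [lra|].
assert (Hf : forall f : U -> R, continuous f t -> Rabs (f t) <= K ->
  locally t (fun s => Rabs (f s) <= K + 1)).
{ intros f Hf Hb. apply filterlim_locally with (eps := mkposreal 1 Rlt_0_1) in Hf.
  revert Hf. apply filter_imp. intros s Hs.
  unfold ball in Hs; simpl in Hs. unfold AbsRing_ball, abs, minus, plus, opp in Hs; simpl in Hs.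
  replace (f s) with (f t + (f s + - f t)) by ring.
  eapply Rle_trans; [apply Rabs_triang|]. lra. }
generalize (filter_and _ _ (Hf _ H1 B1) (filter_and _ _ (Hf _ H2 B2) (filter_and _ _ (Hf _ H3 B3)
  (filter_and _ _ (Hf _ H4 B4) (Hf _ H5 B5))))).
apply filter_imp. unfold params_in_box. tauto.
Qed.

Lemma family_at_most_zeros {U : UniformSpace} (fam : U -> params) (t : U) (k : nat) :
  continuous_params fam t -> gap_series (fam t) k <> 0 ->
  exists K r, 1 <= K /\ 0 < r <= half_domain K /\ r <= half_radius K / 2 /\
    locally t (fun s => params_in_box K (fam s) /\ at_most_zeros k (gap_sum (fam s)) r).
Proof.
intros Hc Hk.
destruct (family_box fam t Hc) as [K [HK HB]].
assert (Hrho := half_radius_pos K HK).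
assert (Hk' : 0 < Rabs (gap_series (fam t) k) / 2).
{ assert (0 < Rabs (gap_series (fam t) k)) by now apply Rabs_pos_lt. lra. }
destruct (PSeries_at_most_zeros k (2 * (box_bound K + 1)) (half_radius K) _ (proj1 Hrho) Hk')
  as [r [Hr H]].
exists K, (Rmin r (Rmin (half_domain K) (half_radius K / 2))).
split; [easy|]. split; [split|split].
- repeat apply Rmin_glb_lt; [easy|now apply half_domain_pos|lra].
- eapply Rle_trans; [apply Rmin_r|apply Rmin_l].
- eapply Rle_trans; [apply Rmin_r|apply Rmin_r].
- assert (Hn := continuous_gap_series fam t k Hc).
  apply filterlim_locally with (eps := mkposreal _ Hk') in Hn.
  generalize (filter_and _ _ HB Hn). apply filter_imp. intros s [Hs1 Hs2].
  split; [easy|]. apply at_most_zeros_le with r; [apply Rmin_l|].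
  apply H; [now apply gap_series_bound|].
  unfold ball in Hs2; simpl in Hs2.
  unfold AbsRing_ball, abs, minus, plus, opp in Hs2; simpl in Hs2.
  assert (Rabs (gap_series (fam t) k) <= Rabs (gap_series (fam s) k) +
    Rabs (gap_series (fam s) k + - gap_series (fam t) k)); [|lra].
  rewrite <- (Rabs_Ropp (gap_series (fam s) k + _)).
  eapply Rle_trans; [|apply Rabs_triang]. right. f_equal. ring.
Qed.

Lemma gap_alternates_0 (K r s : R) (p : params) (j : nat) :
  1 <= K -> params_in_box K p -> 0 < r ->
  (forall i, (i < j)%nat -> gap_series p i = 0) -> 0 < s * gap_series p j ->
  alternates (gap_sum p) s 0 r 0.
Proof.
intros HK Hp Hr Hi Hj.
apply (PSeries_leading_sign (2 * (box_bound K + 1)) (half_radius K) s j (gap_series p)); auto.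
- now apply half_radius_pos.
- now apply gap_series_bound.
Qed.

(* One more sign change is created at 0 while the existing ones persist. *)
Lemma alternation_step (K r s : R) (fam : R -> params) (Q : R -> Prop) (j m : nat) :
  1 <= K -> 0 < r <= half_radius K / 2 -> continuous_params fam 0 ->
  locally 0 Q -> (forall t, Q t -> params_in_box K (fam t)) ->
  alternates (gap_sum (fam 0)) s 0 r m ->
  (forall t i, (i < j)%nat -> gap_series (fam t) i = 0) ->
  (forall d, 0 < d -> exists t, Rabs t < d /\ 0 < - s * gap_series (fam t) j) ->
  exists t, Q t /\ alternates (gap_sum (fam t)) (- s) 0 r (S m).
Proof.
intros HK Hr Hc HQ HB Ha Hi Hj.
assert (Hrho := half_radius_pos K HK).
destruct (alternates_first _ _ _ _ _ Ha) as [p (Hp & _ & Ha')].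
(* The old points are kept above p / 2, which leaves (0, p / 2) for the new one. *)
specialize (Ha' (p / 2) ltac:(lra)).
assert (HL : locally 0 (fun t => alternates (gap_sum (fam t)) s (p / 2) r m)).
{ apply (alternates_locally (fun t => gap_sum (fam t))); [|easy].
  intros u Hu. unfold gap_sum.
  apply (continuous_PSeries_param (2 * (box_bound K + 1)) (half_radius K) u
    (fun t => gap_series (fam t))).
  - easy.
  - rewrite Rabs_pos_eq; lra.
  - revert HQ. apply filter_imp. intros t Ht. apply gap_series_bound; auto.
  - intros n. now apply continuous_gap_series. }
destruct (filter_and _ _ HQ HL) as [d Hd].
destruct (Hj d (cond_pos d)) as [t [Ht Hs]].
destruct (Hd t) as [HQt Hat].
{ unfold ball; simpl. unfold AbsRing_ball, abs, minus, plus, opp; simpl.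
  now rewrite Ropp_0, Rplus_0_r. }
exists t. split; [easy|].
destruct (PSeries_leading_sign (2 * (box_bound K + 1)) (half_radius K) (- s) j
  (gap_series (fam t))) with (d := p / 2) as [q [Hq Sq]]; auto; try lra.
- apply gap_series_bound; auto.
- exists q. split; [lra|]. split; [exact Sq|]. rewrite Ropp_involutive.
  destruct (alternates_first _ _ _ _ _ Hat) as [p' (Hp' & _ & Hat')].
  apply Hat'. lra.
Qed.

(** The alternation is requested inside an arbitrary neighbourhood [N], so that [N] can be shrunk to
    where at most k zeros exist; the k zeros found are then all of them. *)
Lemma up_to_cycles_of_alternation {U : UniformSpace} (k : nat) (fam : U -> params) (t : U) :
  continuous_params fam t -> gap_series (fam t) k <> 0 ->
  (forall K r N, 1 <= K -> 0 < r <= half_radius K / 2 -> locally t N ->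
     (forall s, N s -> params_in_box K (fam s)) ->
     exists s sg, N s /\ alternates (gap_sum (fam s)) sg 0 r k) ->
  up_to_cycles_bifurcate k fam t.
Proof.
intros Hc Hk Halt.
destruct (family_at_most_zeros fam t k Hc Hk) as (K & r0 & HK & Hr0 & Hr0' & HL).
split.
- exists r0. split; [easy|]. revert HL. apply filter_imp. intros s [HB Hz] us [Hnd Hus].
  apply Hz; [easy|]. intros u Hu. destruct (Hus u Hu) as [H1 [H2 _]].
  split; [easy|]. apply (crossing_iff K); try easy. lra.
- intros r N Hr HN.
  assert (R1 := Rmin_l r r0). assert (R2 := Rmin_r r r0).
  assert (R3 : 0 < Rmin r r0) by (apply Rmin_glb_lt; lra).
  destruct (Halt K (Rmin r r0) _ HK ltac:(lra) (filter_and _ _ HN HL)) as (s & sg & [HNs [HB Hz]] & Ha).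
  { intros s [_ [HB _]]. exact HB. }
  destruct (alternates_zeros (gap_sum (fam s)) 0 (Rmin r r0) k) with (s := sg) as [l (L & I & Z)]; auto.
  { intros u Hu. apply PSeries_continuity. apply (gap_has_sum K); try easy.
    rewrite Rabs_pos_eq; lra. }
  exists s, l. split; [easy|]. split; [|easy].
  split; [now apply increasing_from_NoDup with 0|].
  intros u Hu. destruct (Z u Hu) as [Hur Fu]. assert (Hu0 := increasing_from_In 0 u l I Hu).
  split; [lra|].
  apply (limit_cycle_of_zeros K r0 (fam s) k l); try easy; try lra.
  + now apply increasing_from_NoDup with 0.
  + intros z Hz'. destruct (Z z Hz'). assert (Hz0 := increasing_from_In 0 z l I Hz').
    split; [lra|easy].
Qed.

(** * Stability *)

(** F v = G w defines the successor w of v implicitly. For v below u0, G u0 = F u0 < F v < G v, so a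
    solution lies in [v, u0]; the resulting increasing sequence converges to a point where F = G,
    which must be u0. *)
Lemma one_sided_attraction (F G : R -> R) (a u0 u : R) :
  a < u <= u0 ->
  (forall v, a < v <= u0 -> continuity_pt F v /\ continuity_pt G v) ->
  (forall v w, a < v -> v < w -> w <= u0 -> F w < F v) ->
  (forall v, a < v < u0 -> F v < G v) -> F u0 = G u0 ->
  exists s : nat -> R, s 0%nat = u /\
    (forall n, u <= s n <= u0 /\ F (s n) = G (s (S n))) /\ is_lim_seq s u0.
Proof.
intros Hu Hc Hdec Hlt Heq.
(* [choice] needs a successor for every real v, so outside (a, u0] the witness is v itself and the
   premise is false. *)
assert (Hnext : forall v, exists w, a < v <= u0 -> v <= w <= u0 /\ F v = G w).
{ intros v. destruct (Rlt_dec a v) as [H1|]; [|exists v; lra].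
  destruct (Rlt_dec v u0) as [H2|H2].
  - assert (F u0 < F v) by (apply Hdec; lra).
    assert (F v < G v) by (apply Hlt; lra).
    destruct (IVT_interv (fun w => F v - G w) v u0) as [w [Hw Ew]].
    + intros w Hw. apply continuity_pt_minus; [apply continuity_pt_const; now intros ? ?|].
      apply Hc. lra.
    + easy.
    + lra.
    + lra.
    + exists w. intros _. split; [easy|lra].
  - exists v. intros H. assert (v = u0) by lra. subst v. split; [lra|easy]. }
apply choice in Hnext. destruct Hnext as [next Hnext].
set (s := fun n => Nat.iter n next u).
assert (Hs : forall n, u <= s n <= u0).
{ induction n as [|n IH]; [unfold s; simpl; lra|].
  change (s (S n)) with (next (s n)).
  destruct (Hnext (s n)) as [H _]; lra. }
assert (HS : forall n, s n <= s (S n) /\ F (s n) = G (s (S n))).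
{ intros n. specialize (Hs n). change (s (S n)) with (next (s n)).
  destruct (Hnext (s n)) as [H1 H2]; [lra|]. split; [lra|easy]. }
exists s. split; [reflexivity|]. split; [intros n; split; [apply Hs|apply HS]|].
destruct (ex_finite_lim_seq_incr s u0) as [l Hl]; [intros; apply HS|intros; apply Hs|].
assert (Hlb : u <= l <= u0).
{ split.
  - apply (is_lim_seq_le (fun _ => u) s u l); [intros; apply Hs|apply is_lim_seq_const|easy].
  - apply (is_lim_seq_le s (fun _ => u0) l u0); [intros; apply Hs|easy|apply is_lim_seq_const]. }
destruct (Hc l ltac:(lra)) as [CF CG].
assert (LF := is_lim_seq_continuous F s l CF Hl).
assert (LG := is_lim_seq_continuous G (fun n => s (S n)) l CG (proj1 (is_lim_seq_incr_1 s l) Hl)).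
assert (E : Finite (F l) = Finite (G l)).
{ rewrite <- (is_lim_seq_unique _ _ LF), <- (is_lim_seq_unique _ _ LG).
  apply Lim_seq_ext. intros n. apply HS. }
injection E as E.
destruct (Rle_lt_or_eq_dec l u0) as [H| ->]; [lra| |easy].
specialize (Hlt l ltac:(lra)). lra.
Qed.

Lemma asymptotically_stable_of_maps (Rel : R -> R -> Prop) (F G : R -> R) (r u0 : R) :
  0 < u0 < r ->
  (forall v, 0 < v < r -> continuity_pt F v /\ continuity_pt G v) ->
  (forall v w, 0 < v -> v < w -> w < r -> F w < F v) ->
  (forall v, 0 < v < u0 -> F v < G v) -> F u0 = G u0 ->
  (forall v, u0 < v < r -> G v < F v) ->
  (forall v w, 0 < v < r -> 0 < w < r -> F v = G w -> Rel v w) ->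
  asymptotically_stable Rel u0.
Proof.
intros Hu Hc Hdec Hlt Heq Hgt HRel eps He.
exists (Rmin eps (Rmin u0 (r - u0))). split; [repeat apply Rmin_glb_lt; lra|].
intros u Hd.
assert (V1 := Rmin_l eps (Rmin u0 (r - u0))). assert (V2 := Rmin_r eps (Rmin u0 (r - u0))).
assert (V3 := Rmin_l u0 (r - u0)). assert (V4 := Rmin_r u0 (r - u0)).
apply Rabs_lt_between in Hd.
destruct (Rle_lt_dec u u0) as [Hle|Hlt'].
- destruct (one_sided_attraction F G 0 u0 u) as [s (S0 & Ss & Sl)]; auto; try lra.
  + intros v Hv. apply Hc. lra.
  + intros v w H1 H2 H3. apply Hdec; lra.
  + exists s. split; [easy|]. split; [|easy]. intros n.
    destruct (Ss n) as [B1 E1]. destruct (Ss (S n)) as [B2 _]. split.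
    * apply HRel; [lra|lra|easy].
    * apply Rabs_lt_between. lra.
(* Starting points above u0 are handled by the reflection v -> - v, which keeps the maps
   decreasing. *)
- destruct (one_sided_attraction (fun v => - F (- v)) (fun v => - G (- v)) (- r) (- u0) (- u))
    as [s (S0 & Ss & Sl)].
  + lra.
  + intros v Hv. destruct (Hc (- v) ltac:(lra)) as [CF CG].
    split; apply continuity_pt_opp;
    apply (continuity_pt_comp (fun v => - v)); try assumption;
    apply continuity_pt_opp, continuity_pt_id.
  + intros v w H1 H2 H3. specialize (Hdec (- w) (- v) ltac:(lra) ltac:(lra) ltac:(lra)). lra.
  + intros v Hv. specialize (Hgt (- v) ltac:(lra)). lra.
  + now rewrite Ropp_involutive, Heq.
  + exists (fun n => - s n). split; [lra|]. split.
    * intros n. destruct (Ss n) as [B1 E1]. destruct (Ss (S n)) as [B2 _]. split.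
      -- apply HRel; lra.
      -- apply Rabs_lt_between. lra.
    * rewrite <- (Ropp_involutive u0). now apply (is_lim_seq_opp s (- u0)).
Qed.

(** The derivative is w + u w', where w <= - c / 2 <= - 1 / (2 H), while u w' <= 1 / (4 H) on the
    domain. *)
Lemma half_map_derive (K g b x u : R) :
  1 <= K -> in_box K g b x -> 0 < u < half_domain K ->
  exists d, is_derive (half_map g b x) u d /\ d < 0.
Proof.
intros HK Hbox Hu.
assert (Hu' : Rabs u < half_domain K) by (rewrite Rabs_pos_eq; lra).
destruct (half_domain_facts K g b x u HK Hbox Hu') as (_ & A1 & A2 & _).
destruct (box_bounds K g b x HK Hbox) as (H1 & _ & [H3 _] & _).
assert (Hr := half_radius_pos K HK).
assert (HB := half_series_bound K g b x HK Hbox).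
assert (HB' := geometric_bound_derive _ _ _ (proj1 Hr) HB).
set (H := box_bound K) in *. set (rho := half_radius K) in *.
set (w := half_series g b x) in *. set (c := exp (- (PI * g))) in *.
assert (HD : half_domain K * (32 * (H + 1) ^ 2) = rho).
{ unfold half_domain. fold H rho. field. simpl; nra. }
assert (Hu2 : u * (32 * (H + 1) ^ 2) < rho).
{ rewrite <- HD. apply Rmult_lt_compat_r; [simpl; nra|easy]. }
assert (HH2 : 4 <= (H + 1) ^ 2) by (simpl; nra).
exists (PSeries w u + u * PSeries (PS_derive w) u). split.
- unfold half_map. fold w. eapply is_derive_eq.
  + apply (is_derive_mult (fun t => t) (PSeries w)).
    * apply (is_derive_id (K := R_AbsRing)).
    * apply is_derive_PSeries. exact A1.
    * apply Rmult_comm.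
  + unfold plus, mult, one; simpl. ring.
- assert (Hu4 : u * 128 <= u * (32 * (H + 1) ^ 2)) by (apply Rmult_le_compat_l; lra).
  assert (B := PSeries_bound _ (rho / 2) u _ ltac:(lra) HB' ltac:(rewrite Rabs_pos_eq; lra)).
  apply Rabs_le_between in A2.
  assert (B2 : u * PSeries (PS_derive w) u <= / H / 4).
  { apply Rle_trans with (u * (2 * ((H + 1) / rho))).
    - apply Rmult_le_compat_l; [lra|]. eapply Rle_trans; [apply Rle_abs|easy].
    - apply Rmult_le_reg_r with (rho * (4 * H)); [nra|].
      replace (u * (2 * ((H + 1) / rho)) * (rho * (4 * H))) with (u * (8 * ((H + 1) * H)))
        by (field; lra).
      replace (/ H / 4 * (rho * (4 * H))) with rho by (field; lra).
      assert (u * (8 * ((H + 1) * H)) <= u * (32 * (H + 1) ^ 2)); [|lra].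
      apply Rmult_le_compat_l; [lra|]. simpl. nra. }
  assert (0 < / H) by (apply Rinv_0_lt_compat; lra). lra.
Qed.

Lemma half_map_continuous (K g b x u : R) :
  1 <= K -> in_box K g b x -> 0 < u < half_domain K -> continuity_pt (half_map g b x) u.
Proof.
intros HK Hbox Hu. destruct (half_map_derive K g b x u HK Hbox Hu) as [d [Hd _]].
apply derivable_continuous_pt. exists d. now apply is_derive_Reals.
Qed.

Lemma half_map_decreasing (K g b x u v : R) :
  1 <= K -> in_box K g b x -> 0 < u -> u < v -> v < half_domain K ->
  half_map g b x v < half_map g b x u.
Proof.
intros HK Hbox Hu Huv Hv.
destruct (MVT_cor2 (half_map g b x) (Derive (half_map g b x)) u v Huv) as [c [Ec Hc]].
- intros c Hc. apply is_derive_Reals, Derive_correct.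
  destruct (half_map_derive K g b x c HK Hbox ltac:(lra)) as [d [Hd _]]. now exists d.
- destruct (half_map_derive K g b x c HK Hbox ltac:(lra)) as [d [Hd Hneg]].
  rewrite (is_derive_unique _ _ _ Hd) in Ec. nra.
Qed.

Lemma return_map_of_maps (K : R) (p : params) (u v : R) :
  1 <= K -> params_in_box K p -> 0 < u < half_domain K -> 0 < v < half_domain K ->
  left_map p u = right_map p v -> return_map p u v.
Proof.
intros HK Hp Hu Hv E. split; [easy|]. split; [easy|]. exists (/ left_map p u).
split; [now apply (left_half_return_iff K)|]. rewrite E. now apply (right_half_return_iff K).
Qed.

(** The left arc comes first in forward time: v is sent to the w with
    [left_map p v = right_map p w]. A gap that is negative below the zero and positive above it
    places w between v and the cycle. *)
Lemma stable_cycle_criterion (K r u : R) (p : params) :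
  1 <= K -> params_in_box K p -> r <= half_domain K -> 0 < u < r -> gap_sum p u = 0 ->
  (forall v, 0 < v < u -> gap_sum p v < 0) -> (forall v, u < v < r -> 0 < gap_sum p v) ->
  stable_cycle p u.
Proof.
intros HK Hp Hr Hu H0 Hneg Hpos. destruct (params_in_box_halves K p Hp) as [HL HR].
assert (E : forall v, 0 < v < r -> v * gap_sum p v = left_map p v - right_map p v).
{ intros v Hv. apply (gap_maps K); try easy. lra. }
apply (asymptotically_stable_of_maps _ (left_map p) (right_map p) r); auto.
- intros v Hv. split; [apply (half_map_continuous K _ _ _ v HK HL)|apply (half_map_continuous K _ _ _ v HK HR)]; lra.
- intros v w H1 H2 H3. apply (half_map_decreasing K _ _ _ v w HK HL); lra.
- intros v Hv. specialize (E v ltac:(lra)). specialize (Hneg v Hv). nra.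
- specialize (E u Hu). rewrite H0 in E. lra.
- intros v Hv. specialize (E v ltac:(lra)). specialize (Hpos v Hv). nra.
- intros v w Hv Hw. apply (return_map_of_maps K); try easy; lra.
Qed.

(** Reversing time exchanges the roles of the two half maps. *)
Lemma unstable_cycle_criterion (K r u : R) (p : params) :
  1 <= K -> params_in_box K p -> r <= half_domain K -> 0 < u < r -> gap_sum p u = 0 ->
  (forall v, 0 < v < u -> 0 < gap_sum p v) -> (forall v, u < v < r -> gap_sum p v < 0) ->
  unstable_cycle p u.
Proof.
intros HK Hp Hr Hu H0 Hpos Hneg. destruct (params_in_box_halves K p Hp) as [HL HR].
assert (E : forall v, 0 < v < r -> v * gap_sum p v = left_map p v - right_map p v).
{ intros v Hv. apply (gap_maps K); try easy. lra. }
apply (asymptotically_stable_of_maps _ (right_map p) (left_map p) r); auto.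
- intros v Hv. split; [apply (half_map_continuous K _ _ _ v HK HR)|apply (half_map_continuous K _ _ _ v HK HL)]; lra.
- intros v w H1 H2 H3. apply (half_map_decreasing K _ _ _ v w HK HR); lra.
- intros v Hv. specialize (E v ltac:(lra)). specialize (Hpos v Hv). nra.
- specialize (E u Hu). rewrite H0 in E. lra.
- intros v Hv. specialize (E v ltac:(lra)). specialize (Hneg v Hv). nra.
- intros v w Hv Hw Heq. apply (return_map_of_maps K); try easy; lra.
Qed.

(** * The simple bifurcation *)

Lemma locally_Rabs (x : R) (P : R -> Prop) :
  locally x P -> exists eps, 0 < eps /\ forall y, Rabs (y - x) < eps -> P y.
Proof.
intros [eps H]. exists eps. split; [apply cond_pos|]. intros y Hy. now apply H.
Qed.

Lemma continuous_Rabs_lt {U : UniformSpace} (f : U -> R) (t : U) (eps : R) :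
  continuous f t -> 0 < eps -> locally t (fun s => Rabs (f s - f t) < eps).
Proof.
intros Hf He. exact (proj1 (filterlim_locally f (f t)) Hf (mkposreal eps He)).
Qed.

Lemma gap_sum_derive (K : R) (p : params) (u : R) :
  1 <= K -> params_in_box K p -> Rabs u < half_domain K ->
  is_derive (gap_sum p) u (PSeries (PS_derive (gap_series p)) u).
Proof. intros HK Hp Hu. apply is_derive_PSeries. now apply (gap_has_sum K). Qed.

(** The sign s makes s gap increasing near 0, with slope at least A / 2; so a zero exists exactly
    when s gap is negative at 0, and it is simple. The values s = 1 and s = -1 serve the two
    stability types. *)
Lemma one_cycle_criterion (gL b xL xR s : R) (side : R -> Prop) (st : params -> R -> Prop) :
  let fam := fun gR => Params gL gR b xL xR in
  s <> 0 ->
  0 < s * gap_series (fam (- gL)) 1%nat ->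
  (forall m, side m <-> s * gap_series (fam m) 0%nat < 0) ->
  (forall K r u p, 1 <= K -> params_in_box K p -> r <= half_domain K -> 0 < u < r ->
     gap_sum p u = 0 -> (forall v, 0 < v < u -> s * gap_sum p v < 0) ->
     (forall v, u < v < r -> 0 < s * gap_sum p v) -> st p u) ->
  one_cycle_bifurcates_from_infinity fam (- gL) side st.
Proof.
intros fam Hs HA Hside Hst.
set (m0 := - gL). fold m0 in HA.
assert (Hc : continuous_params fam m0).
{ unfold continuous_params, fam; simpl.
  repeat split; try apply continuous_const. apply continuous_id. }
destruct (family_box fam m0 Hc) as [K [HK HB]].
assert (Hrho := half_radius_pos K HK). assert (HD := half_domain_pos K HK).
set (rho := half_radius K) in *. set (C := 2 * (box_bound K + 1)).
set (A := s * gap_series (fam m0) 1%nat) in *.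
(* A bound for the variation of the slope of s gap: on [0, r] it changes by at most M r <= A / 4,
   and another A / 4 is allowed for moving the parameter. *)
set (M := Rmax 1 (Rabs s * (2 * (C / rho) / (rho / 2)))).
assert (HM : 1 <= M) by apply Rmax_l.
assert (HM' : Rabs s * (2 * (C / rho) / (rho / 2)) <= M) by apply Rmax_r.
set (r := Rmin (half_domain K / 2) (Rmin (rho / 4) (A / (4 * M)))).
assert (R0 : 0 < r).
{ repeat apply Rmin_glb_lt; try lra. apply Rdiv_lt_0_compat; lra. }
assert (R1 : r <= half_domain K / 2) by apply Rmin_l.
assert (R2 : r <= rho / 4) by (eapply Rle_trans; [apply Rmin_r|apply Rmin_l]).
assert (R3 : r <= A / (4 * M)) by (eapply Rle_trans; [apply Rmin_r|apply Rmin_r]).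
assert (R3' : M * r <= A / 4).
{ apply Rle_trans with (M * (A / (4 * M))); [apply Rmult_le_compat_l; lra|].
  right. field. lra. }
assert (Z0 : gap_series (fam m0) 0%nat = 0).
{ rewrite gap_series_0. simpl. unfold m0. rewrite Ropp_mult_distr_r. ring. }
assert (C1 : continuous (fun m => s * gap_series (fam m) 1%nat) m0).
{ apply continuous_Rmult; [apply continuous_const|now apply continuous_gap_series]. }
assert (C0 : continuous (fun m => s * gap_series (fam m) 0%nat) m0).
{ apply continuous_Rmult; [apply continuous_const|now apply continuous_gap_series]. }
assert (L1 := continuous_Rabs_lt _ _ (A / 4) C1 ltac:(lra)).
(* A / 4 * r equals A / 2 * (r / 2), so s gap is positive at r / 2. *)
assert (L0 := continuous_Rabs_lt _ _ (A / 4 * r) C0 ltac:(nra)).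
destruct (locally_Rabs _ _ (filter_and _ _ HB (filter_and _ _ L0 L1))) as [eps [He Hgood]].
assert (Hder : forall m, Rabs (m - m0) < eps -> forall c, 0 <= c <= r ->
  A / 2 <= s * PSeries (PS_derive (gap_series (fam m))) c).
{ intros m Hm c Hcc. destruct (Hgood m Hm) as (HBm & _ & L1m).
  assert (GB := gap_series_bound K (fam m) HK HBm). fold rho C in GB.
  assert (GB' := geometric_bound_derive _ _ _ (proj1 Hrho) GB).
  assert (B := PSeries_near_0 (C / rho) (rho / 2) c _ ltac:(lra) GB' ltac:(rewrite Rabs_pos_eq; lra)).
  rewrite (Rabs_pos_eq c) in B by lra.
  replace (PS_derive (gap_series (fam m)) 0%nat) with (gap_series (fam m) 1%nat) in B
    by (unfold PS_derive; simpl; ring).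
  assert (B' : Rabs (s * (PSeries (PS_derive (gap_series (fam m))) c - gap_series (fam m) 1%nat))
     <= A / 4).
  { rewrite Rabs_mult. apply Rle_trans with (Rabs s * (2 * (C / rho) / (rho / 2) * c)).
    - apply Rmult_le_compat_l; [apply Rabs_pos|easy].
    - rewrite <- Rmult_assoc. apply Rle_trans with (M * c); [apply Rmult_le_compat_r; lra|].
      apply Rle_trans with (M * r); [apply Rmult_le_compat_l; lra|easy]. }
  apply Rabs_le_between in B'. apply Rabs_lt_between in L1m. fold A in L1m. lra. }
assert (Hinc : forall m, Rabs (m - m0) < eps -> forall x y, 0 <= x -> x < y -> y <= r ->
  s * gap_sum (fam m) x + A / 2 * (y - x) <= s * gap_sum (fam m) y).
{ intros m Hm x y Hx Hxy Hy. destruct (Hgood m Hm) as (HBm & _ & _).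
  destruct (MVT_cor2 (fun z => s * gap_sum (fam m) z)
    (fun z => s * PSeries (PS_derive (gap_series (fam m))) z) x y Hxy) as [c [Ec Hcc]].
  { intros c Hcc. apply is_derive_Reals. apply is_derive_scal.
    apply (gap_sum_derive K); try easy. rewrite Rabs_pos_eq; lra. }
  assert (A / 2 * (y - x) <= s * PSeries (PS_derive (gap_series (fam m))) c * (y - x));
    [|lra].
  apply Rmult_le_compat_r; [lra|]. apply Hder; [easy|lra]. }
assert (Hg0 : forall m, gap_sum (fam m) 0 = gap_series (fam m) 0%nat) by
  (intros; apply PSeries_0).
assert (Hex : forall m, Rabs (m - m0) < eps -> side m -> exists z, 0 < z < r /\ gap_sum (fam m) z = 0).
{ intros m Hm Hsm. apply Hside in Hsm.
  destruct (Hgood m Hm) as (HBm & L0m & _). rewrite Z0, Rmult_0_r in L0m.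
  apply Rabs_lt_between in L0m.
  assert (I := Hinc m Hm 0 (r / 2) ltac:(lra) ltac:(lra) ltac:(lra)). rewrite Hg0 in I.
  destruct (IVT_interv (fun z => s * gap_sum (fam m) z) 0 (r / 2)) as [z [Hz Fz]].
  - intros a Ha. apply continuity_pt_scal, PSeries_continuity.
    apply (gap_has_sum K); try easy. rewrite Rabs_pos_eq; lra.
  - lra.
  - now rewrite Hg0.
  - lra.
  - exists z. assert (F : gap_sum (fam m) z = 0) by (destruct (Rmult_integral _ _ Fz); easy).
    split; [|easy]. split; [|lra].
    destruct (proj1 Hz) as [|<-]; [easy|]. rewrite Hg0 in F. rewrite F in Hsm. lra. }
set (u := fun m => epsilon (inhabits 0) (fun z => 0 < z < r /\ gap_sum (fam m) z = 0)).
assert (Hu : forall m, Rabs (m - m0) < eps -> side m -> 0 < u m < r /\ gap_sum (fam m) (u m) = 0).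
{ intros m Hm Hsm. apply (epsilon_spec (inhabits 0) _ (Hex m Hm Hsm)). }
exists eps, r, u. split; [easy|]. split; [easy|]. split; [|split].
- intros m Hm Hsm. destruct (Hu m Hm Hsm) as [Hur Fu]. destruct (Hgood m Hm) as (HBm & _ & _).
  assert (Hinc' := Hinc m Hm).
  assert (Hlow : forall v, 0 < v < u m -> s * gap_sum (fam m) v < 0).
  { intros v Hv. assert (I := Hinc' v (u m) ltac:(lra) ltac:(lra) ltac:(lra)).
    rewrite Fu in I. nra. }
  assert (Hhigh : forall v, u m < v < r -> 0 < s * gap_sum (fam m) v).
  { intros v Hv. assert (I := Hinc' (u m) v ltac:(lra) ltac:(lra) ltac:(lra)).
    rewrite Fu in I. nra. }
  assert (Huniq : forall v, 0 < v < r -> gap_sum (fam m) v = 0 -> v = u m).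
  { intros v Hv Fv. destruct (Rtotal_order v (u m)) as [H|[H|H]]; [|easy|].
    - specialize (Hlow v ltac:(lra)). rewrite Fv in Hlow. lra.
    - specialize (Hhigh v ltac:(lra)). rewrite Fv in Hhigh. lra. }
  split; [easy|]. split; [|split; [|split]].
  + apply (limit_cycle_of_zeros K r (fam m) 1 (u m :: nil)); try easy; try lra.
    * intros l Hl Hz. destruct l as [|x [|y l]]; [simpl; lia|simpl; lia|exfalso].
      inversion Hl as [|? ? Hn _]. apply Hn. left.
      destruct (Hz x ltac:(now left)). destruct (Hz y ltac:(right; now left)).
      now rewrite (Huniq x), (Huniq y).
    * constructor; [easy|constructor].
    * intros z [<-|[]]. easy.
    * now left.
  (* Since Delta = u gap, the derivative of Delta at a zero of the gap is u times that of the
     gap. *)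
  + exists (u m * PSeries (PS_derive (gap_series (fam m))) (u m)). split.
    * apply (is_derive_ext_loc (fun v => v * gap_sum (fam m) v)).
      -- apply (filter_imp (fun v => 0 < v < half_domain K)).
         ++ intros v Hv. symmetry. now apply (Delta_gap K).
         ++ apply (open_and _ _ (open_gt 0) (open_lt (half_domain K))). lra.
      -- eapply is_derive_eq.
         ++ apply (is_derive_mult (fun t => t) (gap_sum (fam m))).
            ** apply (is_derive_id (K := R_AbsRing)).
            ** apply (gap_sum_derive K); try easy. rewrite Rabs_pos_eq; lra.
            ** apply Rmult_comm.
         ++ unfold plus, mult, one; simpl. rewrite Fu. ring.
    * intros H0. destruct (Rmult_integral _ _ H0) as [H1|H1]; [lra|].
      assert (D := Hder m Hm (u m) ltac:(lra)). rewrite H1 in D. lra.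
  + apply (Hst K r); try easy. lra.
  + intros v Hv [Hcv _]. apply Huniq; [easy|]. apply (crossing_iff K); try easy. lra.
(* The slope bound gives A / 2 * [u m] <= - s gap(0), which tends to 0. *)
- intros P [eps' HP]. unfold filtermap, within.
  assert (L := continuous_Rabs_lt _ _ (A / 2 * eps') C0
    ltac:(generalize (cond_pos eps'); nra)).
  assert (Heps : locally m0 (fun m => Rabs (m - m0) < eps)).
  { exists (mkposreal eps He). intros m Hm. exact Hm. }
  generalize (filter_and _ _ L Heps). apply filter_imp. intros m [Lm Hm] Hsm.
  destruct (Hu m Hm Hsm) as [Hur Fu]. apply HP.
  unfold ball; simpl. unfold AbsRing_ball, abs, minus, plus, opp; simpl.
  rewrite Ropp_0, Rplus_0_r, Rabs_pos_eq by lra.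
  assert (I := Hinc m Hm 0 (u m) ltac:(lra) ltac:(lra) ltac:(lra)).
  rewrite Fu, Hg0 in I. rewrite Z0, Rmult_0_r in Lm. apply Rabs_lt_between in Lm. nra.
- intros m Hm Hsm v Hv [Hcv _]. destruct (Hgood m Hm) as (HBm & _ & _).
  apply (crossing_iff K) in Hcv; try easy; [|lra].
  assert (I := Hinc m Hm 0 v ltac:(lra) ltac:(lra) ltac:(lra)).
  rewrite Hcv, Hg0 in I.
  assert (~ s * gap_series (fam m) 0%nat < 0) by (intros H; apply Hsm; now apply Hside).
  nra.
Qed.

(** * Unfoldings *)

Definition line {U : NormedModule R_AbsRing} (x v : U) (t : R) : U := plus x (scal t v).

Lemma line_0 {U : NormedModule R_AbsRing} (x v : U) : line x v 0 = x.
Proof. unfold line. change (scal 0 v) with (scal zero v).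
rewrite (scal_zero_l v). apply plus_zero_r. Qed.

Lemma filterdiff_line {U : NormedModule R_AbsRing} (x v : U) (t : R) :
  filterdiff (line x v) (locally t) (fun h : R => scal h v).
Proof.
unfold line.
eapply filterdiff_ext_lin.
- apply filterdiff_plus_fct.
  + apply filterdiff_const.
  + apply filterdiff_linear. apply (is_linear_scal_l v).
- intros h. simpl. apply plus_zero_l.
Qed.

Lemma continuous_line {U : NormedModule R_AbsRing} (x v : U) (t : R) :
  continuous (line x v) t.
Proof.
apply (filterdiff_continuous (K := R_AbsRing) (U := R_NormedModule)).
eexists. apply filterdiff_line.
Qed.

(** Chain rule and uniqueness of derivatives: the differential is read off along lines, where the
    coefficients have explicit formulas. *)
Lemma filterdiff_line_derive {U : NormedModule R_AbsRing} (f l : U -> R) (x v : U) (d : R) :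
  filterdiff f (locally x) l -> is_derive (fun t => f (line x v t)) 0 d -> l v = d.
Proof.
intros Hf Hd.
assert (H : is_derive (fun t => f (line x v t)) 0 (l v)).
{ assert (Hf' : filterdiff f (locally (line x v 0)) l) by (rewrite line_0; exact Hf).
  assert (H := filterdiff_comp' (U := R_NormedModule) (W := R_NormedModule)
    (line x v) f 0 _ l (filterdiff_line x v 0) Hf').
  eapply filterdiff_ext_lin; [exact H|].
  intros h. simpl. apply (linear_scal l (proj1 Hf) h v). }
rewrite <- (is_derive_unique _ _ _ H). apply (is_derive_unique _ _ _ Hd).
Qed.

(* Along the line in direction [V j] the first j coefficients stay 0 and the next
   one has nonzero derivative, so the differential is triangular. *)
Lemma codimension_of_triangular {U : NormedModule R_AbsRing} (k : nat) (fam : U -> params)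
    (mu : U) (V : nat -> U) :
  (forall i, (i < k)%nat -> gap_series (fam mu) i = 0) -> gap_series (fam mu) k <> 0 ->
  (forall i, (i < k)%nat -> ex_filterdiff (fun nu => gap_series (fam nu) i) (locally mu)) ->
  (forall j i t, (i < j < k)%nat -> gap_series (fam (line mu (V j) t)) i = 0) ->
  (forall j, (j < k)%nat -> exists d, d <> 0 /\
     is_derive (fun t => gap_series (fam (line mu (V j) t)) j) 0 d) ->
  codimension_bifurcation_point k fam mu.
Proof.
intros Hz Hk Hd Hflat Hder.
exists (fun nu => shift (gap_series (fam nu))).
split; [intros; apply displacement_series_gap|].
split; [|split; [exact Hk|]].
{ intros [|i] Hi; [lia|]. apply Hz. lia. }
assert (Hl : forall i, exists l : U -> R, (i < k)%nat ->
  filterdiff (fun nu => gap_series (fam nu) i) (locally mu) l).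
{ intros i. destruct (Nat.lt_decidable i k) as [H|H].
  - destruct (Hd i H) as [l Hl]. now exists l.
  - exists (fun _ => 0). intros; lia. }
apply choice in Hl. destruct Hl as [l Hl].
(* Delta_i is coefficient i - 1 of the gap. *)
exists (fun i => l (pred i)). split.
{ intros [|i] Hi; [lia|]. apply Hl. lia. }
intros c.
(* Forward substitution: once the first n equations hold, the next is corrected along [V n], on
   which the earlier functionals vanish. *)
assert (Hsol : forall n, (n <= k)%nat -> exists v, forall i, (i < n)%nat -> l i v = c (S i)).
{ induction n as [|n IH]; intros Hn; [exists zero; intros; lia|].
  destruct IH as [v Hv]; [lia|].
  destruct (Hder n ltac:(lia)) as [d [Hd0 Hdn]].
  assert (Ln := filterdiff_line_derive _ _ _ _ _ (Hl n ltac:(lia)) Hdn).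
  exists (plus v (scal ((c (S n) - l n v) / d) (V n))).
  assert (Lin : forall i, (i < k)%nat -> l i (plus v (scal ((c (S n) - l n v) / d) (V n))) =
     l i v + (c (S n) - l n v) / d * l i (V n)).
  { intros i Hi. assert (HL := proj1 (Hl i Hi)).
    rewrite (linear_plus (l i) HL), (linear_scal (l i) HL). reflexivity. }
  intros i Hi. rewrite Lin by lia.
  destruct (Nat.eq_dec i n) as [->|Hne].
  - rewrite Ln. field. easy.
  - rewrite Hv by lia.
    assert (L0 : l i (V n) = 0).
    { apply (filterdiff_line_derive _ _ mu (V n) 0 (Hl i ltac:(lia))).
      apply (is_derive_ext (fun _ => 0)).
      - intros t. symmetry. apply Hflat. lia.
      - apply (is_derive_const (V := R_NormedModule) 0). }
    rewrite L0. ring. }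
destruct (Hsol k (Nat.le_refl k)) as [v Hv]. exists v.
intros [|i] Hi; [lia|]. apply Hv. lia.
Qed.

(** The conclusion provides a whole neighbourhood inside [N] at the new point, so that the next
    perturbation can start there. *)
Lemma alternation_line {U : NormedModule R_AbsRing} (K r s : R) (fam : U -> params) (mu v : U)
    (N : U -> Prop) (j m : nat) :
  1 <= K -> 0 < r <= half_radius K / 2 -> continuous_params fam mu ->
  locally mu N -> (forall nu, N nu -> params_in_box K (fam nu)) ->
  alternates (gap_sum (fam mu)) s 0 r m ->
  (forall t i, (i < j)%nat -> gap_series (fam (line mu v t)) i = 0) ->
  (forall d, 0 < d -> exists t, Rabs t < d /\ 0 < - s * gap_series (fam (line mu v t)) j) ->
  exists t, locally (line mu v t) N /\ alternates (gap_sum (fam (line mu v t))) (- s) 0 r (S m).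
Proof.
intros HK Hr Hc HN HB Ha Hi Hj.
assert (Hcl := continuous_line mu v 0).
assert (HN' : locally (line mu v 0) (fun nu => locally nu N)).
{ rewrite line_0. now apply locally_locally. }
destruct (alternation_step K r s (fun t => fam (line mu v t))
  (fun t => locally (line mu v t) N) j m) as [t [Ht Ha']]; auto.
- destruct Hc as (H1 & H2 & H3 & H4 & H5).
  assert (Hcc : forall f : U -> R, continuous f mu -> continuous (fun t => f (line mu v t)) 0).
  { intros f Hf. apply (continuous_comp (line mu v) f); [easy|]. now rewrite line_0. }
  split; [exact (Hcc _ H1)|split; [exact (Hcc _ H2)|split; [exact (Hcc _ H3)|]]].
  split; [exact (Hcc _ H4)|exact (Hcc _ H5)].
- exact (Hcl _ HN').
- intros t Ht. apply HB. now apply locally_singleton.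
- now rewrite line_0.
- now exists t.
Qed.

Lemma quadratic_sign (A B d : R) :
  A <> 0 -> 0 < d -> exists t, Rabs t < d /\ 0 < A * t + B * t ^ 2.
Proof.
intros HA Hd.
assert (HA' := Rabs_pos_lt _ HA). assert (HB := Rabs_pos B).
set (q := Rmin (d / (2 * Rabs A)) (/ (2 * (Rabs B + 1)))).
assert (Q0 : 0 < q).
{ apply Rmin_glb_lt; [apply Rdiv_lt_0_compat; lra|apply Rinv_0_lt_compat; lra]. }
assert (Q1 : q <= d / (2 * Rabs A)) by apply Rmin_l.
assert (Q2 : q <= / (2 * (Rabs B + 1))) by apply Rmin_r.
(* With t = A q the linear term is A^2 q > 0 whatever the sign of A, and the second bound on q keeps
   |B q| <= 1/2. *)
exists (A * q). split.
- rewrite Rabs_mult, (Rabs_pos_eq q) by lra.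
  apply Rle_lt_trans with (Rabs A * (d / (2 * Rabs A))).
  + apply Rmult_le_compat_l; lra.
  + replace (Rabs A * (d / (2 * Rabs A))) with (d / 2) by (field; lra). lra.
- assert (Q3 : Rabs (B * q) <= / 2).
  { rewrite Rabs_mult, (Rabs_pos_eq q) by lra.
    apply Rle_trans with (Rabs B * / (2 * (Rabs B + 1))); [apply Rmult_le_compat_l; lra|].
    apply Rmult_le_reg_r with (2 * (Rabs B + 1)); [lra|].
    rewrite Rmult_assoc, Rinv_l by lra. lra. }
  apply Rabs_le_between in Q3.
  replace (A * (A * q) + B * (A * q) ^ 2) with (A ^ 2 * q * (1 + B * q)) by ring.
  assert (0 < A ^ 2) by (generalize (Rsqr_pos_lt A HA); unfold Rsqr; simpl; lra).
  apply Rmult_lt_0_compat; [apply Rmult_lt_0_compat; lra|lra].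
Qed.

Lemma exp_difference_sign (g s d : R) :
  s <> 0 -> 0 < d ->
  exists t, Rabs t < d /\ 0 < s * (exp (PI * (- g + t)) - exp (- (PI * g))).
Proof.
intros Hs Hd. assert (Hpi := PI_RGT_0).
destruct (Rtotal_order s 0) as [H|[H|H]]; [|easy|].
- exists (- (d / 2)). rewrite Rabs_Ropp, Rabs_pos_eq by lra. split; [lra|].
  assert (exp (PI * (- g + - (d / 2))) < exp (- (PI * g))) by (apply exp_increasing; nra). nra.
- exists (d / 2). rewrite Rabs_pos_eq by lra. split; [lra|].
  assert (exp (- (PI * g)) < exp (PI * (- g + d / 2))) by (apply exp_increasing; nra). nra.
Qed.

(** Hyperbolicity is stated for some series, so the linear coefficient must be shown unique. Two
    series with the same sum on (0, r) have linear coefficients differing by at most M u for all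
    small u > 0. *)
Lemma displacement_series_linear (p : params) (a : nat -> R) :
  displacement_series p a -> a 1%nat = gap_series p 0%nat.
Proof.
intros [A0 [r [Hr Ha]]].
destruct (params_box_exists p) as [K [HK Hp]].
assert (Hrho := half_radius_pos K HK). assert (HD := half_domain_pos K HK).
assert (HG := gap_series_bound K p HK Hp).
set (C := 2 * (box_bound K + 1)) in *. set (rho := half_radius K) in *.
(* Convergence at r / 2 forces the radius to be at least r / 2, which leaves room around r / 4. *)
assert (Hrad : Rbar_lt (Rabs (r / 4)) (CV_radius a)).
{ apply Rbar_lt_le_trans with (Finite (Rabs (r / 2))).
  - simpl. rewrite !Rabs_pos_eq; lra.
  - apply Rbar_not_lt_le. intros Hlt. apply (CV_disk_outside a (r / 2) Hlt).
    destruct (Ha (r / 2) ltac:(lra)) as (_ & _ & Hs).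
    apply ex_series_lim_0. exists (Defs.Delta p (r / 2)).
    exact (proj1 (is_pseries_R a (r / 2) _) Hs). }
destruct (has_sum_intro _ _ Hrad) as [[r' [Hr' Hsm]] _].
rewrite Rabs_pos_eq in Hr' by lra.
destruct (abs_summable_geometric r' a ltac:(lra) Hsm) as [C' HC'].
assert (HC'' := geometric_bound_decr C' r' a ltac:(lra) HC').
set (M := 2 * (C' / r') / r' + 2 * C / rho).
assert (Hclose : forall u, 0 < u < Rmin (r / 8) (Rmin (half_domain K) (rho / 2)) ->
  Rabs (a 1%nat - gap_series p 0%nat) <= M * u).
{ intros u Hu.
  assert (V1 := Rmin_l (r / 8) (Rmin (half_domain K) (rho / 2))).
  assert (V2 := Rmin_r (r / 8) (Rmin (half_domain K) (rho / 2))).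
  assert (V3 := Rmin_l (half_domain K) (rho / 2)). assert (V4 := Rmin_r (half_domain K) (rho / 2)).
  destruct (Ha u ltac:(lra)) as (_ & _ & Hs). apply is_pseries_unique in Hs.
  rewrite (PSeries_decr C' r') in Hs by (try easy; try lra; rewrite Rabs_pos_eq; lra).
  rewrite A0, (Delta_gap K) in Hs by (try easy; lra).
  assert (E : PSeries (PS_decr_1 a) u = gap_sum p u).
  { apply Rmult_eq_reg_l with u; lra. }
  assert (B1 := PSeries_near_0 _ r' u _ ltac:(lra) HC'' ltac:(rewrite Rabs_pos_eq; lra)).
  assert (B2 := PSeries_near_0 _ rho u _ (proj1 Hrho) HG ltac:(rewrite Rabs_pos_eq; lra)).
  fold (gap_sum p u) in B2. rewrite E in B1. rewrite (Rabs_pos_eq u) in B1, B2 by lra.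
  change (PS_decr_1 a 0%nat) with (a 1%nat) in B1.
  unfold M. rewrite Rmult_plus_distr_r.
  replace (a 1%nat - gap_series p 0%nat) with
    ((gap_sum p u - gap_series p 0%nat) - (gap_sum p u - a 1%nat)) by ring.
  unfold Rminus at 1. eapply Rle_trans; [apply Rabs_triang|]. rewrite Rabs_Ropp. lra. }
apply Rminus_diag_uniq. apply Rabs_eq_0.
apply Rle_antisym; [|apply Rabs_pos].
apply Rnot_lt_le. intros Hpos. set (e := Rabs (a 1%nat - gap_series p 0%nat)) in *.
set (u := Rmin (Rmin (r / 8) (Rmin (half_domain K) (rho / 2)) / 2) (e / (2 * (Rabs M + 1)))).
assert (HM := Rabs_pos M).
assert (U0 : 0 < u).
{ apply Rmin_glb_lt; [|apply Rdiv_lt_0_compat; lra].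
  apply Rdiv_lt_0_compat; [|lra]. repeat apply Rmin_glb_lt; lra. }
assert (U1 : u <= Rmin (r / 8) (Rmin (half_domain K) (rho / 2)) / 2) by apply Rmin_l.
assert (U2 : u <= e / (2 * (Rabs M + 1))) by apply Rmin_r.
specialize (Hclose u ltac:(lra)).
assert (M * u <= (Rabs M + 1) * (e / (2 * (Rabs M + 1)))).
{ apply Rle_trans with ((Rabs M + 1) * u).
  - apply Rmult_le_compat_r; [lra|]. generalize (Rle_abs M). lra.
  - apply Rmult_le_compat_l; lra. }
replace ((Rabs M + 1) * (e / (2 * (Rabs M + 1)))) with (e / 2) in * by (field; lra).
lra.
Qed.

Lemma gap_series_0_eq_0 (p : params) :
  gap_series p 0%nat = 0 <-> gamma_L p + gamma_R p = 0.
Proof.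
rewrite gap_series_0. assert (Hpi := PI_RGT_0). split; intros H.
- assert (E : PI * gamma_R p = - (PI * gamma_L p)) by (apply exp_inv; lra). nra.
- replace (- (PI * gamma_L p)) with (PI * gamma_R p) by nra. ring.
Qed.

Lemma infinity_hyperbolic_iff (p : params) :
  infinity_hyperbolic p <-> gamma_L p + gamma_R p <> 0.
Proof.
rewrite <- gap_series_0_eq_0. split.
- intros [a [Ha H1]]. now rewrite <- (displacement_series_linear p a Ha).
- intros H. exists (shift (gap_series p)). split; [apply displacement_series_gap|exact H].
Qed.

Lemma infinity_nonhyperbolic_iff (p : params) :
  infinity_nonhyperbolic p <-> gamma_L p + gamma_R p = 0.
Proof.
rewrite <- gap_series_0_eq_0. split.
- intros [a [Ha H1]]. now rewrite <- (displacement_series_linear p a Ha).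
- intros H. exists (shift (gap_series p)). split; [apply displacement_series_gap|exact H].
Qed.

Lemma gap_series_1_sign (gL b xL xR : R) :
  let crit := Params gL (- gL) b xL xR in
  (y_L crit - y_R crit < 0 -> 0 < gap_series crit 1%nat) /\
  (y_L crit - y_R crit > 0 -> gap_series crit 1%nat < 0).
Proof.
intros crit.
assert (E := gap_series_1 crit eq_refl). cbv zeta in E.
set (c := exp (- (PI * gamma_L crit))) in *.
assert (Hc : 0 < c) by apply exp_pos. assert (Hcc : 0 < c * (1 + c)) by nra.
rewrite E. split; intros H; nra.
Qed.

Lemma gap_series_0_sign (gL gR b xL xR : R) :
  let p := Params gL gR b xL xR in
  (gL < - gR <-> gap_series p 0%nat < 0) /\ (gL > - gR <-> 0 < gap_series p 0%nat).
Proof.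
intros p. unfold p. rewrite gap_series_0. simpl. assert (Hpi := PI_RGT_0).
assert (Hm : forall x y, x < y -> exp (PI * x) < exp (PI * y)) by
  (intros; apply exp_increasing; nra).
rewrite Ropp_mult_distr_r.
destruct (Rtotal_order gR (- gL)) as [H|[H|H]].
- specialize (Hm _ _ H). split; split; lra.
- rewrite H. split; split; lra.
- specialize (Hm _ _ H). split; split; lra.
Qed.

Lemma stable_cycle_bifurcates (gL b xL xR : R) :
  let fam := fun gR => Params gL gR b xL xR in
  let crit := fam (- gL) in
  y_L crit - y_R crit < 0 ->
  one_cycle_bifurcates_from_infinity fam (- gL) (fun gR => gL < - gR) stable_cycle.
Proof.
intros fam crit H. apply (one_cycle_criterion gL b xL xR 1).
- lra.
- rewrite Rmult_1_l. now apply gap_series_1_sign.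
- intros m. rewrite Rmult_1_l. apply gap_series_0_sign.
- intros K r u p HK Hp Hr Hu H0 Hneg Hpos.
  apply (stable_cycle_criterion K r); auto.
  + intros v Hv. specialize (Hneg v Hv). lra.
  + intros v Hv. specialize (Hpos v Hv). lra.
Qed.

Lemma unstable_cycle_bifurcates (gL b xL xR : R) :
  let fam := fun gR => Params gL gR b xL xR in
  let crit := fam (- gL) in
  y_L crit - y_R crit > 0 ->
  one_cycle_bifurcates_from_infinity fam (- gL) (fun gR => gL > - gR) unstable_cycle.
Proof.
intros fam crit H. apply (one_cycle_criterion gL b xL xR (-1)).
- lra.
- assert (gap_series crit 1%nat < 0) by now apply gap_series_1_sign.
  change (0 < -1 * gap_series crit 1%nat). lra.
- intros m. destruct (gap_series_0_sign gL m b xL xR) as [_ E]. rewrite E. split; lra.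
- intros K r u p HK Hp Hr Hu H0 Hneg Hpos.
  apply (unstable_cycle_criterion K r); auto.
  + intros v Hv. specialize (Hneg v Hv). lra.
  + intros v Hv. specialize (Hpos v Hv). lra.
Qed.

Lemma small_cycle_of_bifurcation (fam : R -> params) (m0 : R) (side : R -> Prop)
    (st : params -> R -> Prop) :
  one_cycle_bifurcates_from_infinity fam m0 side st ->
  (forall d, 0 < d -> exists m, Rabs (m - m0) < d /\ side m) ->
  forall eta r, 0 < eta -> 0 < r ->
  exists m u, Rabs (m - m0) < eta /\ 0 < u < r /\ limit_cycle (fam m) u.
Proof.
intros (eps & r0 & u & He & Hr0 & Hu & Hlim & _) Hside eta r Heta Hr.
assert (Hl : locally 0 (fun z => Rabs (z - 0) < r)).
{ exists (mkposreal r Hr). intros z Hz. exact Hz. }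
destruct (locally_Rabs _ _ (Hlim _ Hl)) as [d [Hd Hdu]].
destruct (Hside (Rmin d (Rmin eps eta))) as [m [Hm Hs]]; [repeat apply Rmin_glb_lt; lra|].
assert (V1 := Rmin_l d (Rmin eps eta)). assert (V2 := Rmin_r d (Rmin eps eta)).
assert (V3 := Rmin_l eps eta). assert (V4 := Rmin_r eps eta).
destruct (Hu m ltac:(lra) Hs) as (Hum & Hc & _).
specialize (Hdu m ltac:(lra) Hs). rewrite Rminus_0_r, Rabs_pos_eq in Hdu by lra.
exists m, (u m). split; [lra|]. split; [lra|easy].
Qed.

Lemma degenerate_hopf_iff (p : params) :
  degenerate_hopf_at_infinity p <-> gamma_L p + gamma_R p = 0.
Proof.
split; [intros [H _]; now apply infinity_nonhyperbolic_iff|].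
intros E. split; [now apply infinity_nonhyperbolic_iff|].
intros eta r Heta Hr.
destruct p as [gL gR b xL xR]; simpl in E.
assert (gR = - gL) by lra. subst gR.
(* after a small change of b one of the two cases of the simple bifurcation applies *)
assert (Hb : exists b', Rabs (b' - b) < eta /\
  y_L (Params gL (- gL) b' xL xR) - y_R (Params gL (- gL) b' xL xR) <> 0).
{ unfold y_L, y_R; simpl. destruct (Req_dec b (gL * (xL + xR))) as [->|Hne].
  - exists (gL * (xL + xR) + eta / 2). split; [|lra].
    replace (gL * (xL + xR) + eta / 2 - gL * (xL + xR)) with (eta / 2) by ring.
    rewrite Rabs_pos_eq; lra.
  - exists b. rewrite Rminus_diag, Rabs_R0. split; [easy|lra]. }
destruct Hb as [b' [Hb' Hy]].
assert (Hcyc : exists m u, Rabs (m - - gL) < eta /\ 0 < u < r /\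
  limit_cycle (Params gL m b' xL xR) u).
{ destruct (Rtotal_order (y_L (Params gL (- gL) b' xL xR) - y_R (Params gL (- gL) b' xL xR)) 0)
    as [H|[H|H]]; [|easy|].
  - apply (small_cycle_of_bifurcation _ _ _ _ (stable_cycle_bifurcates gL b' xL xR H)); auto.
    intros d Hd. exists (- gL - d / 2). split; [|lra].
    replace (- gL - d / 2 - - gL) with (- (d / 2)) by ring.
    rewrite Rabs_Ropp, Rabs_pos_eq; lra.
  - apply (small_cycle_of_bifurcation _ _ _ _ (unstable_cycle_bifurcates gL b' xL xR H)); auto.
    intros d Hd. exists (- gL + d / 2). split; [|lra].
    replace (- gL + d / 2 - - gL) with (d / 2) by ring.
    rewrite Rabs_pos_eq; lra. }
destruct Hcyc as (m & u & Hm & Hu & Hlc).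
exists (Params gL m b' xL xR), u.
unfold params_close; simpl. rewrite !Rminus_diag, Rabs_R0. tauto.
Qed.

Lemma exp_cubic_facts (g : R) :
  g <> 0 -> let c := exp (- (PI * g)) in 0 < c /\ 1 - c ^ 2 <> 0.
Proof.
intros Hg c. assert (Hc : 0 < c) by apply exp_pos. split; [easy|].
assert (Hc1 : c <> 1).
{ unfold c. rewrite <- exp_0. intros E. apply exp_inv in E. generalize PI_RGT_0. nra. }
intros E. apply Hc1. nra.
Qed.

(** * The families of (b) and (c) *)

Definition family2 (gL xL xR : R) (mu : R * R) : params :=
  Params gL (fst mu) (snd mu) xL xR.

Definition family3 (gL xL : R) (mu : R * R * R) : params :=
  Params gL (fst (fst mu)) (snd (fst mu)) xL (snd mu).

Lemma continuous_family2 (gL xL xR : R) (mu : R * R) :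
  continuous_params (family2 gL xL xR) mu.
Proof.
unfold continuous_params, family2; simpl.
repeat split; try apply continuous_const; [apply continuous_fst|apply continuous_snd].
Qed.

Lemma continuous_family3 (gL xL : R) (mu : R * R * R) :
  continuous_params (family3 gL xL) mu.
Proof.
unfold continuous_params, family3; simpl.
repeat split; try apply continuous_const.
- apply (continuous_comp fst fst); apply continuous_fst.
- apply (continuous_comp fst snd); [apply continuous_fst|apply continuous_snd].
- apply continuous_snd.
Qed.

Lemma gap_series_1_line (gL b xL xR t : R) :
  let c := exp (- (PI * gL)) in
  gap_series (Params gL (- gL) (b + t) xL xR) 1%nat =
  2 * c * (1 + c) * (b - gL * (xL + xR)) + 2 * c * (1 + c) * t.
Proof.
intros c. rewrite gap_series_1 by reflexivity. unfold y_L, y_R; simpl. fold c. ring.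
Qed.

(** The line stays on b = gL (xL + xR), so [gap_series_2] applies, and xL^2 - xR^2 = - 2 xL t -
    t^2. *)
Lemma gap_series_2_line (gL xL t : R) :
  let c := exp (- (PI * gL)) in
  gap_series (Params gL (- gL) (2 * gL * xL + gL * t) xL (xL + t)) 2%nat =
  - (c * (1 - c ^ 2) * (1 + gL ^ 2) * xL) * t - c * (1 - c ^ 2) * (1 + gL ^ 2) / 2 * t ^ 2.
Proof.
intros c. rewrite gap_series_2; simpl; [fold c; field|reflexivity|ring].
Qed.

Notation RxR := (prod_NormedModule R_AbsRing R_NormedModule R_NormedModule).
Notation RxRxR := (prod_NormedModule R_AbsRing RxR R_NormedModule).

Lemma line_RxR (a b p q t : R) :
  line (U := RxR) (a, b) (p, q) t = (a + t * p, b + t * q).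
Proof. reflexivity. Qed.

Lemma line_RxRxR (a b c p q s t : R) :
  line (U := RxRxR) (a, b, c) (p, q, s) t = (a + t * p, b + t * q, c + t * s).
Proof. reflexivity. Qed.

Lemma is_derive_gap_series_0 (gL b xL xR : R) :
  let c := exp (- (PI * gL)) in
  PI * c <> 0 /\
  is_derive (fun t => gap_series (Params gL (- gL + t * 1) b xL xR) 0%nat) 0 (PI * c).
Proof.
intros c. split.
{ apply Rmult_integral_contrapositive_currified; [generalize PI_RGT_0; lra|].
  apply Rgt_not_eq, exp_pos. }
apply (is_derive_ext (fun t => exp (PI * (- gL + t)) - c)).
{ intros t. rewrite gap_series_0. simpl. rewrite Rmult_1_r. reflexivity. }
auto_derive; [easy|]. rewrite Rplus_0_r. unfold c. rewrite <- Ropp_mult_distr_r. ring.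
Qed.

Lemma is_derive_gap_series_1 (gL b xL xR : R) :
  let c := exp (- (PI * gL)) in
  2 * c * (1 + c) <> 0 /\
  is_derive (fun t => gap_series (Params gL (- gL + t * 0) (b + t * 1) xL xR) 1%nat) 0
    (2 * c * (1 + c)).
Proof.
intros c. split.
{ assert (Hc : 0 < c) by apply exp_pos. apply Rgt_not_eq; nra. }
apply (is_derive_ext (fun t =>
  2 * c * (1 + c) * (b - gL * (xL + xR)) + 2 * c * (1 + c) * t)).
{ intros t. rewrite Rmult_0_r, Rplus_0_r, Rmult_1_r. symmetry. apply gap_series_1_line. }
auto_derive; [easy|ring].
Qed.

Lemma gap_series_2_neq_0 (gL xL xR : R) :
  gL <> 0 -> xL ^ 2 - xR ^ 2 <> 0 ->
  gap_series (Params gL (- gL) (gL * (xL + xR)) xL xR) 2%nat <> 0.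
Proof.
intros Hg Hx. destruct (exp_cubic_facts gL Hg) as [Hc Hc2].
rewrite gap_series_2 by reflexivity. simpl gamma_L. simpl x_L. simpl x_R.
assert (0 < 1 + gL ^ 2) by (generalize (pow2_ge_0 gL); lra).
apply Rmult_integral_contrapositive_currified; [|lra].
repeat apply Rmult_integral_contrapositive_currified; try easy; lra.
Qed.

(** gamma_R moves coefficient 0; then b, with gamma_R kept critical, leaves coefficient 0 at zero
    and moves coefficient 1. *)
Lemma codimension_2 (gL xL xR : R) :
  gL <> 0 -> xL ^ 2 - xR ^ 2 <> 0 ->
  codimension_bifurcation_point 2 (family2 gL xL xR) (- gL, gL * (xL + xR)).
Proof.
intros Hg Hx.
set (c := exp (- (PI * gL))).
set (mu := (- gL, gL * (xL + xR)) : R * R).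
assert (F1 : forall b xR', gap_series (Params gL (- gL) b xL xR') 0%nat = 0).
{ intros. apply gap_series_0_eq_0. simpl. ring. }
apply (codimension_of_triangular (U := RxR) 2 _ mu
  (fun j => match j with O => (1, 0) | _ => (0, 1) end)).
- intros [|[|i]] Hi; [apply F1| |lia].
  unfold mu, family2; simpl. rewrite gap_series_1 by reflexivity.
  unfold y_L, y_R; simpl. ring.
- now apply gap_series_2_neq_0.
- intros i Hi. unfold family2.
  apply (ex_filterdiff_gap_series (U := RxR)
    (fun _ => gL) fst snd (fun _ => xL) (fun _ => xR)); [| | | | |lia].
  + apply ex_filterdiff_Rconst.
  + apply ex_filterdiff_linear, is_linear_fst.
  + apply ex_filterdiff_linear, is_linear_snd.
  + apply ex_filterdiff_Rconst.
  + apply ex_filterdiff_Rconst.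
- intros [|[|j]] i t Hij; [lia| |lia]. assert (i = 0%nat) by lia. subst i.
  unfold mu. rewrite line_RxR. apply gap_series_0_eq_0. simpl. ring.
- intros [|[|j]] Hj; [| |lia].
  + exists (PI * c). split; [now apply is_derive_gap_series_0|].
    apply (is_derive_ext (fun t => gap_series
      (Params gL (- gL + t * 1) (gL * (xL + xR)) xL xR) 0%nat)).
    { intros t. unfold mu. rewrite line_RxR, !gap_series_0. reflexivity. }
    now apply is_derive_gap_series_0.
  + exists (2 * c * (1 + c)). apply (is_derive_gap_series_1 gL (gL * (xL + xR)) xL xR).
Qed.

Lemma gap_series_3_neq_0 (gL xL : R) :
  gL <> 0 -> xL <> 0 -> gap_series (Params gL (- gL) (2 * gL * xL) xL xL) 3%nat <> 0.
Proof.
intros Hg Hx. rewrite gap_series_3 by reflexivity. simpl gamma_L. simpl x_L.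
set (c := exp (- (PI * gL))). assert (Hc : 0 < c) by apply exp_pos.
assert (0 < 1 + gL ^ 2) by (generalize (pow2_ge_0 gL); lra).
assert (0 < c ^ 3) by now apply pow_lt.
apply Ropp_neq_0_compat.
repeat apply Rmult_integral_contrapositive_currified; try easy; try lra.
Qed.

Lemma gap_series_2_line_coefficient (gL xL : R) :
  gL <> 0 -> xL <> 0 ->
  let c := exp (- (PI * gL)) in c * (1 - c ^ 2) * (1 + gL ^ 2) * xL <> 0.
Proof.
intros Hg Hx c. destruct (exp_cubic_facts gL Hg) as [Hc Hc2]. fold c in Hc, Hc2.
assert (0 < 1 + gL ^ 2) by (generalize (pow2_ge_0 gL); lra).
repeat apply Rmult_integral_contrapositive_currified; try easy; lra.
Qed.

(* The third direction is tangent to the curve b = gL (xL + xR), on which the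
   first two coefficients vanish. *)
Lemma codimension_3 (gL xL : R) :
  gL <> 0 -> xL <> 0 ->
  codimension_bifurcation_point 3 (family3 gL xL) (- gL, 2 * gL * xL, xL).
Proof.
intros Hg Hx.
set (c := exp (- (PI * gL))).
set (mu := (- gL, 2 * gL * xL, xL) : R * R * R).
assert (F0 : forall b xR, gap_series (Params gL (- gL) b xL xR) 0%nat = 0).
{ intros. apply gap_series_0_eq_0. simpl. ring. }
assert (F1 : forall t, gap_series (Params gL (- gL) (2 * gL * xL + gL * t) xL (xL + t)) 1%nat = 0).
{ intros. rewrite gap_series_1 by reflexivity. unfold y_L, y_R; simpl. ring. }
assert (E2 : forall t, gap_series (family3 gL xL (line (U := RxRxR) mu (0, gL, 1) t)) =
  gap_series (Params gL (- gL) (2 * gL * xL + gL * t) xL (xL + t))).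
{ intros t. unfold mu. rewrite line_RxRxR. unfold family3. simpl fst. simpl snd.
  f_equal. f_equal; ring. }
apply (codimension_of_triangular (U := RxRxR) 3 _ mu
  (fun j => match j with O => (1, 0, 0) | 1%nat => (0, 1, 0) | _ => (0, gL, 1) end)).
- intros [|[|[|i]]] Hi; [apply F0| | |lia].
  + assert (F := F1 0). rewrite Rmult_0_r, !Rplus_0_r in F. exact F.
  + assert (F := gap_series_2_line gL xL 0). cbv zeta in F.
    rewrite Rmult_0_r, !Rplus_0_r in F. etransitivity; [exact F|]. simpl. ring.
- now apply gap_series_3_neq_0.
- intros i Hi. unfold family3.
  apply (ex_filterdiff_gap_series (U := RxRxR) (fun _ => gL) (fun nu => fst (fst nu))
    (fun nu => snd (fst nu)) (fun _ => xL) snd); [| | | | |lia].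
  + apply ex_filterdiff_Rconst.
  + apply ex_filterdiff_linear. apply (is_linear_comp fst fst); apply is_linear_fst.
  + apply ex_filterdiff_linear.
    apply (is_linear_comp fst snd); [apply is_linear_fst|apply is_linear_snd].
  + apply ex_filterdiff_Rconst.
  + apply ex_filterdiff_linear, is_linear_snd.
- intros [|[|[|j]]] i t Hij; [lia| | |lia].
  + assert (i = 0%nat) by lia. subst i.
    unfold mu. rewrite line_RxRxR. apply gap_series_0_eq_0. simpl. ring.
  + rewrite E2. destruct i as [|[|i]]; [apply F0|apply F1|lia].
- intros [|[|[|j]]] Hj; [| | |lia].
  + exists (PI * c). split; [now apply is_derive_gap_series_0|].
    apply (is_derive_ext (fun t => gap_series
      (Params gL (- gL + t * 1) (2 * gL * xL) xL xL) 0%nat)).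
    { intros t. unfold mu. rewrite line_RxRxR, !gap_series_0. reflexivity. }
    now apply is_derive_gap_series_0.
  + exists (2 * c * (1 + c)). split; [now apply is_derive_gap_series_1|].
    apply (is_derive_ext (fun t => gap_series
      (Params gL (- gL + t * 0) (2 * gL * xL + t * 1) xL xL) 1%nat)).
    { intros t. unfold mu. rewrite line_RxRxR. unfold family3; simpl.
      do 2 f_equal. ring. }
    now apply is_derive_gap_series_1.
  + exists (- (c * (1 - c ^ 2) * (1 + gL ^ 2) * xL)). split.
    { now apply Ropp_neq_0_compat, gap_series_2_line_coefficient. }
    apply (is_derive_ext (fun t => - (c * (1 - c ^ 2) * (1 + gL ^ 2) * xL) * t
       - c * (1 - c ^ 2) * (1 + gL ^ 2) / 2 * t ^ 2)).
    { intros t. rewrite E2. symmetry. apply gap_series_2_line. }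
    auto_derive; [easy|ring].
Qed.

Lemma gap_series_1_line_sign (gL b xL xR s d : R) :
  b = gL * (xL + xR) -> s <> 0 -> 0 < d ->
  exists t, Rabs t < d /\ 0 < s * gap_series (Params gL (- gL) (b + t) xL xR) 1%nat.
Proof.
intros -> Hs Hd. set (c := exp (- (PI * gL))). assert (Hc : 0 < c) by apply exp_pos.
destruct (quadratic_sign (s * (2 * c * (1 + c))) 0 d) as [t [Ht Hp]]; [|easy|].
{ apply Rmult_integral_contrapositive_currified; [easy|]. apply Rgt_not_eq. nra. }
exists t. split; [easy|]. rewrite gap_series_1_line. fold c. lra.
Qed.

(** Coefficients are released from the highest down: b gives coefficient 1 the sign of - s while
    coefficient 0 is still 0, then gamma_R gives coefficient 0 the sign of s. The signs s, - s, s
    enclose two zeros. *)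
Lemma up_to_2_cycles (gL xL xR : R) :
  gL <> 0 -> xL ^ 2 - xR ^ 2 <> 0 ->
  up_to_cycles_bifurcate 2 (family2 gL xL xR) (- gL, gL * (xL + xR)).
Proof.
intros Hg Hx.
set (mu := (- gL, gL * (xL + xR)) : R * R).
assert (F0 : forall b, gap_series (Params gL (- gL) b xL xR) 0%nat = 0).
{ intros. apply gap_series_0_eq_0. simpl. ring. }
assert (F1 : gap_series (family2 gL xL xR mu) 1%nat = 0).
{ unfold mu, family2; simpl. rewrite gap_series_1 by reflexivity.
  unfold y_L, y_R; simpl. ring. }
assert (F2 : gap_series (family2 gL xL xR mu) 2%nat <> 0) by now apply gap_series_2_neq_0.
apply up_to_cycles_of_alternation; [apply continuous_family2|exact F2|].
intros K r N HK Hr HN HB.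
set (s := gap_series (family2 gL xL xR mu) 2%nat) in *.
assert (A0 : alternates (gap_sum (family2 gL xL xR mu)) s 0 r 0).
{ apply (gap_alternates_0 K r s _ 2); auto; try lra.
  - apply HB. now apply locally_singleton.
  - intros [|[|i]] Hi; [apply F0|exact F1|lia].
  - fold s. nra. }
destruct (alternation_line (U := RxR) K r s (family2 gL xL xR) mu (0, 1) N 1 0)
  as [t [HN1 A1]]; auto using continuous_family2.
- intros t i Hi. assert (i = 0%nat) by lia. subst i.
  unfold mu. rewrite line_RxR. apply gap_series_0_eq_0. simpl. ring.
- intros d Hd.
  destruct (gap_series_1_line_sign gL (gL * (xL + xR)) xL xR (- s) d) as [t [Ht Hp]]; auto.
  { now apply Ropp_neq_0_compat. }
  exists t. split; [easy|]. unfold mu. rewrite line_RxR. unfold family2; simpl.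
  now rewrite Rmult_0_r, Rplus_0_r, Rmult_1_r.
- unfold mu in HN1, A1. rewrite line_RxR, Rmult_0_r, Rplus_0_r, Rmult_1_r in HN1, A1.
  destruct (alternation_line (U := RxR) K r (- s) (family2 gL xL xR)
    (- gL, gL * (xL + xR) + t) (1, 0) N 0 1) as [t' [HN2 A2]];
    auto using continuous_family2.
  + intros; lia.
  + intros d Hd. rewrite Ropp_involutive.
    destruct (exp_difference_sign gL s d F2 Hd) as [t' [Ht' Hp]].
    exists t'. split; [easy|]. rewrite line_RxR, gap_series_0. simpl.
    now rewrite Rmult_1_r.
  + eexists. eexists. split; [apply locally_singleton, HN2|exact A2].
Qed.

(** Here b and x_R first move together along b = gL (xL + xR) to release coefficient 2; then b alone
    releases coefficient 1 and gamma_R coefficient 0. *)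
Lemma up_to_3_cycles (gL xL : R) :
  gL <> 0 -> xL <> 0 ->
  up_to_cycles_bifurcate 3 (family3 gL xL) (- gL, 2 * gL * xL, xL).
Proof.
intros Hg Hx.
set (mu := (- gL, 2 * gL * xL, xL) : R * R * R).
assert (F0 : forall b xR, gap_series (Params gL (- gL) b xL xR) 0%nat = 0).
{ intros. apply gap_series_0_eq_0. simpl. ring. }
assert (F1 : forall t, gap_series (Params gL (- gL) (2 * gL * xL + gL * t) xL (xL + t)) 1%nat = 0).
{ intros. rewrite gap_series_1 by reflexivity. unfold y_L, y_R; simpl. ring. }
assert (F2 := gap_series_2_line gL xL).
assert (L3 : forall t, line (U := RxRxR) mu (0, gL, 1) t =
  (- gL, 2 * gL * xL + gL * t, xL + t)).
{ intros t. unfold mu. rewrite line_RxRxR. f_equal; [f_equal|]; ring. }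
assert (F3 : gap_series (family3 gL xL mu) 3%nat <> 0) by now apply gap_series_3_neq_0.
apply up_to_cycles_of_alternation; [apply continuous_family3|exact F3|].
intros K r N HK Hr HN HB.
set (s := gap_series (family3 gL xL mu) 3%nat) in *.
assert (A0 : alternates (gap_sum (family3 gL xL mu)) s 0 r 0).
{ apply (gap_alternates_0 K r s _ 3); auto; try lra.
  - apply HB. now apply locally_singleton.
  - intros [|[|[|i]]] Hi; [apply F0| | |lia].
    + specialize (F1 0). rewrite Rmult_0_r, !Rplus_0_r in F1. exact F1.
    + specialize (F2 0). cbv zeta in F2. rewrite Rmult_0_r, !Rplus_0_r in F2.
      etransitivity; [exact F2|]. simpl. ring.
  - fold s. nra. }
destruct (alternation_line (U := RxRxR) K r s (family3 gL xL) mu (0, gL, 1) N 2 0)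
  as [t [HN1 A1]]; auto using continuous_family3.
- intros t i Hi. rewrite L3. destruct i as [|[|i]]; [apply F0|apply F1|lia].
- intros d Hd.
  assert (Hc := gap_series_2_line_coefficient gL xL Hg Hx). cbv zeta in Hc, F2.
  set (c := exp (- (PI * gL))) in *.
  (* Coefficient 2 is quadratic in t with nonzero linear part, so it takes the required sign for
     arbitrarily small t. *)
  destruct (quadratic_sign (s * (c * (1 - c ^ 2) * (1 + gL ^ 2) * xL))
    (s * (c * (1 - c ^ 2) * (1 + gL ^ 2) / 2)) d) as [t [Ht Hp]]; [|easy|].
  { now apply Rmult_integral_contrapositive_currified. }
  exists t. split; [easy|]. rewrite L3. unfold family3. simpl fst. simpl snd.
  rewrite F2. lra.
- rewrite L3 in HN1, A1.
  set (b := 2 * gL * xL + gL * t) in *. set (xR := xL + t) in *.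
  assert (Hs : - s <> 0) by now apply Ropp_neq_0_compat.
  destruct (alternation_line (U := RxRxR) K r (- s) (family3 gL xL) (- gL, b, xR) (0, 1, 0) N 1 1)
    as [t1 [HN2 A2]]; auto using continuous_family3.
  + intros t1 i Hi. assert (i = 0%nat) by lia. subst i.
    rewrite line_RxRxR. apply gap_series_0_eq_0. simpl. ring.
  + intros d Hd. rewrite Ropp_involutive.
    destruct (gap_series_1_line_sign gL b xL xR s d) as [t1 [Ht Hp]]; auto.
    { unfold b, xR. ring. }
    exists t1. split; [easy|]. rewrite line_RxRxR. unfold family3; simpl.
    now rewrite !Rmult_0_r, !Rplus_0_r, Rmult_1_r.
  + rewrite line_RxRxR, !Rmult_0_r, !Rplus_0_r, Rmult_1_r in HN2, A2.
    rewrite Ropp_involutive in A2.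
    destruct (alternation_line (U := RxRxR) K r s (family3 gL xL)
      (- gL, b + t1, xR) (1, 0, 0) N 0 2) as [t2 [HN3 A3]]; auto using continuous_family3.
    * intros; lia.
    * intros d Hd.
      destruct (exp_difference_sign gL (- s) d Hs Hd) as [t2 [Ht Hp]].
      exists t2. split; [easy|]. rewrite line_RxRxR, gap_series_0. simpl.
      now rewrite Rmult_1_r.
    * eexists. eexists. split; [apply locally_singleton, HN3|exact A3].
Qed.

Theorem theorem8 :
  (forall p : params,
     (infinity_hyperbolic p <-> gamma_L p + gamma_R p <> 0) /\
     (degenerate_hopf_at_infinity p <-> gamma_L p + gamma_R p = 0)) /\
  (* (a) *)
  (forall gL b xL xR : R,
     let fam := fun gR : R => Params gL gR b xL xR in
     let crit := fam (- gL) in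
     (y_L crit - y_R crit <> 0 <-> b - gL * (xL + xR) <> 0) /\
     (y_L crit - y_R crit < 0 ->
        one_cycle_bifurcates_from_infinity fam (- gL)
          (fun gR => gL < - gR) stable_cycle) /\
     (y_L crit - y_R crit > 0 ->
        one_cycle_bifurcates_from_infinity fam (- gL)
          (fun gR => gL > - gR) unstable_cycle)) /\
  (* (b) *)
  (forall gL xL xR : R,
     gL <> 0 -> xL ^ 2 - xR ^ 2 <> 0 ->
     let fam := fun mu : R * R => Params gL (fst mu) (snd mu) xL xR in
     let crit := (- gL, gL * (xL + xR)) in
     codimension_bifurcation_point 2 fam crit /\
     up_to_cycles_bifurcate 2 fam crit) /\
  (* (c) *)
  (forall gL xL : R,
     gL <> 0 -> xL <> 0 ->
     let fam := fun mu : R * R * R =>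
       Params gL (fst (fst mu)) (snd (fst mu)) xL (snd mu) in
     let crit := (- gL, 2 * gL * xL, xL) in
     codimension_bifurcation_point 3 fam crit /\
     up_to_cycles_bifurcate 3 fam crit).
Proof.
split; [|split; [|split]].
- intros p. split; [apply infinity_hyperbolic_iff|apply degenerate_hopf_iff].
- intros gL b xL xR fam crit. split; [|split].
  + unfold crit, fam, y_L, y_R; simpl. split; intros H E; apply H; lra.
  + apply stable_cycle_bifurcates.
  + apply unstable_cycle_bifurcates.
- intros gL xL xR Hg Hx. split; [now apply codimension_2|now apply up_to_2_cycles].
- intros gL xL Hg Hx. split; [now apply codimension_3|now apply up_to_3_cycles].
Qed.
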